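(* Let $T>0$, $\gamma>0$, and let $\overline f^0(u)=\sum_{i=1}^2\int_{\mathbb T}f^0(u,k,i)\,dk$ with $f^0(\cdot,\cdot,1),f^0(\cdot,\cdot,2)\in C_c^\infty(\mathbb R\times\mathbb T)$. For $B>0$ let $\tilde\rho_B$ be the solution of $\partial_t\tilde\rho_B(t,u)=\mathfrak L_B[\tilde\rho_B](t,u)$, $t\in(0,T]$, $u\in\mathbb R$, with $\tilde\rho_B(0,\cdot)=\overline f^0$, where $\mathfrak L_B$ is defined in the context. Let $$D_0=2\kappa_0\int_0^{\infty}\frac{1-\cos r}{r^{5/2}}dr,\quad D_\infty=2\kappa_\infty\int_0^\infty\frac{1-\cos r}{r^{8/3}}dr,\quad \kappa_0=\Big(\frac1{2^{10}\pi^2}\Big)^{1/2},\quad \kappa_\infty=\Big(\frac1{2^{13}\,27\,\pi^3}\Big)^{1/3}.$$ Then: (i) $\lim_{B\to0}\tilde\rho_B=\rho_0$ in $\mathbb L^1([0,T],\mathbb L^2(\mathbb R))$, where $\rho_0$ is the solution of $$\partial_t\rho_0(t,u)=-\Gamma\big(1+\tfrac32\big)\gamma^{-1/2}D_0(-\Delta)^{3/4}[\rho_0](t,u),\qquad \rho_0(0,u)=\overline f^0(u),\qquad t\in(0,T],\ u\in\mathbb R.$$ (ii) $\lim_{B\to\infty}\tilde\rho_B(B^{1/3}\,\cdot,\cdot)=\rho_\infty$ in $\mathbb L^1([0,T],\mathbb L^2(\mathbb R))$, where $\rho_\infty$ is the solution of $$\partial_t\rho_\infty(t,u)=-\Gamma\big(1+\tfrac53\big)\gamma^{-2/3}D_\infty(-\Delta)^{5/6}[\rho_\infty](t,u),\qquad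 \rho_\infty(0,u)=\overline f^0(u),\qquad t\in(0,T],\ u\in\mathbb R.$$
   Context: $\mathbb T=[-\tfrac12,\tfrac12)$ is the one-dimensional torus; $\Gamma$ is the Gamma function; $\mathcal F[\phi](\xi)=\int_{\mathbb R}\phi(u)e^{2\mathbf i\pi\xi u}du$; for $\beta\in(1,2)$, $\mathcal F[-(-\Delta)^{\beta/2}\phi](\xi)=-|2\pi\xi|^\beta\mathcal F[\phi](\xi)$. For $B>0$ and $r\neq0$, $x_{B,\pm}(r)$ is defined implicitly by $\big(2\sqrt{x_{B,\pm}^2(r)+\tfrac{B^2}4}\pm B\big)x_{B,\pm}(r)=\frac{\pi}{\gamma r}$; for $r>0$, $h_{B,\pm}(r)=\frac1{4\pi}\int_0^{x_{B,\pm}(r)}\Big(\frac12\pm\frac{B}{4\sqrt{x^2+B^2/4}}\Big)x^2dx$; for $r<0$, $h_{B,\pm}(r)=\frac1{4\pi}\int_{x_{B,\pm}(r)}^0\Big(\frac12\pm\frac{B}{4\sqrt{x^2+B^2/4}}\Big)x^2dx$; and $g_{B,\pm}(r)=-h_{B,\pm}'(r)$ for $r>0$, $g_{B,\pm}(r)=h_{B,\pm}'(r)$ for $r<0$ (positive even functions). With $\tau_0$ exponential of parameter $1$, let $\nu$ be the Lévy measure on $\mathbb R\setminus\{0\}$ $$d\nu(r)=2\gamma\,\mathbb E\Big[\tau_0^{-1}\Big(g_{B,+}\big(\tfrac{2\pi r}{\tau_0}\big)+g_{B,-}\big(\tfrac{2\pi r}{\tau_0}\big)\Big)\Big]dr,$$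 $\Phi_B(\theta)=\int_{\mathbb R\setminus\{0\}}(e^{\mathbf i\theta r}-1+\mathbf i\theta r\mathbf 1_{\{|r|<1\}})d\nu(r)$, and $\mathfrak L_B[\phi](p)=\int_{\mathbb R}\mathcal F[\phi](\xi)\Phi_B(\xi)e^{2\mathbf i\pi p\xi}d\xi$ for $\phi\in C_c^\infty(\mathbb R)$, $p\in\mathbb R$.
   Formalization: In ν, Φ_B and 𝔏_B: τ_0^{-1} becomes 2π/τ_0, the compensator is -iθr1_{|r|<1}, the symbol is Φ_B(2πξ), the inversion kernel is e^{-2iπpξ}; as printed they diverge or give wrong constants. In (ii) ρ̃_B is the solution on [0,B^{1/3}T]. *)

(* Defs.v *)
(* [R : realType] is the field of real numbers, [R[i]] its complexification. *)
From HB Require Import structures.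
From mathcomp Require Import all_boot all_order all_algebra.
From mathcomp Require Import all_classical all_reals all_analysis.
From mathcomp Require Export complex.

Set Implicit Arguments.
Unset Strict Implicit.
Unset Printing Implicit Defensive.

Import Order.TTheory GRing.Theory Num.Theory.
Import numFieldNormedType.Exports.

Local Open Scope classical_set_scope.
Local Open Scope ring_scope.
Local Open Scope complex_scope.

Section ComplexIntegral.
Context {R : realType}.
Notation mu := (@lebesgue_measure R).

Definition cintegrable (D : set R) (f : R -> R[i]) : Prop :=
  mu.-integrable D (fun x => (complex.Re (f x))%:E) /\
  mu.-integrable D (fun x => (complex.Im (f x))%:E).

Definition cintegral (D : set R) (f : R -> R[i]) : R[i] :=
  (\int[mu]_(x in D) complex.Re (f x)) +i* (\int[mu]_(x in D) complex.Im (f x)).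

(* exp(i x) *)
Definition cis (x : R) : R[i] := cos x +i* sin x.

Definition fourier (phi : R -> R) (xi : R) : R[i] :=
  cintegral setT (fun u => (phi u)%:C * cis (2 * pi * xi * u)).

End ComplexIntegral.

Section InitialDatum.
Context {R : realType}.
Notation mu := (@lebesgue_measure R).

Definition partial (b : bool) (f : R -> R -> R) : R -> R -> R :=
  if b then fun u k => derive1 (fun x => f x k) u else fun u k => derive1 (f u) k.

Definition partials (s : seq bool) (f : R -> R -> R) : R -> R -> R :=
  foldr partial f s.

Definition smooth2 (f : R -> R -> R) : Prop :=
  forall s : seq bool,
    continuous (fun p : R * R => partials s f p.1 p.2) /\
    forall u k, derivable (fun x => partials s f x k) u 1 /\
                derivable (partials s f u) k 1.

(* C_c^oo(R x T): the torus T = [-1/2, 1/2) is compact, so functions on R x T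
   are functions on R x R that are 1-periodic in the second variable, and only
   the support in the first variable has to be bounded. *)
Definition Ccoo_torus (f : R -> R -> R) : Prop :=
  [/\ smooth2 f,
      forall u k, f u (k + 1) = f u k &
      exists M : R, forall u k, M < `|u| -> f u k = 0].

Definition fbar (f : R -> R -> 'I_2 -> R) (u : R) : R :=
  \sum_(i < 2) \int[mu]_(k in [set` `[- (1 / 2), 1 / 2[ ]) f u k i.

End InitialDatum.

(* The sign s is 1 for the index "+" and -1 for the index "-". *)
Section LevyMeasure.
Context {R : realType}.
Notation mu := (@lebesgue_measure R).
Variables (gamma B s : R).

(* The left-hand side is an increasing bijection of R as a function of x, so
   that the equation has exactly one solution. *)
Definition xB (r : R) : R :=
  xget 0 [set x : R |
    (2 * Num.sqrt (x ^+ 2 + B ^+ 2 / 4) + s * B) * x = pi / (gamma * r)].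

Definition hB_integrand (x : R) : R :=
  (1 / 2 + s * (B / (4 * Num.sqrt (x ^+ 2 + B ^+ 2 / 4)))) * x ^+ 2.

Definition hB (r : R) : R :=
  if 0 < r then
    1 / (4 * pi) * \int[mu]_(x in [set` `[0, xB r]]) hB_integrand x
  else if r < 0 then
    1 / (4 * pi) * \int[mu]_(x in [set` `[xB r, 0]]) hB_integrand x
  else 0.

Definition gB (r : R) : R :=
  if 0 < r then - derive1 hB r else if r < 0 then derive1 hB r else 0.

End LevyMeasure.

Section Operators.
Context {R : realType}.
Notation mu := (@lebesgue_measure R).

(* Density of the Levy measure nu:
     d nu(r) = 2 gamma E[(2 pi / tau) (g_+ + g_-)(2 pi r / tau)] dr,
   where tau is exponential of parameter 1, i.e. for a > 0
     nu([a, +oo)) = 2 gamma E[h_+(2 pi a / tau) + h_-(2 pi a / tau)].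
   The factor 2 pi / tau is the derivative of r |-> 2 pi r / tau.  Writing 1 / tau
   for it drops a 2 pi, and the limits as B -> 0 and B -> oo, namely
   Gamma(5/2) gamma^(-1/2) kappa_0 |r|^(-5/2) and, after multiplication by
   B^(1/3), Gamma(8/3) gamma^(-2/3) kappa_oo |r|^(-8/3), would be off by this
   same factor. *)
Definition nu_density (gamma B r : R) : R :=
  2 * gamma *
  \int[mu]_tau (exponential_pdf 1 tau *
    (2 * pi / tau *
      (gB gamma B 1 (2 * pi * r / tau) + gB gamma B (-1) (2 * pi * r / tau)))).

(* Levy-Khintchine exponent of nu.  The compensator has to be - i theta r for
   the integral to converge at 0, where nu_density behaves like |r|^(-5/2); as
   nu is even, it does not contribute to the value. *)
Definition PhiB (gamma B theta : R) : R[i] :=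
  cintegral [set r : R | r != 0] (fun r =>
    (cis (theta * r) - 1 - (theta * r * (if `|r| < 1 then 1 else 0)) *i)
      * (nu_density gamma B r)%:C).

(* Generator of the Levy process of exponent PhiB.  With [fourier] normalized by
   exp(2 i pi xi u), its symbol is PhiB(2 pi xi), as that of -(-Laplacian)^(b/2)
   is -|2 pi xi|^b, and the inverse transform has the kernel exp(-2 i pi p xi):
   with exp(2 i pi p xi), the operator would be composed with p |-> -p. *)
Definition LB_integrand (gamma B : R) (phi : R -> R) (p xi : R) : R[i] :=
  fourier phi xi * PhiB gamma B (2 * pi * xi) * cis (- (2 * pi * p * xi)).

Definition LB (gamma B : R) (phi : R -> R) (p : R) : R[i] :=
  cintegral setT (LB_integrand gamma B phi p).

(* Unbounded operators are given by their graphs: [A phi psi] means that phi is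
   in the domain of the operator and is mapped to psi. *)
Definition LB_graph (gamma B : R) (phi psi : R -> R) : Prop :=
  (forall p, cintegrable setT (LB_integrand gamma B phi p)) /\
  (forall p, (psi p)%:C = LB gamma B phi p).

(* psi = - (-Laplacian)^(beta / 2) phi *)
Definition neg_frac_lap_graph (beta : R) (phi psi : R -> R) : Prop :=
  [/\ mu.-integrable setT (EFin \o phi),
      mu.-integrable setT (EFin \o psi) &
      forall xi : R,
        fourier psi xi = - (`|2 * pi * xi| `^ beta)%:C * fourier phi xi].

Definition scale_graph (c : R) (A : (R -> R) -> (R -> R) -> Prop)
    (phi psi : R -> R) : Prop :=
  exists2 chi, A phi chi & psi = (fun u => c * chi u).

End Operators.

Section Cauchy.
Context {R : realType}.
Notation mu := (@lebesgue_measure R).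

(* norm of L^1(R) \cap L^2(R) *)
Definition norm12 (f : R -> R) : \bar R :=
  ('N[mu]_1 [EFin \o f] + 'N[mu]_(2%:E) [EFin \o f])%E.

(* [rho] is the (strong) solution on [0, S] of d/dt rho = A rho,
   rho(0, .) = f0: the curve t |-> rho(t, .) is continuous in L^1 \cap L^2, and for
   t in (0, S] it is differentiable both pointwise and in L^1 \cap L^2, with
   derivative A rho(t, .).  At t = S the derivative is from the left. *)
Record is_solution (A : (R -> R) -> (R -> R) -> Prop) (S : R) (f0 : R -> R)
    (rho : R -> R -> R) : Prop := IsSolution {
  sol_init : forall u, rho 0 u = f0 u;
  sol_space : forall t, 0 <= t <= S ->
    measurable_fun setT (rho t) /\ (norm12 (rho t) < +oo)%E;
  sol_cont : forall t, 0 <= t <= S ->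
    (fun r => norm12 (fun u => rho r u - rho t u))
      @ (within [set` `[0, S]] (nbhs t)) --> 0%E;
  sol_eq : forall t, 0 < t <= S -> exists2 drho : R -> R,
    A (rho t) drho &
    (forall u, (fun r => (r - t)^-1 * (rho r u - rho t u))
       @ (within [set` `[0, S]] (dnbhs t)) --> drho u) /\
    (fun r => norm12 (fun u => (r - t)^-1 * (rho r u - rho t u) - drho u))
       @ (within [set` `[0, S]] (dnbhs t)) --> 0%E
}.

(* distance of L^1([0, T], L^2(R)) *)
Definition distL1L2 (T : R) (rho sigma : R -> R -> R) : \bar R :=
  (\int[mu]_(t in [set` `[0%R, T]])
     'N[mu]_(2%:E) [(fun u => (rho t u - sigma t u)%:E)])%E.

End Cauchy.

Section Constants.
Context {R : realType}.
Notation mu := (@lebesgue_measure R).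

Definition Gamma (a : R) : R :=
  \int[mu]_(x in [set` `]0, +oo[ ]) (x `^ (a - 1) * expR (- x)).

Definition kappa_0 : R := (1 / (2 ^+ 10 * pi ^+ 2)) `^ (1 / 2).

Definition kappa_oo : R := (1 / (2 ^+ 13 * 27 * pi ^+ 3)) `^ (1 / 3).

Definition D_0 : R :=
  2 * kappa_0 * \int[mu]_(r in [set` `]0, +oo[ ]) ((1 - cos r) / r `^ (5 / 2)).

Definition D_oo : R :=
  2 * kappa_oo * \int[mu]_(r in [set` `]0, +oo[ ]) ((1 - cos r) / r `^ (8 / 3)).

End Constants.

(* Main.v *)
(* After the substitution r = pi / (gamma F_s(y)), with F_s(y) = (2 sqrt(y^2 + B^2/4) + s B) y,
   the integral over r and the expectation over the exponential time give
     Phi_B(theta) = - psi_B(theta),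
     psi_B(theta) = gamma/pi sum_(s = +-1)
       int_0^oo w_s(y) theta^2 / (theta^2 + 4 gamma^2 F_s(y)^2) dy,
   where w_s is the integrand of h_B.  By dominated convergence, psi_B(theta) tends as
   B -> 0, and B^(1/3) psi_B(theta) as B -> oo (with y = B^(1/3) z), to integrals of the
   form gamma/pi int_0^oo y^(2k) theta^2 / (theta^2 + 16 gamma^2 y^(2k+2)) dy with k = 1
   and k = 2, and the same substitutions identify these with the stable exponents of
   the statement.

   On the Fourier side, a solution whose operator has the symbol - a is
   exp(- t a) times the transform of the initial datum f.  For t > 0 all transforms are
   integrable, so that Plancherel, obtained from Poisson kernels and Lebesgue points,
   bounds ||rho_B(t) - rho(t)||_2^2 by the integral of
   min(1, T |a_B - a|)^2 |F f|^2, which tends to 0 by dominated convergence. *)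
Require Import Defs.
From HB Require Import structures.
From mathcomp Require Import all_boot all_order all_algebra.
From mathcomp Require Import all_classical all_reals all_analysis.
From mathcomp Require Import measurable_realfun ring lra.

Set Implicit Arguments.
Unset Strict Implicit.
Unset Printing Implicit Defensive.

Import Order.TTheory GRing.Theory Num.Theory.
Import numFieldNormedType.Exports.

Local Open Scope classical_set_scope.
Local Open Scope ring_scope.

(** * Integrals on the half line *)

(** Only the properties in [is_solution] are available, so the exponential formula on the Fourier
    side has to be derived. The L^1 part of [norm12] controls every Fourier coefficient and turns
    the equation into a scalar one at each frequency; the L^2 part bounds the norms as t tends to 0
    and yields the square integrability of F f. Integrability of the transforms at t > 0, on which
    Plancherel rests, has two sources: membership in the domain of L_B, whose symbol is bounded
    below at high frequency, and exponential decay in the stable case. The function x_B is only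
    known through its equation, so the integral over r is rewritten in the variable y = x_B(r),
    where r = [levy_S y] is explicit. The integrands are nonnegative, which allows Tonelli and
    monotone convergence with values in the extended reals; finiteness comes at the end, from
    majorants C / (1 + y^2). Neither Gamma nor the integral of (1 - cos r) / r^p is evaluated: they
    appear on both sides, and only the constants in front are compared. *)

Lemma is_derive_continuous {R : realType} (f : R -> R) (x d : R) :
  is_derive x (1 : R) f d -> {for x, continuous f}.
Proof.
move=> fd; apply: differentiable_continuous; apply/derivable1_diffP.
exact: ex_derive.
Qed.

Section LebesgueReflection.
Context {R : realType}.
Notation mu := (@lebesgue_measure R).
Local Open Scope ereal_scope.

Lemma ge0_integral_opp (D : set R) (f : R -> \bar R) :
  measurable D -> measurable_fun D f -> (forall x, D x -> 0 <= f x) ->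
  \int[mu]_(x in -%R @^-1` D) f (- x)%R = \int[mu]_(x in D) f x.
Proof.
move=> mD mf f0.
rewrite (_ : -%R @^-1` D = (-%R : _ -> measurableTypeR R) @^-1` D)//.
rewrite -ge0_integral_pushforward//=; last by move=> x /set_mem; exact: f0.
by apply: eq_measure_integral => //= A mA AS; exact: lebesgue_measureN.
Qed.

Lemma integral_opp (D : set R) (f : R -> \bar R) :
  measurable D -> measurable_fun D f ->
  \int[mu]_(x in -%R @^-1` D) f (- x)%R = \int[mu]_(x in D) f x.
Proof.
move=> mD mf; rewrite integralE [RHS]integralE.
rewrite -(@ge0_integral_opp D f^\+)//; last exact: measurable_funepos.
rewrite -(@ge0_integral_opp D f^\-)//; last exact: measurable_funeneg.
by congr (_ - _); apply: eq_integral => x _; rewrite ?funeposE ?funenegE.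
Qed.

End LebesgueReflection.

(** * Change of variables by a decreasing bijection of the half line *)

Section DecreasingSubstitution.
Context {R : realType}.
Notation mu := (@lebesgue_measure R).
Local Open Scope ereal_scope.

Variables (S S' G : R -> R).
Hypothesis dS : forall y : R, (0 < y)%R -> is_derive y (1:R)%R S (S' y).
Hypothesis cS' : forall y : R, (0 < y)%R -> {for y, continuous S'}.
Hypothesis S'0 : forall y : R, (0 < y)%R -> (S' y < 0)%R.
Hypothesis S0 : forall y : R, (0 < y)%R -> (0 < S y)%R.
Hypothesis Sy : S y @[y --> +oo%R] --> (0 : R)%R.
Hypothesis S0y : S y @[y --> 0%R^'+] --> +oo%R.
Hypothesis cG : forall x : R, (0 < x)%R -> {for x, continuous G}.
Hypothesis G0 : forall x : R, (0 < x)%R -> (0 <= G x)%R.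

Let S_decreasing (x y : R) : (0 < x -> x < y -> S y < S x)%R.
Proof.
move=> x0 xy.
have [||c /[!in_itv]/= /andP[xc cy] E] := @MVT R S S' x y xy.
- by move=> z /[!in_itv]/= /andP[xz _]; apply: dS; apply: lt_trans xz.
- apply: continuous_in_subspaceT => z /[!inE]/= /[!in_itv]/= /andP[xz _].
  exact: is_derive_continuous (dS (lt_le_trans x0 xz)).
have c0 : (0 < c)%R by exact: lt_trans xc.
by rewrite -subr_lt0 E nmulr_rlt0 ?S'0// subr_gt0.
Qed.

Let decrW (x y : R) : (0 < x -> x <= y -> S y <= S x)%R.
Proof.
move=> x0; rewrite le_eqVlt => /orP[/eqP->//|xy].
exact/ltW/S_decreasing.
Qed.

Let a n : R := (n.+1%:R^-1)%R.
(** The summand 1 keeps [a n < b n] at [n = 0], where both would otherwise equal 1. *)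
Let b n : R := (n.+1%:R + 1)%R.

Let a0 n : (0 < a n)%R. Proof. by rewrite invr_gt0. Qed.
Let b0 n : (0 < b n)%R. Proof. by rewrite addr_gt0. Qed.
Let ab n : (a n < b n)%R.
Proof.
rewrite (@le_lt_trans _ _ 1%R)//; first by rewrite invf_le1// ler1n.
by rewrite ltrDr.
Qed.
Let aS m n : (m <= n)%N -> (a n <= a m)%R.
Proof. by move=> mn; rewrite lef_pV2 ?posrE// ler_nat. Qed.
Let bS m n : (m <= n)%N -> (b m <= b n)%R.
Proof. by move=> mn; rewrite lerD2r ler_nat. Qed.

Let cvS y : (0 < y)%R -> {for y, continuous S}.
Proof.
by move=> y0; exact: is_derive_continuous (dS y0).
Qed.

Let mG : measurable_fun (`]0%R, +oo[%classic : set R) (EFin \o G).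
Proof.
apply/measurable_EFinP; apply: open_continuous_measurable_fun => //.
by move=> x; rewrite inE/= in_itv/= andbT; exact: cG.
Qed.

Let mGS : measurable_fun (`]0%R, +oo[%classic : set R) (fun y => (G (S y) * - S' y)%:E).
Proof.
apply/measurable_EFinP; apply: open_continuous_measurable_fun => //.
move=> x; rewrite inE/= in_itv/= andbT => x0.
apply: (@continuousM _ _ (G \o S) (fun y => - S' y)%R).
  by apply: continuous_comp; [exact: cvS|apply: cG; exact: S0].
by apply: continuousN; exact: cS'.
Qed.

Let S'E (y : R) : (0 < y)%R -> derive1 S y = S' y.
Proof. by move=> y0; rewrite derive1E; have [_ ->] := dS y0. Qed.

(** The segments [[a n, b n]] and their images [[S (b n), S (a n)]] both exhaust the half line. The
    formula for compact intervals holds on each of them, and monotone convergence passes to the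
    limit because [G] is nonnegative; both sides may be infinite. *)
Lemma decreasing_substitution_0y :
  \int[mu]_(x in `]0%R, +oo[) (G x)%:E =
  \int[mu]_(y in `]0%R, +oo[) (G (S y) * - S' y)%:E.
Proof.
have sub (u v : R) : (0 < u)%R -> `[u, v] `<=` (`]0%R, +oo[ : set R).
  by move=> u0 x /=; rewrite !in_itv/= => /andP[ux _]; rewrite andbT (lt_le_trans u0).
have UL : \bigcup_n (`[S (b n), S (a n)]%classic : set R) = `]0%R, +oo[%classic :> set R.
  apply/seteqP; split => [x [n _]|x /=].
    by apply: sub; exact: S0.
  rewrite in_itv/= andbT => x0.
  have h1 : \forall y \near +oo%R, (S y <= x)%R.
    by move/cvgr_le : Sy => /(_ x x0).
  have h2 : \forall y \near 0%R^'+, (x <= S y)%R.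
    by move/cvgryPge : S0y => /(_ x).
  have [e /= e0 he] := h2.
  have [M [_ hM]] := h1.
  near \oo => n.
  exists n => //=; rewrite in_itv/=; apply/andP; split.
    apply: hM; near: n; apply: (@filterS _ _ _ (fun n => M <= n%:R)%R).
      by move=> n Mn; rewrite (le_lt_trans Mn)// /b -natr1 -addrA ltrDl addr_gt0.
    exact: nbhs_infty_ger.
  apply: he => //=; rewrite sub0r normrN ger0_norm ?(ltW (a0 _))//.
  by near: n; have := near_infty_natSinv_lt (PosNum e0).
have UR : \bigcup_n (`[a n, b n]%classic : set R) = `]0%R, +oo[%classic :> set R.
  apply/seteqP; split => [x [n _]|x /=]; first exact: sub.
  rewrite in_itv/= andbT => x0.
  near \oo => n; exists n => //=; rewrite in_itv/=; apply/andP; split.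
    by apply: ltW; near: n; have := near_infty_natSinv_lt (PosNum x0).
  near: n; apply: (@filterS _ _ _ (fun n => x <= n%:R)%R).
    by move=> n xn; rewrite (le_trans xn)// /b -natr1 -addrA lerDl addr_ge0.
  exact: nbhs_infty_ger.
have cvL : \int[mu]_(x in `[S (b n), S (a n)]) (G x)%:E @[n --> \oo] -->
    \int[mu]_(x in `]0%R, +oo[) (G x)%:E.
  rewrite -UL; apply: ge0_nondecreasing_set_cvg_integral => //.
  - move=> m n mn; rewrite subsetEset; apply: subset_itv; rewrite bnd_simp.
      exact: decrW (bS mn).
    exact: decrW (aS mn).
  - move=> n; apply: measurable_funS mG => //; apply: sub; exact: S0.
  - move=> n x /(sub _ _ (S0 (b0 n)))/=; rewrite in_itv/= andbT lee_fin; exact: G0.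
have cvR : \int[mu]_(x in `[a n, b n]) (G (S x) * - S' x)%:E @[n --> \oo] -->
    \int[mu]_(x in `]0%R, +oo[) (G (S x) * - S' x)%:E.
  rewrite -UR; apply: ge0_nondecreasing_set_cvg_integral => //.
  - by move=> m n mn; rewrite subsetEset; apply: subset_itv; rewrite bnd_simp ?aS ?bS.
  - by move=> n; apply: measurable_funS mGS => //; exact: sub.
  - move=> n x /(sub _ _ (a0 n))/=; rewrite in_itv/= andbT lee_fin => x0.
    by rewrite mulr_ge0// ?G0 ?S0// oppr_ge0 ltW// S'0.
suff E n : \int[mu]_(x in `[S (b n), S (a n)]) (G x)%:E =
    \int[mu]_(x in `[a n, b n]) (G (S x) * - S' x)%:E.
  rewrite (eq_cvg _ _ E) in cvL.
  exact: cvg_unique cvL cvR.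
have ia x : x \in (`[a n, b n] : interval R) -> (0 < x)%R.
  by rewrite in_itv/= => /andP[+ _]; exact: lt_le_trans.
rewrite integration_by_substitution_decreasing.
- apply: eq_integral => x /[!inE]/= /ia x0.
  by rewrite !fctE S'E.
- exact: ltW.
- by move=> x y _ /ia y0; exact: S_decreasing.
- move=> x /subset_itv_oo_cc/ia x0.
  have E' : {near x, S' =1 (derive1 S)}.
    near=> z; rewrite S'E//; near: z.
    exact: lt_nbhsr.
  rewrite /continuous_at S'E//.
  by apply: cvg_trans (cS' x0); exact: near_eq_cvg.
- apply/cvg_ex; exists (S' (a n)); apply: cvg_trans (cvg_at_right_filter (cS' (a0 n))).
  apply: near_eq_cvg; near=> z.
  have z0 : (0 < z)%R by apply: lt_trans (a0 n) _; near: z; exact: nbhs_right_gt.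
  by rewrite S'E.
- apply/cvg_ex; exists (S' (b n)); apply: cvg_trans (cvg_at_left_filter (cS' (b0 n))).
  apply: near_eq_cvg; near=> z.
  have z0 : (0 < z)%R by near: z; apply: nbhs_left_gt; exact: b0.
  by rewrite S'E.
- split.
  + by move=> x /subset_itv_oo_cc/ia x0; have /@ex_derive := dS x0.
  + exact/cvg_at_right_filter/cvS.
  + exact/cvg_at_left_filter/cvS.
- apply: continuous_in_subspaceT => x /[!inE]/= /[!in_itv]/= /andP[+ _] => h.
  by apply: cG; rewrite (lt_le_trans _ h)// S0.
Unshelve. all: by end_near. Qed.

End DecreasingSubstitution.

(** * Laplace transforms of 1 and of 1 - cos *)

Section ExponentialCosine.
Context {R : realType}.
Notation mu := (@lebesgue_measure R).
Variables (e : R).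
Hypothesis e0 : 0 < e.

(** The antiderivative of the integrand that vanishes at infinity, so that the integral is
    [- F c 0]. *)
Let F (c t : R) : R :=
  - (expR (- (e * t)) * (e^-1 + (c * sin (c * t) - e * cos (c * t)) / (e ^+ 2 + c ^+ 2))).

Let ec0 c : e ^+ 2 + c ^+ 2 != 0.
Proof. by rewrite gt_eqF// ltr_pwDl ?sqr_ge0// exprn_gt0. Qed.

Let dF (c t : R) : is_derive t (1 : R) (F c) (expR (- (e * t)) * (1 - cos (c * t))).
Proof.
rewrite /F.
apply: is_derive_eq.
rewrite /GRing.scale /=.
have ee : e != 0 by rewrite gt_eqF.
field.
by rewrite ee ec0.
Qed.

Let expRNy : expR (- (e * t)) @[t --> +oo] --> (0 : R).
Proof.
apply: (@cvg_comp _ _ _ (fun t => e * t) (fun t => expR (- t)) _ +oo).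
  exact: gt0_cvgMry.
exact: cvgr_expR.
Qed.

Let Fy c : F c t @[t --> +oo] --> (0 : R).
Proof.
pose M := e^-1 + (`|c| + e) / (e ^+ 2 + c ^+ 2).
apply/cvgr0Pnorm_le => d d0.
have M0 : 0 < M.
  by rewrite ltr_pwDl ?invr_gt0// divr_ge0 ?addr_ge0 ?sqr_ge0// ltW.
near=> t.
have B : `|e^-1 + (c * sin (c * t) - e * cos (c * t)) / (e ^+ 2 + c ^+ 2)| <= M.
  rewrite (le_trans (ler_normD _ _))// lerD//.
    by rewrite ger0_norm// invr_ge0 ltW.
  rewrite normrM (ger0_norm (_ : 0 <= _^-1)) ?invr_ge0 ?addr_ge0 ?sqr_ge0//.
  rewrite ler_pM2r ?invr_gt0; last by rewrite lt_def ec0 addr_ge0 ?sqr_ge0.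
  rewrite (le_trans (ler_normB _ _))// !normrM (gtr0_norm e0) lerD//.
    by rewrite ler_piMr// ler_norml sin_geN1 sin_le1.
  by rewrite ler_piMr ?(ltW e0)// ler_norml cos_geN1 cos_le1.
rewrite /F normrN normrM (ger0_norm (expR_ge0 _)).
rewrite (le_trans (ler_wpM2l (expR_ge0 _) B))// -ler_pdivlMr//.
near: t.
have dM : 0 < d / M by rewrite divr_gt0.
by apply: filterS (cvgr0_norm_le _ expRNy _ dM) => t; rewrite ger0_norm ?expR_ge0.
Unshelve. all: by end_near. Qed.

Lemma integral0y_expR_onem_cos (c : R) :
  (\int[mu]_(t in `[0%R, +oo[) (expR (- (e * t)) * (1 - cos (c * t)))%:E =
   (e^-1 - e / (e ^+ 2 + c ^+ 2))%:E)%E.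
Proof.
have cf : continuous (fun t => expR (- (e * t)) * (1 - cos (c * t))).
  move=> t; exact: is_derive_continuous.
have cF : continuous (F c).
  move=> t; exact: is_derive_continuous.
rewrite (@ge0_continuous_FTC2y _ _ (F c) 0 0).
- rewrite /F !mulr0 oppr0 expR0 sin0 cos0 -EFinB; congr EFin.
  by field; rewrite ec0 gt_eqF.
- move=> t _; rewrite mulr_ge0 ?expR_ge0// subr_ge0; exact: cos_le1.
- by apply: continuous_subspaceT => t; exact: cf.
- exact: Fy.
- by move=> t _; exact: ex_derive.
- by apply: cvg_at_right_filter; exact: cF.
- by move=> t _; rewrite derive1E; have [_ ->] := dF c t.
Qed.

Lemma integral0y_expR :
  (\int[mu]_(t in `[0%R, +oo[) (expR (- (e * t)))%:E = (e^-1)%:E)%E.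
Proof.
have dG (t : R) : is_derive t (1 : R) (fun t => - (e^-1 * expR (- (e * t)))) (expR (- (e * t))).
  apply: is_derive_eq; rewrite /GRing.scale /=.
  have ee : e != 0 by rewrite gt_eqF.
  by field.
rewrite (@ge0_continuous_FTC2y _ _ (fun t => - (e^-1 * expR (- (e * t)))) 0 0).
- by rewrite mulr0 oppr0 expR0 sub0e mulr1 -EFinN opprK.
- by move=> t _; exact: expR_ge0.
- apply: continuous_subspaceT => t; exact: is_derive_continuous.
- rewrite -oppr0; apply: cvgN; rewrite -(mulr0 e^-1); apply: cvgM expRNy; exact: cvg_cst.
- by move=> t _; exact: ex_derive.
- exact/cvg_at_right_filter/(is_derive_continuous (dG 0)).
- by move=> t _; rewrite derive1E; have [_ ->] := dG t.
Qed.

End ExponentialCosine.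

(** Up to a constant, this is the majorant of the integrands in [y] over the half line, in all the
    limits below. *)
Lemma integrable_oneDsqrV {R : realType} :
  (@lebesgue_measure R).-integrable setT (fun x : R => ((1 + x ^+ 2)^-1)%:E).
Proof.
have c : continuous (fun x : R => (1 + x ^+ 2)^-1) by exact: continuous_oneDsqrV.
have p (x : R) : 0 <= (1 + x ^+ 2)^-1 by rewrite invr_ge0 addr_ge0 ?sqr_ge0.
apply/integrableP; split.
  by apply/measurable_EFinP; exact: continuous_measurable_fun.
under eq_integral => x _ do rewrite gee0_abs ?lee_fin//.
rewrite ge0_symfun_integralT//; last by move=> x /=; rewrite sqrrN.
rewrite -set_itvcy [X in (_ * X)%E](_ : _ = (pi / 2)%:E) ?ltry//.
exact: integral0y_oneDsqr.
Qed.

Lemma measurable_expR_onem_cos {R : realType} (c : R) :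
  measurable_fun setT (fun t : R => expR (- t) * (1 - cos (c * t))).
Proof.
apply: measurable_funM; first exact: measurableT_comp.
apply: measurable_funB => //; apply: measurableT_comp; last exact: measurable_funM.
by apply: continuous_measurable_fun; exact: continuous_cos.
Qed.

(** The mean of [1 - cos (c * tau)] for an exponential time [tau] of parameter 1. It is the source
    of the quotients [theta ^+ 2 / (theta ^+ 2 + ..)] below. *)
Lemma integral_expR_onem_cos1 {R : realType} (c : R) :
  (\int[@lebesgue_measure R]_(t in `]0%R, +oo[) (expR (- t) * (1 - cos (c * t)))%:E =
   (c ^+ 2 / (1 + c ^+ 2))%:E)%E.
Proof.
have m : measurable_fun (`]0, +oo[%classic : set R)
    (fun t => (expR (- t) * (1 - cos (c * t)))%:E).
  apply/measurable_EFinP; apply: measurable_funTS; exact: measurable_expR_onem_cos.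
rewrite integral_itv_obnd_cbnd//.
transitivity (1^-1 - 1 / (1 ^+ 2 + c ^+ 2))%:E%E.
  rewrite -integral0y_expR_onem_cos//; apply: eq_integral => t _.
  by rewrite mul1r.
congr EFin; rewrite invr1 expr1n; field.
by rewrite gt_eqF// ltr_pwDl ?sqr_ge0.
Qed.

(** * The functions x_B, h_B and g_B *)

Section LevyKernel.
Context {R : realType}.
Notation mu := (@lebesgue_measure R).
Variables (gamma B s : R).
Implicit Types (x y r v : R).
Hypotheses (gamma0 : 0 < gamma) (B0 : 0 < B) (s1 : s = 1 \/ s = - 1).

Let q (y : R) : R := Num.sqrt (y ^+ 2 + B ^+ 2 / 4).

(* [levy_F y = pi / (gamma * r)] is the equation of [xB r], so that [levy_S] is
   the inverse of [xB]. *)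
Definition levy_F (y : R) : R := (2 * Num.sqrt (y ^+ 2 + B ^+ 2 / 4) + s * B) * y.

Definition levy_S (y : R) : R := pi / (gamma * levy_F y).

Let F := levy_F.
Let S := levy_S.

Let arg_gt0 y : 0 < y ^+ 2 + B ^+ 2 / 4.
Proof. by rewrite ltr_wpDl ?sqr_ge0// divr_gt0// exprn_gt0. Qed.

Let q_gt0 y : 0 < q y. Proof. by rewrite sqrtr_gt0. Qed.

Let q2 y : q y ^+ 2 = y ^+ 2 + B ^+ 2 / 4.
Proof. by rewrite sqr_sqrtr// ltW. Qed.

Let sB : - B <= s * B <= B.
Proof. by move: B0; case: s1 => -> ?; rewrite ?mul1r ?mulN1r; apply/andP; split; lra. Qed.

Let q_ge y : B <= 2 * q y.
Proof.
rewrite -(@ler_pXn2r _ 2)// ?nnegrE ?mulr_ge0 ?(ltW (q_gt0 _)) ?(ltW B0)//.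
rewrite exprMn q2.
have -> : 2 ^+ 2 * (y ^+ 2 + B ^+ 2 / 4) = 4 * y ^+ 2 + B ^+ 2 by field.
by rewrite lerDr mulr_ge0 ?sqr_ge0.
Qed.

Let q_ge_id y : y <= q y.
Proof.
have [y0|y0] := leP 0 y; last by rewrite (le_trans (ltW y0))// ltW.
rewrite -(@ler_pXn2r _ 2)// ?nnegrE ?(ltW (q_gt0 _))//.
by rewrite q2 lerDl divr_ge0 ?sqr_ge0.
Qed.

Let q_gt y : 0 < y -> B < 2 * q y.
Proof.
move=> y0; rewrite -(@ltr_pXn2r _ 2)// ?nnegrE ?mulr_ge0 ?(ltW (q_gt0 _)) ?(ltW B0)//.
rewrite exprMn q2.
have -> : 2 ^+ 2 * (y ^+ 2 + B ^+ 2 / 4) = 4 * y ^+ 2 + B ^+ 2 by field.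
by rewrite ltrDr mulr_gt0 ?exprn_gt0.
Qed.

(** For [s = - 1] the slope [2 * q y - B] vanishes at [y = 0]; hence the strict bound [q_gt] and the
    restriction to [y > 0]. *)
Let slope_gt0 y : 0 < y -> 0 < 2 * q y + s * B.
Proof. by move=> /q_gt yB; case/andP: sB => sB1 sB2; lra. Qed.

Lemma levy_F_gt0 y : 0 < y -> 0 < levy_F y.
Proof. by move=> y0; rewrite mulr_gt0// slope_gt0. Qed.

Definition levy_F' (y : R) : R :=
  2 * Num.sqrt (y ^+ 2 + B ^+ 2 / 4) + s * B
  + 2 * y ^+ 2 / Num.sqrt (y ^+ 2 + B ^+ 2 / 4).

Let is_derive_q y : is_derive y (1 : R) q (y / q y).
Proof.
have qy := q_gt0 y.
have h : is_derive (y ^+ 2 + B ^+ 2 / 4) (1 : R) Num.sqrt (2 * q y)^-1.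
  exact: is_derive1_sqrt.
have h2 : is_derive y (1 : R) (fun y => y ^+ 2 + B ^+ 2 / 4) (2 * y).
  by apply: is_derive_eq; rewrite /GRing.scale /=; ring.
have := @is_derive1_comp R Num.sqrt (fun y => y ^+ 2 + B ^+ 2 / 4) y _ _ h h2.
have -> : (2 * q y)^-1 * (2 * y) = y / q y by field; rewrite gt_eqF.
by [].
Qed.

Lemma is_derive_levy_F y : is_derive y (1 : R) levy_F (levy_F' y).
Proof.
have qy := q_gt0 y.
have h := is_derive_q y.
rewrite /levy_F -/q.
apply: is_derive_eq.
rewrite /levy_F' -/(q y) /GRing.scale /=.
by field; rewrite gt_eqF.
Qed.

Lemma levy_F'_gt0 y : 0 < y -> 0 < levy_F' y.
Proof.
by move=> y0; rewrite ltr_pwDl ?slope_gt0// divr_ge0 ?mulr_ge0 ?sqr_ge0// ltW.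
Qed.

(** For [s = - 1] the derivative is 0 at the origin, but the mean value point lies strictly above
    [x], so that [x = 0] is allowed. *)
Lemma levy_F_mono (x y : R) : 0 <= x -> x < y -> levy_F x < levy_F y.
Proof.
move=> x0 xy.
have [||c /[!in_itv]/= /andP[xc cy] E] := @MVT R levy_F levy_F' x y xy.
- by move=> z _; exact: is_derive_levy_F.
- apply: continuous_subspaceT => z.
  exact: is_derive_continuous (is_derive_levy_F z).
by rewrite -subr_gt0 E mulr_gt0 ?subr_gt0// levy_F'_gt0// (le_lt_trans x0).
Qed.

Lemma levy_FN y : levy_F (- y) = - levy_F y.
Proof. by rewrite /levy_F sqrrN mulrN. Qed.

Lemma levy_F0 : levy_F 0 = 0. Proof. by rewrite /levy_F mulr0. Qed.

(** [xB] is picked by [xget] among the solutions of its equation; injectivity on all of [R]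
    identifies the one picked. Oddness reduces the claim to the half line. *)
Lemma levy_F_inj : injective levy_F.
Proof.
have F0 x : 0 < x -> 0 < levy_F x by exact: levy_F_gt0.
have FN x : x < 0 -> levy_F x < 0.
  by move=> x0; rewrite -[x]opprK levy_FN oppr_lt0 F0// oppr_gt0.
have H x y : 0 <= x -> 0 <= y -> levy_F x = levy_F y -> x = y.
  move=> x0 y0 E; case: (ltgtP x y) => // h.
    by have := levy_F_mono x0 h; rewrite E ltxx.
  by have := levy_F_mono y0 h; rewrite E ltxx.
have F0' x : 0 <= x -> 0 <= levy_F x.
  by rewrite le_eqVlt => /orP[/eqP<-|/F0/ltW//]; rewrite levy_F0.
move=> x y E.
have [x0|x0] := leP 0 x; have [y0|y0] := leP 0 y.
- exact: H.
- by have := FN _ y0; rewrite -E ltNge F0'.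
- by have := FN _ x0; rewrite E ltNge F0'.
- apply: oppr_inj; apply: H; rewrite ?oppr_ge0 ?ltW//.
  by rewrite !levy_FN E.
Qed.

Lemma levy_F_surj v : 0 < v -> exists2 y, 0 < y & levy_F y = v.
Proof.
(* Since [q M >= M], the slope [2 * q M + s * B] is at least [2 * M - B >= 1], whence
   [levy_F M >= M >= v]. *)
move=> v0; pose M := B + v + 1.
have M0 : 0 <= M by rewrite !addr_ge0 ?ltW.
have vM : v <= levy_F M.
  rewrite /levy_F -/(q M) (@le_trans _ _ (1 * M))//.
    by move: B0 => B0'; rewrite mul1r /M; lra.
  have BB := B0; have vv := v0.
  rewrite ler_wpM2r//; have : B + v + 1 <= q M := q_ge_id M.
  move: (q M) sB => qM /andP[h1 h2] h3; lra.
have [||y /[!in_itv]/= /andP[y0 _] yv] := @IVT R levy_F 0 M v M0.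
- apply: continuous_subspaceT => z.
  exact: is_derive_continuous (is_derive_levy_F z).
- by rewrite levy_F0 min_l ?max_r ?(ltW v0)// (le_trans _ vM) ?ltW.
exists y => //; rewrite lt_neqAle y0 andbT.
by apply/eqP => y0'; move: yv; rewrite -y0' levy_F0 => v0'; move: v0; rewrite -v0' ltxx.
Qed.

Lemma levy_S_gt0 y : 0 < y -> 0 < levy_S y.
Proof. by move=> y0; rewrite divr_gt0 ?pi_gt0// mulr_gt0// levy_F_gt0. Qed.

Let pi_neq0 : (pi : R) != 0. Proof. by rewrite gt_eqF// pi_gt0. Qed.

Let gamma_neq0 : gamma != 0. Proof. by rewrite gt_eqF. Qed.

Lemma levy_S_surj r : 0 < r -> exists2 y, 0 < y & levy_S y = r.
Proof.
move=> r0; have [|y y0 E] := @levy_F_surj (pi / (gamma * r)).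
  by rewrite divr_gt0 ?pi_gt0 ?mulr_gt0.
exists y => //; rewrite /levy_S E.
move: pi pi_neq0 => p p0; field.
by rewrite p0 gamma_neq0 (gt_eqF r0).
Qed.

Let pi_S y : 0 < y -> pi / (gamma * levy_S y) = levy_F y.
Proof.
move=> y0; rewrite /levy_S.
move: pi pi_neq0 => p p0; field.
by rewrite p0 gamma_neq0 (gt_eqF (levy_F_gt0 y0)).
Qed.

Lemma xB_levy_S y : 0 < y -> xB gamma B s (levy_S y) = y.
Proof.
move=> y0; rewrite /xB; case: xgetP => [x -> /=|/(_ y)].
  by rewrite pi_S// => /levy_F_inj.
by case; rewrite /= pi_S.
Qed.

Lemma xBN_levy_S y : 0 < y -> xB gamma B s (- levy_S y) = - y.
Proof.
have E : 0 < y -> pi / (gamma * - levy_S y) = levy_F (- y).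
  by move=> y0; rewrite mulrN invrN mulrN pi_S// levy_FN.
move=> y0; rewrite /xB; case: xgetP => [x -> /=|/(_ (- y))].
  by rewrite E// => /levy_F_inj.
by case; rewrite /= E.
Qed.

Definition levy_S' (y : R) : R := - (pi / gamma * (levy_F' y / levy_F y ^+ 2)).

Lemma is_derive_levy_S y : 0 < y -> is_derive y (1 : R) levy_S (levy_S' y).
Proof.
move=> y0; have F0 : levy_F y != 0 by rewrite gt_eqF// levy_F_gt0.
have h := is_derive_levy_F y.
rewrite /levy_S (_ : (fun _ => _) = (fun y => pi / gamma * (levy_F y)^-1)); last first.
  by apply/funext => z; rewrite invfM mulrA.
have h2 := is_deriveV F0 h.
apply: is_derive_eq.
by rewrite /levy_S' /GRing.scale /=; ring.
Qed.

Lemma levy_S'_lt0 y : 0 < y -> levy_S' y < 0.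
Proof.
move=> y0; rewrite oppr_lt0 mulr_gt0 ?divr_gt0 ?pi_gt0 ?levy_F'_gt0//.
by rewrite exprn_gt0// levy_F_gt0.
Qed.

Let is_derive_xB y : 0 < y ->
  is_derive (levy_S y) (1 : R) (xB gamma B s) (levy_S' y)^-1.
Proof.
move=> y0; apply: (@is_derive_inverse R levy_S (xB gamma B s) (levy_S' y) y).
- near=> z; apply: xB_levy_S; near: z; exact: lt_nbhsr.
- near=> z.
  apply: is_derive_continuous; apply: is_derive_levy_S; near: z; exact: lt_nbhsr.
- exact: is_derive_levy_S.
- by rewrite lt_eqF// levy_S'_lt0.
Unshelve. all: by end_near. Qed.

Let w (x : R) := hB_integrand B s x.

Lemma hB_integrand_ge0 x : 0 <= hB_integrand B s x.
Proof.
rewrite mulr_ge0 ?sqr_ge0// -/(q x).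
have : B / (4 * q x) <= 1 / 2.
  rewrite ler_pdivrMr ?mulr_gt0//; have := q_ge x; lra.
have : 0 <= B / (4 * q x) by rewrite divr_ge0 ?mulr_ge0 ?ltW.
by case: s1 => ->; lra.
Qed.

Lemma continuous_hB_integrand : continuous (hB_integrand B s).
Proof.
move=> y; have h := is_derive_continuous (is_derive_q y).
apply: (@cvgM R R); last exact: exprn_continuous.
apply: cvgD; first exact: cvg_cst.
apply: cvgM; first exact: cvg_cst.
apply: cvgM; first exact: cvg_cst.
apply: cvgV; first by rewrite mulf_neq0// gt_eqF// q_gt0.
by apply: cvgM; first exact: cvg_cst.
Qed.

(** The function [hB] in the variable [y = xB r], to which the fundamental theorem of calculus
    applies. *)
Definition levy_H (y : R) : R :=
  1 / (4 * pi) * \int[mu]_(x in [set` `[0, y]]) hB_integrand B s x.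

Let is_derive_levy_H y : 0 < y ->
  is_derive y (1 : R) levy_H (1 / (4 * pi) * hB_integrand B s y).
Proof.
move=> y0; have [] := @continuous_FTC1_closed R (hB_integrand B s) 0 y (y + 1) _ _ y0.
- by rewrite ltrDl.
- apply: continuous_compact_integrable; first exact: segment_compact.
  by apply: continuous_subspaceT => z; exact: continuous_hB_integrand.
- exact: continuous_hB_integrand.
move=> d1 d2.
have h : is_derive y (1 : R) (fun y => \int[mu]_(x in [set` `[0, y]]) hB_integrand B s x)
    (hB_integrand B s y).
  by apply: DeriveDef; [exact: d1|rewrite -d2 derive1E].
by rewrite /levy_H; apply: is_derive_eq.
Qed.

Let hBE r : 0 < r -> hB gamma B s r = levy_H (xB gamma B s r).
Proof. by move=> r0; rewrite /hB r0. Qed.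

(** [xB] is odd and [hB_integrand] is even, so the reflection of the variable exchanges the two
    integrals. *)
Lemma hBN r : 0 < r -> hB gamma B s (- r) = hB gamma B s r.
Proof.
move=> r0; rewrite /hB r0 oppr_gt0 oppr_lt0 r0 ltNge (ltW r0)/=.
congr (_ * _).
have [y y0 <-] := levy_S_surj r0.
rewrite xB_levy_S// xBN_levy_S//.
rewrite /Rintegral; congr fine.
rewrite (_ : [set` `[0, y]] = -%R @^-1` [set` `[- y, 0]]); last first.
  by rewrite opp_preimage_itvbndbnd oppr0 opprK.
have mf : measurable_fun (`[- y, 0]%classic : set R) (EFin \o hB_integrand B s).
  apply/measurable_EFinP; apply: (measurable_funS measurableT) => //.
  by apply: continuous_measurable_fun; exact: continuous_hB_integrand.
rewrite -[LHS]integral_opp//.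
by apply: eq_integral => x _; rewrite /hB_integrand sqrrN.
Qed.

(** The derivative of [hB], up to sign, given by the chain rule for [levy_H] composed with [xB].
    Continuity and measurability of [gB] on the half line are read off from this form. *)
Definition levy_g (r : R) : R :=
  1 / (4 * pi) * hB_integrand B s (xB gamma B s r) * (- levy_S' (xB gamma B s r))^-1.

Let is_derive_hB r : 0 < r -> is_derive r (1 : R) (hB gamma B s) (- levy_g r).
Proof.
move=> r0; have [y y0 yr] := levy_S_surj r0.
have h1 := is_derive_xB y0; rewrite yr in h1.
have h2 := is_derive_levy_H y0.
rewrite -(xB_levy_S y0) yr in h2.
have h3 := @is_derive1_comp R _ _ r _ _ h2 h1.
have xr : xB gamma B s r = y by rewrite -yr xB_levy_S.
rewrite /levy_g xr invrN mulrN opprK.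
rewrite xr in h3.
apply: near_eq_is_derive h3.
near=> z; rewrite /= hBE//; near: z; exact: lt_nbhsr.
Unshelve. all: by end_near. Qed.

Lemma gBE r : 0 < r -> gB gamma B s r = levy_g r.
Proof.
move=> r0; rewrite /gB r0 derive1E.
by have [_ ->] := is_derive_hB r0; rewrite opprK.
Qed.

Lemma gBN r : 0 < r -> gB gamma B s (- r) = gB gamma B s r.
Proof.
move=> r0; rewrite (gBE r0) /gB oppr_gt0 oppr_lt0 r0 ltNge (ltW r0)/= derive1E.
have h1 : is_derive (- - r) (1 : R) (hB gamma B s) (- levy_g r).
  by rewrite opprK; exact: is_derive_hB.
have h2 : is_derive (- r) (1 : R) (-%R : R -> R) (- 1) by exact: is_deriveNid.
have h3 := @is_derive1_comp R _ _ (- r) _ _ h1 h2.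
have [|_ ->] := @near_eq_is_derive _ _ _ _ (hB gamma B s) _ _ _ _ h3.
  near=> z; have z0 : z < 0 by near: z; apply: lt_nbhsl; rewrite oppr_lt0.
  by have := @hBN (- z); rewrite opprK oppr_gt0 => ->.
by rewrite mulrN1 opprK.
Unshelve. all: by end_near. Qed.

Lemma levy_g_ge0 r : 0 < r -> 0 <= levy_g r.
Proof.
move=> /levy_S_surj[y y0 <-]; rewrite /levy_g xB_levy_S//.
apply: mulr_ge0; first by rewrite mulr_ge0 ?hB_integrand_ge0// divr_ge0 ?mulr_ge0 ?pi_ge0.
by rewrite invr_ge0 oppr_ge0 ltW// levy_S'_lt0.
Qed.

(** The Jacobian [- levy_S'] cancels the factor that the chain rule put into [levy_g]: in the
    variable [y], [xB] disappears and only the integrand of [hB] is left. *)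
Lemma levy_gS y : 0 < y ->
  levy_g (levy_S y) * - levy_S' y = 1 / (4 * pi) * hB_integrand B s y.
Proof.
move=> y0; rewrite /levy_g xB_levy_S// divfK//.
by rewrite oppr_eq0 lt_eqF// levy_S'_lt0.
Qed.

Lemma continuous_levy_S' y : 0 < y -> {for y, continuous levy_S'}.
Proof.
move=> y0; have h := is_derive_continuous (is_derive_q y).
have hF := is_derive_continuous (is_derive_levy_F y).
have q0 : q y != 0 by rewrite gt_eqF// q_gt0.
have F0 : levy_F y ^+ 2 != 0 by rewrite gt_eqF// exprn_gt0// levy_F_gt0.
apply: cvgN; apply: cvgM; first exact: cvg_cst.
apply: cvgM; last first.
  apply: cvgV => //.
  exact: (cvgM hF hF).
apply: cvgD.
  by apply: cvgD; [apply: cvgM => //; exact: cvg_cst|exact: cvg_cst].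
apply: cvgM; last exact: cvgV.
by apply: cvgM; [exact: cvg_cst|exact: exprn_continuous].
Qed.

Lemma continuous_levy_g r : 0 < r -> {for r, continuous levy_g}.
Proof.
move=> r0; have [y y0 yr] := levy_S_surj r0.
have h := is_derive_continuous (is_derive_xB y0); rewrite yr in h.
have xr : xB gamma B s r = y by rewrite -yr xB_levy_S.
have c1 : {for r, continuous (hB_integrand B s \o xB gamma B s)}.
  by apply: continuous_comp; [exact: h|exact: continuous_hB_integrand].
have c2 : {for r, continuous (levy_S' \o xB gamma B s)}.
  by apply: continuous_comp; [exact: h|rewrite xr; exact: continuous_levy_S'].
apply: cvgM; first by apply: cvgM; [exact: cvg_cst|exact: c1].
apply: cvgV; first by rewrite oppr_eq0 xr lt_eqF// levy_S'_lt0.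
by apply: cvgN; exact: c2.
Qed.

Lemma levy_F_ge y : 0 < y -> y ^+ 2 - B * y <= levy_F y.
Proof.
move=> y0; rewrite /levy_F expr2 -mulrBl ler_wpM2r ?(ltW y0)// -/(q y).
by move: (q y) (q_ge_id y) sB (q_gt0 y) => u h1 /andP[h2 h3] h4; lra.
Qed.

Lemma levy_S_cvgy : levy_S y @[y --> +oo] --> (0 : R).
Proof.
rewrite /levy_S (_ : (fun _ => _) = (fun y => pi / gamma * (levy_F y)^-1)); last first.
  by apply/funext => z; rewrite invfM mulrA.
rewrite -(mulr0 (pi / gamma)); apply: cvgM; first exact: cvg_cst.
apply/gtr0_cvgV0.
  near=> y; apply: levy_F_gt0; near: y; exact: nbhs_pinfty_gt.
apply/cvgryPge => A; near=> y.
have y0 : 0 < y by near: y; exact: nbhs_pinfty_gt.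
have yB : B + `|A| + 1 <= y by near: y; apply: nbhs_pinfty_ge; rewrite num_real.
rewrite (le_trans _ (levy_F_ge y0))// expr2 -mulrBl.
rewrite (le_trans (ler_norm A))// (@le_trans _ _ (`|A| * 1))// ?mulr1//.
have := normr_ge0 A; move: y0 yB B0; move: `|A| => a y0 yB b0 a0; nra.
Unshelve. all: by end_near. Qed.

Lemma levy_S_cvg0 : levy_S y @[y --> 0^'+] --> +oo.
Proof.
rewrite /levy_S (_ : (fun _ => _) = (fun y => pi / gamma * (levy_F y)^-1)); last first.
  by apply/funext => z; rewrite invfM mulrA.
apply: gt0_cvgMry; first by rewrite divr_gt0 ?pi_gt0.
apply/gtr0_cvgV0.
  near=> y; rewrite invr_gt0; apply: levy_F_gt0; near: y; exact: nbhs_right_gt.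
suff h : levy_F y @[y --> 0^'+] --> (0 : R).
  by apply: cvg_trans h; apply: near_eq_cvg; near=> y; rewrite /= invrK.
have h : levy_F y @[y --> (0 : R)] --> levy_F 0.
  exact: is_derive_continuous (is_derive_levy_F 0).
by rewrite levy_F0 in h; exact: cvg_at_right_filter.
Unshelve. all: by end_near. Qed.

End LevyKernel.

(** * The exponent of the Levy process *)

Section Tonelli.
Context {R : realType}.
Notation mu := (@lebesgue_measure R).
Local Open Scope ereal_scope.
Variables (D1 D2 : set R) (f : R -> R -> \bar R).
Hypotheses (mD1 : measurable D1) (mD2 : measurable D2).
Hypothesis mf : measurable_fun (D1 `*` D2) (fun z : R * R => f z.1 z.2).
Hypothesis f0 : forall x y, D1 x -> D2 y -> 0 <= f x y.

Let g := (fun z : R * R => f z.1 z.2) \_ (D1 `*` D2).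

Let mg : measurable_fun setT g.
Proof. by apply/(measurable_restrictT _ _).1 => //; exact: measurableX. Qed.

Let g0 z : 0 <= g z.
Proof.
rewrite /g patchE; case: ifPn => // /set_mem[h1 h2].
exact: f0.
Qed.

Let E1 x : \int[mu]_y g (x, y) = (fun x => \int[mu]_(y in D2) f x y) \_ D1 x.
Proof.
rewrite patchE; case: ifPn => [/set_mem xD|xD].
  rewrite [RHS]integral_mkcond; apply: eq_integral => y _.
  rewrite /g !patchE; case: ifPn => [/set_mem[_ /= h]|h].
    by rewrite mem_set.
  by rewrite memNset// => yD; move: h; rewrite mem_set.
rewrite integral0_eq// => y _; rewrite /g patchE memNset// => -[/= h _].
by move: xD; rewrite mem_set.
Qed.

Let E2 y : \int[mu]_x g (x, y) = (fun y => \int[mu]_(x in D1) f x y) \_ D2 y.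
Proof.
rewrite patchE; case: ifPn => [/set_mem xD|xD].
  rewrite [RHS]integral_mkcond; apply: eq_integral => x _.
  rewrite /g !patchE; case: ifPn => [/set_mem[/= h _]|h].
    by rewrite mem_set.
  by rewrite memNset// => yD; move: h; rewrite mem_set.
rewrite integral0_eq// => x _; rewrite /g patchE memNset// => -[/= _ h].
by move: xD; rewrite mem_set.
Qed.

Lemma measurable_ge0_partial_integral :
  measurable_fun D1 (fun x => \int[mu]_(y in D2) f x y).
Proof.
have := @measurable_fun_fubini_tonelli_F _ _ _ _ R mu g mg g0.
rewrite /fubini_F (_ : (fun _ => _) = (fun x => \int[mu]_(y in D2) f x y) \_ D1).
  by move/(measurable_restrictT _ mD1).2.
by apply/funext => x; exact: E1.
Qed.

Lemma ge0_tonelli_set :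
  \int[mu]_(x in D1) \int[mu]_(y in D2) f x y =
  \int[mu]_(y in D2) \int[mu]_(x in D1) f x y.
Proof.
rewrite integral_mkcond [RHS]integral_mkcond.
transitivity (\int[mu]_x \int[mu]_y g (x, y)).
  by apply: eq_integral => x _; rewrite E1.
rewrite (@fubini_tonelli _ _ _ _ R mu mu g mg g0).
by apply: eq_integral => y _; rewrite -E2.
Qed.

End Tonelli.

Lemma measurable_inv {R : realType} : measurable_fun setT (@GRing.inv R).
Proof.
have m0 : measurable [set (0 : R)] by exact: measurable_set1.
rewrite -(setvU [set (0 : R)]); apply/(measurable_funU _ (measurableC m0) m0).
split; last exact: measurable_fun_set1.
apply: open_continuous_measurable_fun; first exact/closed_openC/closed_eq.
move=> x /set_mem/= /eqP x0; exact: inv_continuous.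
Qed.

(** * The integral of 1 - cos against the Levy density, one sign at a time *)

Section LevyExponentIntegral.
Context {R : realType}.
Notation mu := (@lebesgue_measure R).
Variables (gamma B s : R).
Hypotheses (gamma0 : 0 < gamma) (B0 : 0 < B) (s1 : s = 1 \/ s = - 1).
Implicit Types (x y r v t : R).

Let g := levy_g gamma B s.
Let P : set R := `]0, +oo[%classic.

Let Pgt0 x : P x -> 0 < x. Proof. by rewrite /P/= in_itv/= andbT. Qed.

Let inP x : 0 < x -> P x. Proof. by rewrite /P/= in_itv/= andbT. Qed.

Let mP : measurable P. Proof. exact: measurable_itv. Qed.

Let k (theta r t : R) : R :=
  (1 - cos (theta * r)) * (expR (- t) * (2 * pi / t * g (2 * pi * r / t))).

Let pi2_gt0 : 0 < 2 * pi :> R. Proof. by rewrite mulr_gt0// pi_gt0. Qed.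

Let arg_gt0 r t : 0 < r -> 0 < t -> 0 < 2 * pi * r / t.
Proof. by move=> r0 t0; exact: divr_gt0 (mulr_gt0 pi2_gt0 r0) t0. Qed.

Lemma levy_N_integrand_ge0 r t : 0 < r -> 0 < t -> 0 <= expR (- t) * (2 * pi / t * g (2 * pi * r / t)).
Proof.
move=> r0 t0; apply: mulr_ge0; first exact: expR_ge0.
exact: mulr_ge0 (ltW (divr_gt0 pi2_gt0 t0)) (levy_g_ge0 gamma0 B0 s1 (arg_gt0 r0 t0)).
Qed.

Let k0 theta r t : P r -> P t -> 0 <= k theta r t.
Proof.
move=> /Pgt0 r0 /Pgt0 t0; rewrite /k mulr_ge0 ?subr_ge0 ?cos_le1//.
exact: levy_N_integrand_ge0.
Qed.

Lemma measurable_levy_g : measurable_fun (`]0, +oo[%classic : set R) g.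
Proof.
apply: open_continuous_measurable_fun => // x /set_mem/Pgt0 x0.
exact: continuous_levy_g.
Qed.

Let mk0 : measurable_fun (P `*` P) (fun z : R * R =>
  expR (- z.2) * (2 * pi / z.2 * g (2 * pi * z.1 / z.2))).
Proof.
have mPP : measurable (P `*` P) by apply: measurableX.
have m2 : measurable_fun (P `*` P) (fun z : R * R => z.2^-1).
  apply: measurable_funTS.
  exact: measurableT_comp measurable_inv measurable_snd.
apply: measurable_funM.
  apply: measurable_funTS; apply: measurableT_comp => //.
  by apply: measurableT_comp.
apply: measurable_funM; first by apply: measurable_funM.
apply: (@measurable_comp _ _ _ _ _ _ P g (P `*` P)) => //.
- move=> _ [[r t] [/= /Pgt0 r0 /Pgt0 t0] <-] /=.
  exact/inP/arg_gt0.
- exact: measurable_levy_g.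
- apply: measurable_funM => //; apply: measurable_funM => //.
  by apply: measurable_funTS; exact: measurable_fst.
Qed.

Let mk theta : measurable_fun (P `*` P) (fun z : R * R => (k theta z.1 z.2)%:E).
Proof.
apply/measurable_EFinP; apply: measurable_funM; last exact: mk0.
apply: measurable_funTS; apply: measurable_funB => //.
apply: measurableT_comp; first by apply: continuous_measurable_fun; exact: continuous_cos.
by apply: measurable_funM => //; exact: measurable_fst.
Qed.

Lemma measurable_levy_N_integrand r : 0 < r -> measurable_fun P (fun t =>
  (expR (- t) * (2 * pi / t * g (2 * pi * r / t)))%:E).
Proof.
move=> r0; apply/measurable_EFinP.
apply: (@measurable_comp _ _ _ _ _ _ (P `*` P) _ P (pair r)) mk0 _.
- exact: measurableX.
- by move=> _ [t tP <-]; split => //; exact: inP.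
- exact: measurable_funTS (measurable_pair1 r).
Qed.

(** The expectation in [nu_density] for one sign. It is kept in the extended reals because its
    finiteness is obtained only almost everywhere, in [integral_onem_cos_nu]. *)
Definition levy_N (r : R) : \bar R :=
  (\int[mu]_(t in `]0%R, +oo[) (expR (- t) * (2 * pi / t * g (2 * pi * r / t)))%:E)%E.

Lemma measurable_levy_N : measurable_fun P levy_N.
Proof.
apply: (@measurable_ge0_partial_integral R P P (fun r t =>
  (expR (- t) * (2 * pi / t * g (2 * pi * r / t)))%:E)) => //.
  by apply/measurable_EFinP; exact: mk0.
by move=> r t /Pgt0 r0 /Pgt0 t0; rewrite lee_fin levy_N_integrand_ge0.
Qed.

(** At fixed [t] the substitution is [r = t / (2 * pi) * levy_S y], which turns the argument
    [2 * pi * r / t] of [g] into [levy_S y]; [levy_gS] then removes [g]. *)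
Let inner theta t : 0 < t ->
  (\int[mu]_(r in P) (k theta r t)%:E =
   \int[mu]_(y in P) ((expR (- t) * (1 - cos (theta * levy_S gamma B s y / (2 * pi) * t)))
     * (1 / (4 * pi) * hB_integrand B s y))%:E)%E.
Proof.
move=> t0; have tp : 0 < t / (2 * pi) by rewrite divr_gt0.
have tpi : (t / (2 * pi)) != 0 by rewrite gt_eqF.
pose S y := t / (2 * pi) * levy_S gamma B s y.
pose S' y := t / (2 * pi) * levy_S' gamma B s y.
have dS y : 0 < y -> is_derive y (1 : R) S (S' y).
  move=> y0; have h := is_derive_levy_S gamma B0 s1 y0.
  by apply: is_derive_eq; rewrite /S' /GRing.scale/=.
rewrite (@decreasing_substitution_0y R S S' (k theta ^~ t) dS).
- apply: eq_integral => y /set_mem/Pgt0 y0; congr EFin.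
  rewrite /k /S /S'.
  have -> : 2 * pi * (t / (2 * pi) * levy_S gamma B s y) / t = levy_S gamma B s y.
    move: (2 * pi) pi2_gt0 => p p0.
    by field; rewrite (gt_eqF t0) (gt_eqF p0).
  rewrite -(levy_gS gamma0 B0 s1 y0) -/g.
  have -> : theta * (t / (2 * pi) * levy_S gamma B s y) =
      theta * levy_S gamma B s y / (2 * pi) * t by ring.
  move: (g _) (cos _) (expR _) (levy_S' _ _ _ _) => a b c d.
  move: (2 * pi) pi2_gt0 => p p0.
  by field; rewrite (gt_eqF t0) (gt_eqF p0).
- move=> y y0; apply: cvgM; first exact: cvg_cst.
  exact: continuous_levy_S'.
- by move=> y y0; rewrite /S' pmulr_rlt0//; exact: levy_S'_lt0.
- by move=> y y0; rewrite mulr_gt0//; exact: levy_S_gt0.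
- rewrite -(mulr0 (t / (2 * pi))); apply: cvgM; first exact: cvg_cst.
  exact: levy_S_cvgy.
- by apply: gt0_cvgMry => //; exact: levy_S_cvg0.
- move=> r r0.
  have c1 : {for r, continuous (g \o (fun r => 2 * pi * r / t))}.
    apply: continuous_comp.
      by apply: cvgM; [apply: cvgM => //; exact: cvg_cst|exact: cvg_cst].
    by apply: continuous_levy_g => //; exact: arg_gt0.
  have c2 : {for r, continuous (cos \o (fun r => theta * r))}.
    apply: continuous_comp; last exact: continuous_cos.
    by apply: cvgM => //; exact: cvg_cst.
  apply: cvgM; first by apply: cvgB; [exact: cvg_cst|exact: c2].
  apply: cvgM; first exact: cvg_cst.
  by apply: cvgM; [exact: cvg_cst|exact: c1].
- by move=> r r0; apply: k0; exact: inP.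
Qed.

(* The substitution [r = levy_S y] turns the density of h_B into
   [hB_integrand], and averaging [1 - cos] over the exponential time with
   [integral0y_expR_onem_cos] produces the quotient. *)
Definition levy_q (theta y : R) : R :=
  hB_integrand B s y * (theta ^+ 2 / (theta ^+ 2 + 4 * gamma ^+ 2 * levy_F B s y ^+ 2)).

(** The integrands are nonnegative, so the order of integration is exchanged freely: once to
    substitute for [r] at fixed [t], and once more to average over [t] at fixed [y]. *)
Lemma levy_exponent_integral (theta : R) :
  (\int[mu]_(r in `]0%R, +oo[) ((1 - cos (theta * r))%:E * levy_N r) =
   \int[mu]_(y in `]0%R, +oo[) (1 / (4 * pi) * levy_q theta y)%:E)%E.
Proof.
transitivity (\int[mu]_(r in P) \int[mu]_(t in P) (k theta r t)%:E)%E.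
  apply: eq_integral => r /set_mem/Pgt0 r0; rewrite /levy_N -ge0_integralZl//.
  - exact: measurable_levy_N_integrand.
  - by move=> t /Pgt0 t0; rewrite lee_fin levy_N_integrand_ge0.
rewrite ge0_tonelli_set//; last by move=> r t ? ?; rewrite lee_fin k0.
under eq_integral => t /set_mem/Pgt0 t0 do rewrite inner//.
have mH : measurable_fun setT (fun y => 1 / (4 * pi) * hB_integrand B s y).
  apply: measurable_funM => //; apply: continuous_measurable_fun.
  exact: continuous_hB_integrand.
have H0 y : 0 <= 1 / (4 * pi) * hB_integrand B s y.
  by rewrite mulr_ge0 ?hB_integrand_ge0// divr_ge0 ?mulr_ge0 ?pi_ge0.
have E0 c t : 0 <= expR (- t) * (1 - cos (c * t)).
  by rewrite mulr_ge0 ?expR_ge0// subr_ge0 cos_le1.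
have mS : measurable_fun P (levy_S gamma B s).
  apply: open_continuous_measurable_fun => // y /set_mem/Pgt0 y0.
  exact: is_derive_continuous (is_derive_levy_S gamma B0 s1 y0).
rewrite ge0_tonelli_set//; last 2 first.
- apply/measurable_EFinP; apply: measurable_funM; last first.
    by apply: measurable_funTS; exact: measurableT_comp mH measurable_snd.
  apply: measurable_funM.
    apply: measurable_funTS; apply: measurableT_comp => //.
    by apply: measurableT_comp.
  apply: measurable_funB => //; apply: measurableT_comp.
    by apply: continuous_measurable_fun; exact: continuous_cos.
  apply: measurable_funM; last by apply: measurable_funTS; exact: measurable_fst.
  apply: measurable_funM => //; apply: measurable_funM => //.
  apply: (@measurable_comp _ _ _ _ _ _ P _ (P `*` P)) mS _ => //.
  + by move=> _ [[t y] [_ yP] <-].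
  + by apply: measurable_funTS; exact: measurable_snd.
- by move=> t y _ _; rewrite lee_fin mulr_ge0.
apply: eq_integral => y /set_mem/Pgt0 y0.
under eq_integral do rewrite EFinM.
pose c := theta * levy_S gamma B s y / (2 * pi).
have mE : measurable_fun P (fun t => (expR (- t) * (1 - cos (c * t)))%:E).
  apply/measurable_EFinP; apply: measurable_funTS.
  exact: measurable_expR_onem_cos.
rewrite ge0_integralZr//; last by rewrite lee_fin.
rewrite [X in (X * _)%E](integral_expR_onem_cos1 c).
rewrite -EFinM; congr EFin.
rewrite /c.
have F0 := levy_F_gt0 B0 s1 y0.
rewrite /levy_q /levy_S; move: (levy_F B s y) F0 (hB_integrand _ _ _) pi (pi_gt0 R).
move=> F F0 h p p0.
have d1 : theta ^+ 2 + 4 * gamma ^+ 2 * F ^+ 2 != 0.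
  by rewrite gt_eqF// ltr_wpDl ?sqr_ge0// !mulr_gt0 ?exprn_gt0.
(* The factors [pi] cancel. The square of this frequency is the origin of [4 * gamma ^+ 2] in
   [levy_q]. *)
have -> : theta * (p / (gamma * F)) / (2 * p) = theta / (2 * gamma * F).
  by field; rewrite !gt_eqF.
field.
by rewrite (gt_eqF p0) (gt_eqF F0) (gt_eqF gamma0) d1.
Qed.

End LevyExponentIntegral.

(** Both hypotheses together give [v <= 1 + K], by the bound 1 near the origin and by
    [v <= v * y ^+ 2] elsewhere; adding [v * y ^+ 2 <= K] gives the claim. *)
Lemma le_oneDsqrV {R : realFieldType} (v y K : R) :
  0 <= K -> (y ^+ 2 <= 1 -> v <= 1) -> v * y ^+ 2 <= K ->
  v <= (1 + 2 * K) * (1 + y ^+ 2)^-1.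
Proof.
move=> K0 vy vK; have y2 := sqr_ge0 y.
rewrite ler_pdivlMr ?ltr_wpDr// mulrDr mulr1 (_ : 1 + 2 * K = 1 + K + K); last by ring.
apply: lerD => //; have [y1|y1] := leP (y ^+ 2) 1; first by have := vy y1; lra.
nra.
Qed.

(** * The Levy-Khintchine integral of an even density *)

Section EvenDensity.
Context {R : realType}.
Notation mu := (@lebesgue_measure R).
Implicit Types (theta x y r t : R).

Let P : set R := `]0, +oo[%classic.
Let Pgt0 x : P x -> 0 < x. Proof. by rewrite /P/= in_itv/= andbT. Qed.
Let inP x : 0 < x -> P x. Proof. by rewrite /P/= in_itv/= andbT. Qed.
Let mP : measurable P. Proof. exact: measurable_itv. Qed.

Variable nu : R -> R.
Hypothesis mnu : measurable_fun P nu.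
Hypothesis nu0 : forall r, 0 < r -> 0 <= nu r.
Hypothesis nuN : forall r, 0 < r -> nu (- r) = nu r.

Let negE : [set r : R | r != 0] = (-%R @^-1` P) `|` P.
Proof.
apply/seteqP; split => x /=.
  by rewrite neq_lt => /orP[h|h]; [left; apply: inP; rewrite oppr_gt0|right; exact: inP].
by rewrite neq_lt => -[/Pgt0|/Pgt0->]; rewrite ?oppr_gt0 ?orbT// => ->.
Qed.

Let mNP : measurable (-%R @^-1` P).
Proof. by rewrite /P opp_preimage_itvbndy; exact: measurable_itv. Qed.

Let dNP : [disjoint (-%R @^-1` P) & P].
Proof.
apply/disj_setPS => x [/= /Pgt0 + /Pgt0 x0].
by rewrite oppr_gt0 ltNge (ltW x0).
Qed.

Let mnuN : measurable_fun (-%R @^-1` P) (nu).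
Proof.
apply: (@eq_measurable_fun _ _ _ _ _ (nu \o -%R)).
  move=> r /set_mem /Pgt0 /= r0; rewrite -[in RHS](opprK r).
  by rewrite -nuN// opprK.
apply: (@measurable_comp _ _ _ _ _ _ P _ (-%R @^-1` P)) mnu _ => //.
by move=> _ [x xP <-].
Qed.

Let mnuT : measurable_fun [set r : R | r != 0] (nu).
Proof. by rewrite negE; apply/measurable_funU. Qed.

Let nu_even r : r != 0 -> nu (- r) = nu r.
Proof.
rewrite neq_lt => /orP[r0|r0]; last exact (nuN r0).
have h : 0 < - r by rewrite oppr_gt0.
by have := nuN h; rewrite opprK => ->.
Qed.

Let D : set R := [set r : R | r != 0].

Let f theta r := (1 - cos (theta * r)) * nu r.

Let o theta r := (sin (theta * r) - theta * r * (if `|r| < 1 then 1 else 0)) *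
  nu r.

Let mD : measurable [set r : R | r != 0].
Proof. by rewrite negE; exact: measurableU. Qed.

Let mf theta : measurable_fun [set r : R | r != 0] (f theta).
Proof.
apply: measurable_funM => //; apply: measurable_funTS.
apply: measurable_funB => //; apply: measurableT_comp.
  by apply: continuous_measurable_fun; exact: continuous_cos.
exact: measurable_funM.
Qed.

Let mo theta : measurable_fun [set r : R | r != 0] (o theta).
Proof.
apply: measurable_funM => //; apply: measurable_funTS.
apply: measurable_funB => //.
  apply: measurableT_comp; last exact: measurable_funM.
  by apply: continuous_measurable_fun; exact: continuous_sin.
apply: measurable_funM; first exact: measurable_funM.
apply: measurable_fun_ifT => //.
by apply: measurable_fun_ltr => //; exact: measurableT_comp.
Qed.

(** Reflection exchanges the positive and the negative part of the odd function [o]. If their common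
    integral is infinite, the difference is an infinity, which [fine] sends to 0. *)
Let int_o theta : \int[mu]_(r in D) o theta r = 0.
Proof.
have odd r : r != 0 -> o theta (- r) = - o theta r.
  by move=> r0; rewrite /o nu_even// normrN mulrN sinN; case: ifP => _; ring.
have DN : -%R @^-1` [set r : R | r != 0] = [set r : R | r != 0].
  by apply/seteqP; split => x /=; rewrite oppr_eq0.
have mo' : measurable_fun [set r : R | r != 0] (EFin \o o theta).
  by apply/measurable_EFinP; exact: mo.
rewrite /Rintegral integralE.
set p := (X in (X - _)%E); set n := (X in (_ - X)%E).
have -> : p = n.
  rewrite /p /n -[LHS]ge0_integral_opp// ?DN; last exact: measurable_funepos.
  apply: eq_integral => r /set_mem/= r0.
  by rewrite funeposE funenegE odd// EFinN.
have : (0 <= n)%E by apply: integral_ge0 => r _; exact: funeneg_ge0.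
by case: n => [x _|_|//] //=; rewrite subrr.
Qed.

Let f0 theta r : r != 0 -> (0 <= (f theta r)%:E)%E.
Proof.
move=> r0; rewrite lee_fin mulr_ge0// ?subr_ge0 ?cos_le1//.
move: r0; rewrite neq_lt => /orP[r0|r0]; last exact: nu0.
by rewrite -nu_even ?lt_eqF// nu0// oppr_gt0.
Qed.

Let int_f theta I :
  (\int[mu]_(r in P) (f theta r)%:E = I%:E)%E ->
  (\int[mu]_(r in D) (f theta r)%:E = (I + I)%:E)%E.
Proof.
move=> intf; have mf' : measurable_fun [set r : R | r != 0] (EFin \o f theta).
  by apply/measurable_EFinP; exact: mf.
rewrite /D negE ge0_integral_setU//; last 2 first.
- by rewrite -negE.
- by move=> r; rewrite -negE; exact: f0.
have -> : (\int[mu]_(r in -%R @^-1` P) (f theta r)%:E = \int[mu]_(r in P) (f theta r)%:E)%E.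
  rewrite -[RHS]ge0_integral_opp//.
  - apply: eq_integral => r /set_mem/Pgt0 r0; rewrite /f mulrN cosN nu_even//.
    by rewrite lt_eqF// -oppr_gt0.
  - by apply: measurable_funS mf' => // r /Pgt0 r0; rewrite /= gt_eqF.
  - by move=> r /Pgt0 r0; apply: f0; rewrite gt_eqF.
by rewrite intf.
Qed.

(** The imaginary part, compensator included, is odd and vanishes; the real part is even, and its
    two half lines give [I + I]. *)
Lemma cintegral_even_density theta I :
  (\int[mu]_(r in `]0%R, +oo[) ((1 - cos (theta * r)) * nu r)%:E = I%:E)%E ->
  cintegral [set r : R | r != 0] (fun r =>
    (cis (theta * r) - 1 - (theta * r * (if `|r| < 1 then 1 else 0)) *i)
      * (nu r)%:C)%C = (- (I + I))%:C%C.
Proof.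
move=> intI; rewrite /cintegral; apply/eqP; rewrite eq_complex /=.
apply/andP; split; apply/eqP; last first.
  rewrite -[RHS](int_o theta); apply: eq_Rintegral => r _.
  by rewrite /o /= mulr0 add0r subr0.
transitivity (\int[mu]_(r in D) (- f theta r)).
  by apply: eq_Rintegral => r _; rewrite /f /= mulr0 !subr0 -mulNr opprB.
rewrite /Rintegral; under eq_integral do rewrite EFinN.
rewrite integral_ge0N ?(int_f intI)// => r r0.
exact: f0.
Qed.

End EvenDensity.

(** * The exponent as an integral over y *)

Section LevyExponent.
Context {R : realType}.
Notation mu := (@lebesgue_measure R).
Implicit Types (s theta x y r t : R).
Variables (gamma B : R).
Hypotheses (gamma0 : 0 < gamma) (B0 : 0 < B).

Let P : set R := `]0, +oo[%classic.
Let Pgt0 x : P x -> 0 < x. Proof. by rewrite /P/= in_itv/= andbT. Qed.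
Let inP x : 0 < x -> P x. Proof. by rewrite /P/= in_itv/= andbT. Qed.
Let mP : measurable P. Proof. exact: measurable_itv. Qed.

Section sign.
Variable s : R.
Hypothesis s1 : s = 1 \/ s = - 1.

Lemma levy_q_ge0 theta y : 0 <= levy_q gamma B s theta y.
Proof.
apply: mulr_ge0; first exact: hB_integrand_ge0.
apply: divr_ge0; first exact: sqr_ge0.
apply: addr_ge0; first exact: sqr_ge0.
by apply: mulr_ge0; rewrite ?sqr_ge0// mulr_ge0 ?sqr_ge0.
Qed.

Let den_gt0 theta y : 0 < y -> 0 < theta ^+ 2 + 4 * gamma ^+ 2 * levy_F B s y ^+ 2.
Proof.
move=> y0; rewrite ltr_wpDl ?sqr_ge0//.
have F0 := levy_F_gt0 B0 s1 y0.
exact: mulr_gt0 (mulr_gt0 _ (exprn_gt0 _ _)) (exprn_gt0 _ F0).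
Qed.

(** The majorant does not depend on [B], as the limit [B -> 0] requires. For large [y] it comes from
    dropping [theta ^+ 2] in the denominator, once the weight is compared with [levy_F]. *)
Lemma levy_q_le theta y : 0 < y ->
  levy_q gamma B s theta y <=
  (1 + 2 * (theta ^+ 2 / (16 * gamma ^+ 2))) * (1 + y ^+ 2)^-1.
Proof.
move=> y0; have d0 := den_gt0 theta y0.
have F0 := levy_F_gt0 B0 s1 y0.
pose q := Num.sqrt (y ^+ 2 + B ^+ 2 / 4).
have q2 : q ^+ 2 = y ^+ 2 + B ^+ 2 / 4.
  by rewrite sqr_sqrtr// addr_ge0 ?sqr_ge0// divr_ge0 ?sqr_ge0.
have q0 : 0 < q.
  by rewrite sqrtr_gt0 ltr_wpDl ?sqr_ge0// divr_gt0// exprn_gt0.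
have g2 : 0 < 16 * gamma ^+ 2 by rewrite mulr_gt0// exprn_gt0.
have t2 := sqr_ge0 theta.
have hE : hB_integrand B s y = (2 * q + s * B) / (4 * q) * y ^+ 2.
  by rewrite /hB_integrand -/q; field; rewrite gt_eqF.
have FE : levy_F B s y = (2 * q + s * B) * y by [].
have slope : 0 < 2 * q + s * B by move: F0; rewrite FE pmulr_lgt0.
(* Since [y ^+ 2 = q ^+ 2 - B ^+ 2 / 4] and [s ^+ 2 = 1], the difference of the two sides is a
   nonnegative multiple of the square [(q + s * B / 2) ^+ 2]. *)
have h4 : 4 * (hB_integrand B s y * y ^+ 2) <= levy_F B s y ^+ 2.
  rewrite hE FE exprMn -subr_ge0.
  have -> : ((2 * q + s * B) ^+ 2 * y ^+ 2 -
      4 * ((2 * q + s * B) / (4 * q) * y ^+ 2 * y ^+ 2)) =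
      (2 * q + s * B) * y ^+ 2 / q * ((2 * q + s * B) * q - y ^+ 2).
    by field; rewrite gt_eqF.
  apply: mulr_ge0.
    by rewrite divr_ge0 ?(ltW q0)// mulr_ge0 ?sqr_ge0 ?(ltW slope).
  have -> : y ^+ 2 = q ^+ 2 - B ^+ 2 / 4 by rewrite q2 addrK.
  rewrite (_ : _ - _ = (q + s * B / 2) ^+ 2 + (1 - s ^+ 2) * B ^+ 2 / 4); last by field.
  have -> : s ^+ 2 = 1 by case: s1 => ->; rewrite ?sqrrN expr1n.
  by rewrite subrr !mul0r addr0 sqr_ge0.
have h0 := hB_integrand_ge0 B0 s1 y.
have BQ : B <= 2 * q.
  rewrite -(@ler_pXn2r _ 2)// ?nnegrE ?mulr_ge0 ?(ltW q0) ?(ltW B0)//.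
  by rewrite exprMn q2; move: (sqr_ge0 y) => y2; lra.
have F2 : 0 <= 4 * gamma ^+ 2 * levy_F B s y ^+ 2.
  by apply: mulr_ge0; rewrite ?sqr_ge0// mulr_ge0 ?sqr_ge0.
apply: le_oneDsqrV; first by rewrite divr_ge0// ltW.
  move=> y1; apply: le_trans y1; apply: (@le_trans _ _ (hB_integrand B s y)).
    by rewrite /levy_q ler_piMr// ler_pdivrMr// mul1r lerDl.
  rewrite hE ler_piMl ?sqr_ge0// ler_pdivrMr ?mulr_gt0// mul1r.
  by move: q BQ q0 {hE FE slope q2} B0 => q BQ q0 B0'; case: s1 => ->; lra.
rewrite /levy_q mulrAC mulrA ler_pdivrMr//.
rewrite (_ : _ * (_ + _) = theta ^+ 2 / (16 * gamma ^+ 2) * theta ^+ 2 +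
    theta ^+ 2 * (levy_F B s y ^+ 2 / 4)); last by field; rewrite gt_eqF.
apply: (@le_trans _ _ (theta ^+ 2 * (levy_F B s y ^+ 2 / 4))); last first.
  by rewrite lerDr mulr_ge0// divr_ge0// ltW.
have h5 : hB_integrand B s y * y ^+ 2 <= levy_F B s y ^+ 2 / 4.
  by rewrite ler_pdivlMr// mulrC.
rewrite [leLHS](_ : _ = theta ^+ 2 * (hB_integrand B s y * y ^+ 2)); last by ring.
exact: ler_wpM2l.
Qed.

Lemma continuous_levy_q theta y : 0 < y -> {for y, continuous (levy_q gamma B s theta)}.
Proof.
move=> y0; have hF := is_derive_continuous (is_derive_levy_F s B0 y).
apply: cvgM; first exact: continuous_hB_integrand.
apply: cvgM; first exact: cvg_cst.
apply: cvgV; first by rewrite gt_eqF// den_gt0.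
apply: cvgD; first exact: cvg_cst.
by apply: cvgM; [exact: cvg_cst|exact: (cvgM hF hF)].
Qed.

Lemma measurable_levy_q theta : measurable_fun P (levy_q gamma B s theta).
Proof.
apply: open_continuous_measurable_fun => // y /set_mem/Pgt0 y0.
exact: continuous_levy_q.
Qed.

Lemma integrable_levy_q theta :
  mu.-integrable P (EFin \o levy_q gamma B s theta).
Proof.
pose C := 1 + 2 * (theta ^+ 2 / (16 * gamma ^+ 2)).
have C0 : 0 <= C by rewrite addr_ge0// mulr_ge0// divr_ge0 ?sqr_ge0// mulr_ge0 ?sqr_ge0.
apply: (@le_integrable _ _ _ mu P mP _ (fun y => C%:E * ((1 + y ^+ 2)^-1)%:E)%E).
- by apply/measurable_EFinP; exact: measurable_levy_q.
- move=> y /Pgt0 y0 /=; rewrite lee_fin ger0_norm ?levy_q_ge0// ger0_norm.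
    exact: levy_q_le.
  by rewrite mulr_ge0// invr_ge0 addr_ge0// sqr_ge0.
- apply: integrableZl => //; apply: integrableS (@integrable_oneDsqrV R) => //.
Qed.

End sign.

Definition levy_psi theta : R :=
  gamma / pi * \int[mu]_(y in `]0, +oo[)
    (levy_q gamma B 1 theta y + levy_q gamma B (- 1) theta y).

Let N r : \bar R := (levy_N gamma B 1 r + levy_N gamma B (- 1) r)%E.

Let one1 : (1 : R) = 1 \/ (1 : R) = - 1. Proof. by left. Qed.
Let None1 : (- 1 : R) = 1 \/ (- 1 : R) = - 1. Proof. by right. Qed.

Let levy_N_ge0 s r : s = 1 \/ s = - 1 -> 0 < r -> (0 <= levy_N gamma B s r)%E.
Proof.
move=> s1 r0; apply: integral_ge0 => t /Pgt0 t0; rewrite lee_fin.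
apply: mulr_ge0; first exact: expR_ge0.
apply: mulr_ge0; first by rewrite divr_ge0 ?mulr_ge0 ?pi_ge0 ?ltW.
by apply: levy_g_ge0 => //; rewrite divr_gt0// mulr_gt0// mulr_gt0// pi_gt0.
Qed.

Lemma nu_densityE r : 0 < r -> nu_density gamma B r = 2 * gamma * fine (N r).
Proof.
move=> r0; rewrite /nu_density /Rintegral; congr (_ * fine _).
rewrite /N /levy_N -ge0_integralD//=; last 4 first.
- by move=> t /Pgt0 t0; rewrite lee_fin; exact: levy_N_integrand_ge0.
- exact: measurable_levy_N_integrand.
- by move=> t /Pgt0 t0; rewrite lee_fin; exact: levy_N_integrand_ge0.
- exact: measurable_levy_N_integrand.
pose h t := expR (- t) * (2 * pi / t *
  (gB gamma B 1 (2 * pi * r / t) + gB gamma B (- 1) (2 * pi * r / t))).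
transitivity (\int[mu]_t (((fun t => (h t)%:E) \_ `[0%R, +oo[) t))%E.
  apply: eq_integral => t _; rewrite /exponential_pdf !patchE.
  case: ifPn => _; last by rewrite mul0r.
  by rewrite mul1r mulN1r.
have hE t : t \in P -> (h t)%:E =
    ((expR (- t) * (2 * pi / t * levy_g gamma B 1 (2 * pi * r / t)))%:E +
     (expR (- t) * (2 * pi / t * levy_g gamma B (- 1) (2 * pi * r / t)))%:E)%E.
  move=> /set_mem/Pgt0 t0; rewrite -EFinD; congr EFin.
  have a0 : 0 < 2 * pi * r / t by rewrite divr_gt0// mulr_gt0// mulr_gt0// pi_gt0.
  by rewrite /h !gBE// !mulrDr.
rewrite -integral_mkcond -[LHS]integral_itv_obnd_cbnd//; last first.
  apply: eq_measurable_fun; first by move=> t tP; rewrite hE.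
  by apply: emeasurable_funD; exact: measurable_levy_N_integrand.
exact: eq_integral.
Qed.

Let gBN' x : 0 < x -> gB gamma B 1 (- x) + gB gamma B (- 1) (- x) =
  gB gamma B 1 x + gB gamma B (- 1) x.
Proof. by move=> x0; rewrite (gBN gamma0 B0 one1 x0) (gBN gamma0 B0 None1 x0). Qed.

Lemma nu_densityN r : 0 < r -> nu_density gamma B (- r) = nu_density gamma B r.
Proof.
rewrite /nu_density; move: gBN'.
move: (gB gamma B 1) (gB gamma B (- 1)) => g1 g2 gN r0.
apply: congr1; apply: eq_Rintegral => t _.
have [t0|t0] := ltP 0 t.
  have a0 : 0 < 2 * pi * r / t by rewrite divr_gt0// mulr_gt0// mulr_gt0// pi_gt0.
  have -> : 2 * pi * - r / t = - (2 * pi * r / t) by rewrite mulrN mulNr.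
  by rewrite gN.
have [tn|tn] := ltP t 0; last first.
  (* At [t = 0] the factor [2 * pi / t] is 0, by the convention that the inverse of 0 is 0. *)
  have -> : t = 0 by apply/eqP; rewrite eq_le t0 tn.
  by rewrite invr0 !mulr0 !mul0r !mulr0.
have -> : exponential_pdf 1 t = 0.
  rewrite /exponential_pdf patchE memNset//.
  by rewrite /mkset in_itv/= andbT leNgt tn.
by rewrite !mul0r.
Qed.

Lemma integral_onem_cos_levy_N theta :
  (\int[mu]_(r in P) ((1 - cos (theta * r))%:E * N r) =
   (1 / (4 * pi) * \int[mu]_(y in P)
     (levy_q gamma B 1 theta y + levy_q gamma B (- 1) theta y))%:E)%E.
Proof.
have c0 r : (0 <= (1 - cos (theta * r))%:E)%E by rewrite lee_fin subr_ge0 cos_le1.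
have mc : measurable_fun P (fun r => (1 - cos (theta * r))%:E).
  apply/measurable_EFinP; apply: measurable_funB => //; apply: measurableT_comp.
    by apply: continuous_measurable_fun; exact: continuous_cos.
  exact: measurable_funM.
have pi4 : (0 <= (1 / (4 * pi : R))%:E)%E by rewrite lee_fin divr_ge0// mulr_ge0// pi_ge0.
transitivity (\int[mu]_(r in P) ((1 - cos (theta * r))%:E * levy_N gamma B 1 r +
    (1 - cos (theta * r))%:E * levy_N gamma B (- 1) r))%E.
  by apply: eq_integral => r /set_mem/Pgt0 r0; rewrite ge0_muleDr// levy_N_ge0.
rewrite ge0_integralD//; last 4 first.
- by move=> r /Pgt0 r0; rewrite mule_ge0// levy_N_ge0.
- by apply: emeasurable_funM => //; exact: measurable_levy_N.
- by move=> r /Pgt0 r0; rewrite mule_ge0// levy_N_ge0.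
- by apply: emeasurable_funM => //; exact: measurable_levy_N.
rewrite !levy_exponent_integral//.
have h s : s = 1 \/ s = - 1 -> (\int[mu]_(y in P) (1 / (4 * pi) * levy_q gamma B s theta y)%:E =
    (1 / (4 * pi) * \int[mu]_(y in P) levy_q gamma B s theta y)%:E)%E.
  move=> s1; rewrite -RintegralZl//; last exact: integrable_levy_q.
  rewrite fineK//; apply: integrable_fin_num => //.
  under eq_fun do rewrite EFinM.
  by apply: integrableZl => //; exact: integrable_levy_q.
rewrite !h// -EFinD; congr EFin.
by rewrite -mulrDr -RintegralD//; exact: integrable_levy_q.
Qed.

Let mnu : measurable_fun P (nu_density gamma B).
Proof.
apply: (@eq_measurable_fun _ _ _ _ _ (fun r => 2 * gamma * fine (N r))).
  by move=> r /set_mem/Pgt0 r0; rewrite nu_densityE.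
apply: measurable_funM => //; apply: measurableT_comp; first exact: fine_measurable.
by apply: emeasurable_funD; exact: measurable_levy_N.
Qed.

Lemma nu_density_ge0 r : 0 < r -> 0 <= nu_density gamma B r.
Proof.
move=> r0; rewrite nu_densityE// mulr_ge0//; first by rewrite mulr_ge0// ltW.
by rewrite fine_ge0// adde_ge0// levy_N_ge0.
Qed.

(** [nu_density] contains [fine (N r)], which is 0 where [N r] is infinite. The integral of [M] is
    finite, so almost everywhere either [N r] is finite or [1 - cos (theta * r)] vanishes; in both
    cases the two integrands agree. *)
Lemma integral_onem_cos_nu theta :
  (\int[mu]_(r in P) ((1 - cos (theta * r)) * nu_density gamma B r)%:E =
   (levy_psi theta / 2)%:E)%E.
Proof.
pose M r := ((1 - cos (theta * r))%:E * N r)%E.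
have mc : measurable_fun P (fun r => 1 - cos (theta * r)).
  apply: measurable_funB => //; apply: measurableT_comp.
    by apply: continuous_measurable_fun; exact: continuous_cos.
  exact: measurable_funM.
have N0 r : 0 < r -> (0 <= N r)%E by move=> r0; rewrite adde_ge0// levy_N_ge0.
have M0 r : 0 < r -> (0 <= M r)%E.
  by move=> r0; rewrite mule_ge0 ?N0// lee_fin subr_ge0 cos_le1.
have mM : measurable_fun P M.
  apply: emeasurable_funM; first exact/measurable_EFinP.
  by apply: emeasurable_funD; exact: measurable_levy_N.
have iM : mu.-integrable P M.
  apply/integrableP; split => //.
  under eq_integral => r /set_mem/Pgt0 r0 do rewrite gee0_abs ?M0//.
  by rewrite integral_onem_cos_levy_N ltry.
transitivity (\int[mu]_(r in P) ((2 * gamma)%:E * M r))%E.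
  apply: ae_eq_integral => //.
  - by apply/measurable_EFinP; exact: measurable_funM.
  - exact: emeasurable_funM.
  - have [Z [mZ Z0 hZ]] := @integrable_ae _ _ _ mu P mP M iM.
    exists Z; split => // r /= hr; apply: hZ => h; apply: hr => rP.
    have /Pgt0 r0 := rP.
    rewrite nu_densityE// mulrCA EFinM; congr (_ * _)%E.
    move: (h rP) (N0 _ r0); rewrite /M; case: (N r) => [x _ _ //|/=|//].
    case: (ltgtP (1 - cos (theta * r)) 0) => [|c0|->]; last by rewrite mul0r mul0e.
      by rewrite ltNge subr_ge0 cos_le1.
    by rewrite gt0_muley ?lte_fin.
rewrite integralZl// integral_onem_cos_levy_N -EFinM; congr EFin.
rewrite /levy_psi -/P; move: (Rintegral _ _ _) pi (pi_gt0 R) => I p p0.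
by field; rewrite gt_eqF.
Qed.

Lemma levy_psi_ge0 theta : 0 <= levy_psi theta.
Proof.
rewrite mulr_ge0 ?divr_ge0 ?pi_ge0 ?(ltW gamma0)//.
by apply: Rintegral_ge0 => y _; rewrite addr_ge0// levy_q_ge0.
Qed.

Lemma PhiBE theta : PhiB gamma B theta = (- levy_psi theta)%:C%C.
Proof.
rewrite [in RHS](splitr (levy_psi theta)).
apply: cintegral_even_density.
- exact mnu.
- exact nu_density_ge0.
- exact nu_densityN.
- exact (integral_onem_cos_nu theta).
Qed.

End LevyExponent.

(** * Stable exponents *)

Section StableExponent.
Context {R : realType}.
Notation mu := (@lebesgue_measure R).
Implicit Types (theta b x y r t : R).
Variables (gamma beta : R) (k : nat).
Hypothesis gamma0 : 0 < gamma.
Hypothesis betaE : k.+1%:R * beta = (k.*2.+1)%:R.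

Let P : set R := `]0, +oo[%classic.
Let Pgt0 x : P x -> 0 < x. Proof. by rewrite /P/= in_itv/= andbT. Qed.
Let inP x : 0 < x -> P x. Proof. by rewrite /P/= in_itv/= andbT. Qed.
Let mP : measurable P. Proof. exact: measurable_itv. Qed.

Let beta_gt0 : 0 < beta.
Proof.
have k0 : (0 : R) < k.+1%:R by rewrite ltr0n.
by rewrite -(pmulr_rgt0 _ k0) betaE ltr0n.
Qed.

Let pow_y y : 0 < y -> (y ^+ k.+1) `^ (1 + beta) = y ^+ (k.+1 + k.*2.+1).
Proof.
move=> y0; rewrite -powR_mulrn ?(ltW y0)// -powRrM mulrDr mulr1 betaE -natrD.
by rewrite powR_mulrn ?(ltW y0).
Qed.

Let powRV x p : 0 <= x -> (x `^ p)^-1 = x^-1 `^ p.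
Proof. by move=> x0; rewrite -[in RHS]powR_inv1// -powRrM mulN1r powRN. Qed.

(** The substitution is [r = b / y ^+ k.+1]. Only integer powers of [y] remain, because [betaE]
    makes (k + 1)(1 + beta) the integer 3k + 2; the Jacobian brings it down to 2k. *)
Lemma onem_cos_powR_subst b : 0 < b ->
  (\int[mu]_(r in P) ((1 - cos r) / r `^ (1 + beta))%:E =
   \int[mu]_(y in P) (k.+1%:R * b `^ (- beta) *
     (y ^+ k.*2 * (1 - cos (b / y ^+ k.+1))))%:E)%E.
Proof.
move=> b0.
pose S y := b * (y ^+ k.+1)^-1.
pose S' y := - (k.+1%:R * b / y ^+ k.+2).
have dS y : 0 < y -> is_derive y (1 : R) S (S' y).
  move=> y0; have h : is_derive y (1 : R) (fun y => y ^+ k.+1) (k.+1%:R * y ^+ k).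
    by apply: DeriveDef; [exact: exprn_derivable|rewrite -derive1E exp_derive1].
  have yk : y ^+ k.+1 != 0 by rewrite gt_eqF// exprn_gt0.
  have h2 := @is_deriveV R (fun y => y ^+ k.+1) y _ _ yk h.
  apply: is_derive_eq; rewrite /S' /GRing.scale/=.
  rewrite !exprS; have := gt_eqF y0; have := gt_eqF (exprn_gt0 k y0).
  move: (y ^+ k) => u u0 y1; field.
  by rewrite u0 y1.
rewrite (@decreasing_substitution_0y R S S' _ dS).
- apply: eq_integral => y /set_mem/Pgt0 y0; congr EFin.
  have y1 : y != 0 by rewrite gt_eqF.
  have b1 : b != 0 by rewrite gt_eqF.
  rewrite /S /S' opprK powRM ?invr_ge0 ?exprn_ge0 ?ltW//.
  rewrite -[(y ^+ k.+1)^-1 `^ _]powRV ?exprn_ge0 ?ltW// pow_y//.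
  have -> : b `^ (1 + beta) = b * b `^ beta.
    by rewrite powRD ?b1 ?implybT// powRr1// ltW.
  rewrite powRN -addnn !(addnS, addSn) !exprS !exprD.
  have := gt_eqF (exprn_gt0 k y0); have := gt_eqF (powR_gt0 beta b0).
  move: (y ^+ k) (b `^ beta) => u v v0 u0.
  move: (cos _) => c.
  by field; rewrite v0 u0 y1 b1.
- move=> y y0; apply: cvgN; apply: cvgM; first exact: cvg_cst.
  apply: cvgV; first by rewrite gt_eqF// exprn_gt0.
  exact: exprn_continuous.
- by move=> y y0; rewrite oppr_lt0 divr_gt0 ?exprn_gt0// mulr_gt0.
- by move=> y y0; rewrite mulr_gt0// invr_gt0 exprn_gt0.
- rewrite -(mulr0 b); apply: cvgM; first exact: cvg_cst.
  apply/gtr0_cvgV0; first by near=> y; rewrite exprn_gt0//; near: y; exact: nbhs_pinfty_gt.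
  apply/cvgryPge => A; near=> y.
  have y1 : 1 <= y by near: y; apply: nbhs_pinfty_ge; rewrite num_real.
  have yA : A <= y by near: y; apply: nbhs_pinfty_ge; rewrite num_real.
  by rewrite (le_trans yA)// exprS ler_peMr ?exprn_ege1// (le_trans ler01).
- apply: gt0_cvgMry => //; apply/gtr0_cvgV0.
    by near=> y; rewrite invr_gt0 exprn_gt0//; near: y; exact: nbhs_right_gt.
  suff h : y ^+ k.+1 @[y --> (0 : R)^'+] --> (0 : R).
    by apply: cvg_trans h; apply: near_eq_cvg; near=> y; rewrite /= invrK.
  apply: cvg_at_right_filter; rewrite -[X in _ --> X](@expr0n R k.+1).
  exact: exprn_continuous.
- move=> r r0; apply: cvgM.
    by apply: cvgB; [exact: cvg_cst|exact: continuous_cos].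
  apply: cvgV; first by rewrite gt_eqF// powR_gt0.
  have rP : r \in `]0, +oo[ by rewrite in_itv/= r0.
  have /derivable1_diffP/differentiable_continuous := @derivable_powR _ 1 (1 + beta) r rP.
  exact.
- by move=> r r0; rewrite divr_ge0 ?powR_ge0// subr_ge0 cos_le1.
Unshelve. all: by end_near. Qed.

(* The index [beta = (2 k + 1) / (k + 1)] is 3/2 for [k = 1] and 5/3 for
   [k = 2]. *)
Definition stable_q theta y : R :=
  y ^+ k.*2 * (theta ^+ 2 / (theta ^+ 2 + 16 * gamma ^+ 2 * y ^+ (k.+1).*2)).

Definition stable_psi theta : R :=
  gamma / pi * \int[mu]_(y in `]0, +oo[) stable_q theta y.

Let stable_J := (\int[mu]_(r in P) ((1 - cos r) / r `^ (1 + beta))%:E)%E.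

Let den_gt0 theta y : 0 < y -> 0 < theta ^+ 2 + 16 * gamma ^+ 2 * y ^+ (k.+1).*2.
Proof.
move=> y0; rewrite ltr_wpDl ?sqr_ge0//.
exact: mulr_gt0 (mulr_gt0 _ (exprn_gt0 _ _)) (exprn_gt0 _ _).
Qed.

(** The computation of the Levy exponent run backwards: the quotient is reopened as an exponential
    mean of [1 - cos]. After Tonelli, the integral over [y] at fixed [t] is a multiple of [stable_J]
    with a factor t^beta, which leaves a Gamma integral. *)
Lemma integral_stable_q theta : 0 < theta ->
  (\int[mu]_(y in P) (stable_q theta y)%:E =
   (k.+1%:R^-1 * (theta / (4 * gamma)) `^ beta)%:E *
   \int[mu]_(t in P) (t `^ beta * expR (- t))%:E * stable_J)%E.
Proof.
move=> th0.
pose c y := theta / (4 * gamma * y ^+ k.+1).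
pose f y t := y ^+ k.*2 * (expR (- t) * (1 - cos (c y * t))).
have f0 y t : 0 < y -> 0 <= f y t.
  by move=> y0; rewrite !mulr_ge0 ?exprn_ge0 ?expR_ge0 ?subr_ge0 ?cos_le1 ?(ltW y0).
transitivity (\int[mu]_(y in P) \int[mu]_(t in P) (f y t)%:E)%E.
  apply: eq_integral => y /set_mem/Pgt0 y0; rewrite /f.
  under eq_integral do rewrite EFinM.
  rewrite ge0_integralZl//; last 2 first.
  - apply/measurable_EFinP; apply: measurable_funTS.
    exact: measurable_expR_onem_cos.
  - by rewrite lee_fin exprn_ge0// ltW.
  rewrite [X in (_ * X)%E](integral_expR_onem_cos1 (c y)) -EFinM; congr EFin.
  have E : y ^+ (k.+1).*2 = (y ^+ k.+1) ^+ 2 by rewrite -muln2 exprM.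
  rewrite /stable_q /c E; congr (_ * _).
  have := exprn_gt0 k.+1 y0; move: (y ^+ k.+1) => u u0.
  field.
  rewrite (gt_eqF u0) (gt_eqF gamma0) /= gt_eqF// ltr_wpDr ?sqr_ge0// exprn_gt0//.
  by rewrite mulr_gt0// mulr_gt0.
rewrite ge0_tonelli_set//; last 2 first.
- apply/measurable_EFinP; apply: measurable_funM.
    by apply: measurable_funX; exact: measurable_funTS.
  apply: measurable_funTS; apply: measurable_funM.
    by apply: measurableT_comp => //; exact: measurableT_comp.
  apply: measurable_funB => //; apply: measurableT_comp.
    by apply: continuous_measurable_fun; exact: continuous_cos.
  apply: measurable_funM; last exact: measurable_snd.
  apply: measurable_funM => //; apply: measurableT_comp; first exact: measurable_inv.
  by apply: measurable_funM => //; apply: measurable_funX; exact: measurable_fst.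
- by move=> y t /Pgt0 y0 _; rewrite lee_fin f0.
transitivity (\int[mu]_(t in P) ((k.+1%:R^-1 * (theta / (4 * gamma)) `^ beta)%:E *
  (t `^ beta * expR (- t))%:E * stable_J))%E.
  apply: eq_integral => t /set_mem/Pgt0 t0; rewrite /f.
  pose b := theta * t / (4 * gamma).
  have b0 : 0 < b by rewrite divr_gt0 ?mulr_gt0.
  pose X y := y ^+ k.*2 * (1 - cos (b / y ^+ k.+1)).
  have X0 y : 0 < y -> 0 <= X y.
    by move=> y0; rewrite mulr_ge0 ?exprn_ge0 ?(ltW y0)// subr_ge0 cos_le1.
  have mX : measurable_fun P (EFin \o X).
    apply/measurable_EFinP; apply: measurable_funTS; apply: measurable_funM.
      exact: measurable_funX.
    apply: measurable_funB => //; apply: measurableT_comp.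
      by apply: continuous_measurable_fun; exact: continuous_cos.
    apply: measurable_funM => //; apply: measurableT_comp; first exact: measurable_inv.
    exact: measurable_funX.
  have JE : stable_J = ((k.+1%:R * b `^ (- beta))%:E * \int[mu]_(y in P) (X y)%:E)%E.
    rewrite /stable_J (onem_cos_powR_subst b0) -ge0_integralZl//.
    - by move=> y /Pgt0 y0; rewrite lee_fin X0.
    - by rewrite lee_fin mulr_ge0// powR_ge0.
  transitivity ((expR (- t))%:E * \int[mu]_(y in P) (X y)%:E)%E.
    rewrite -ge0_integralZl//; last by move=> y /Pgt0 y0; rewrite lee_fin X0.
    apply: eq_integral => y /set_mem/Pgt0 y0; rewrite -EFinM; congr EFin.
    rewrite /X mulrCA; congr (_ * (_ * (1 - cos _))).
    rewrite /c /b.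
    have := exprn_gt0 k.+1 y0; move: (y ^+ k.+1) => u u0.
    by field; rewrite (gt_eqF gamma0) (gt_eqF u0).
  rewrite JE muleA -!EFinM; congr (_%:E * _)%E.
  have -> : b = theta / (4 * gamma) * t by rewrite /b mulrAC.
  have tg : 0 <= theta / (4 * gamma) by rewrite divr_ge0 ?mulr_ge0 ?ltW.
  have t0' := ltW t0.
  rewrite powRN (powRM _ tg t0').
  have h1 : (theta / (4 * gamma)) `^ beta != 0.
    by rewrite gt_eqF// powR_gt0// divr_gt0// mulr_gt0.
  have h2 : t `^ beta != 0 by rewrite gt_eqF// powR_gt0.
  move: (powR (_ / _) _) h1 (powR t _) h2 => u u0 v v0.
  by field; rewrite v0 u0 nat1r pnatr_eq0.
have J0 : (0 <= stable_J)%E.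
  apply: integral_ge0 => r /Pgt0 r0.
  by rewrite lee_fin divr_ge0 ?powR_ge0// subr_ge0 cos_le1.
have mt : measurable_fun P (fun t => (t `^ beta * expR (- t))%:E).
  apply/measurable_EFinP; apply: measurable_funM.
    by apply: measurable_funTS; exact: measurable_powR.
  by apply: measurable_funTS; apply: measurableT_comp.
rewrite ge0_integralZr//.
- rewrite ge0_integralZl//.
  + by move=> t _; rewrite lee_fin mulr_ge0 ?powR_ge0 ?expR_ge0.
  + by rewrite lee_fin mulr_ge0 ?invr_ge0 ?powR_ge0.
- exact: emeasurable_funM.
- move=> t _; rewrite mule_ge0// lee_fin; first by rewrite mulr_ge0 ?invr_ge0 ?powR_ge0.
  by rewrite mulr_ge0 ?powR_ge0 ?expR_ge0.
Qed.

Lemma stable_q_ge0 theta y : 0 < y -> 0 <= stable_q theta y.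
Proof.
move=> y0; rewrite mulr_ge0 ?exprn_ge0 ?(ltW y0)//.
by rewrite divr_ge0 ?sqr_ge0// ltW// den_gt0.
Qed.

(** The power of [y] in the denominator exceeds that of the prefactor by 2; dropping [theta ^+ 2]
    there bounds [y ^+ 2 * stable_q theta y] by the same constant as for [levy_q]. *)
Lemma stable_q_le theta y : 0 < y ->
  stable_q theta y <= (1 + 2 * (theta ^+ 2 / (16 * gamma ^+ 2))) * (1 + y ^+ 2)^-1.
Proof.
move=> y0; have d0 := den_gt0 theta y0.
have g2 : 0 < 16 * gamma ^+ 2 by rewrite mulr_gt0// exprn_gt0.
have t2 := sqr_ge0 theta.
have yk n : 0 < y ^+ n by rewrite exprn_gt0.
apply: le_oneDsqrV; first by rewrite divr_ge0// ltW.
  move=> y1; have y1' : y <= 1 by rewrite -(@expr_le1 _ 2)// ltW.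
  rewrite (@le_trans _ _ (y ^+ k.*2))//; last by rewrite exprn_ile1// ltW.
  rewrite /stable_q ler_piMr ?(ltW (yk _))// ler_pdivrMr// mul1r lerDl.
  exact: ltW (mulr_gt0 g2 (yk _)).
have E : y ^+ (k.+1).*2 = y ^+ k.*2 * y ^+ 2 by rewrite doubleS -addn2 exprD.
rewrite /stable_q mulrAC mulrA ler_pdivrMr// E.
have h := yk k.*2; have h2 := yk 2%N.
rewrite -subr_ge0 [leRHS](_ : _ = theta ^+ 2 / (16 * gamma ^+ 2) * theta ^+ 2).
  by rewrite mulr_ge0// divr_ge0// ltW.
by field; rewrite (gt_eqF gamma0).
Qed.

Lemma continuous_stable_q theta y : 0 < y -> {for y, continuous (stable_q theta)}.
Proof.
move=> y0; apply: cvgM; first exact: exprn_continuous.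
apply: cvgM; first exact: cvg_cst.
apply: cvgV; first by rewrite gt_eqF// den_gt0.
apply: cvgD; first exact: cvg_cst.
by apply: cvgM; [exact: cvg_cst|exact: exprn_continuous].
Qed.

Lemma measurable_stable_q theta : measurable_fun P (stable_q theta).
Proof.
apply: open_continuous_measurable_fun => // y /set_mem/Pgt0 y0.
exact: continuous_stable_q.
Qed.

Lemma integrable_oneDsqrV_cst (C : R) (f : R -> R) : measurable_fun P f ->
  (forall y, 0 < y -> 0 <= f y) -> (forall y, 0 < y -> f y <= C * (1 + y ^+ 2)^-1) ->
  mu.-integrable P (EFin \o f).
Proof.
move=> mf f0 fC.
apply: (@le_integrable _ _ _ mu P mP _ (fun y => C%:E * ((1 + y ^+ 2)^-1)%:E)%E).
- exact/measurable_EFinP.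
- move=> y /Pgt0 y0 /=; rewrite lee_fin ger0_norm ?f0//.
  by rewrite (le_trans (fC _ y0))// ler_norm.
- by apply: integrableZl => //; apply: integrableS (@integrable_oneDsqrV R).
Qed.

Lemma integrable_stable_q theta : mu.-integrable P (EFin \o stable_q theta).
Proof.
apply: integrable_oneDsqrV_cst; first exact: measurable_stable_q.
- by move=> y y0; exact: stable_q_ge0.
- by move=> y y0; exact: stable_q_le.
Qed.

(** If one factor is infinite, finiteness of the product forces the other to be 0, and both sides
    are 0. *)
Let fineM_ge0 (x y : \bar R) : (0 <= x -> 0 <= y -> x * y < +oo ->
  fine (x * y) = (fine x * fine y)%R)%E.
Proof.
case: x => [x| |]//; case: y => [y| |]//= x0 y0.
- move: x0; rewrite lee_fin le_eqVlt => /orP[/eqP<-|x0]; first by rewrite mul0e mul0r.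
  by rewrite gt0_muley ?lte_fin.
- move: y0; rewrite lee_fin le_eqVlt => /orP[/eqP<-|y0]; first by rewrite mule0 mulr0.
  by rewrite gt0_mulye ?lte_fin.
Qed.

(** The majorant of [stable_q] makes the product of the two integrals finite; the finiteness of each
    factor is not established separately, whence [fineM_ge0]. *)
Lemma stable_psiE theta : stable_psi theta =
  gamma / pi * (k.+1%:R^-1 * (`|theta| / (4 * gamma)) `^ beta) *
  (\int[mu]_(t in P) (t `^ beta * expR (- t))) *
  (\int[mu]_(r in P) ((1 - cos r) / r `^ (1 + beta))).
Proof.
have [->|th] := eqVneq theta 0.
  rewrite normr0 mul0r powR0 ?gt_eqF// !(mulr0, mul0r) /stable_psi.
  rewrite (@eq_Rintegral _ _ _ _ _ (cst 0)) ?Rintegral_cst ?mul0r ?mulr0//.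
  by move=> y _; rewrite /stable_q expr0n mul0r mulr0.
have th0 : 0 < `|theta| by rewrite normr_gt0.
rewrite /stable_psi -!(mulrA (gamma / pi)); congr (_ * _).
rewrite [LHS](_ : _ = \int[mu]_(y in P) stable_q `|theta| y); last first.
  by apply: eq_Rintegral => y _; rewrite /stable_q real_normK ?num_real.
have h := integral_stable_q th0.
have hoo : (\int[mu]_(y in P) (stable_q `|theta| y)%:E < +oo)%E.
  have /integrableP[_] := integrable_stable_q `|theta|.
  apply: le_lt_trans; rewrite le_eqVlt; apply/orP; left; apply/eqP.
  apply: eq_integral => y /set_mem/Pgt0 y0 /=.
  by rewrite (ger0_norm (stable_q_ge0 _ y0)).
rewrite [LHS]/Rintegral h.
rewrite h in hoo.
have J0 : (0 <= stable_J)%E.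
  apply: integral_ge0 => r /Pgt0 r0.
  by rewrite lee_fin divr_ge0 ?powR_ge0// subr_ge0 cos_le1.
have G0 : (0 <= \int[mu]_(t in P) (t `^ beta * expR (- t))%:E)%E.
  by apply: integral_ge0 => t _; rewrite lee_fin mulr_ge0 ?powR_ge0 ?expR_ge0.
have c0 : 0 <= k.+1%:R^-1 * (`|theta| / (4 * gamma)) `^ beta.
  by rewrite mulr_ge0 ?invr_ge0 ?powR_ge0.
rewrite fineM_ge0//; last by rewrite mule_ge0.
congr (_ * _).
move: G0; rewrite /Rintegral; case: (\int[mu]_(t in P) _)%E => [x _|_|//]; first by [].
have c1 : 0 < k.+1%:R^-1 * (`|theta| / (4 * gamma)) `^ beta.
  by rewrite mulr_gt0 ?invr_gt0// powR_gt0// divr_gt0// mulr_gt0.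
by rewrite gt0_muley ?lte_fin//= mulr0.
Qed.

End StableExponent.

(** * Matching the constants *)

Section StableConstants.
Context {R : realType}.
Notation mu := (@lebesgue_measure R).
Variable gamma : R.
Hypothesis gamma0 : 0 < gamma.

Let pi0 : 0 < pi :> R. Proof. exact: pi_gt0. Qed.

Let powRiV (a p : R) : 0 <= a -> (a^-1) `^ p = (a `^ p)^-1.
Proof. by move=> a0; rewrite -powR_inv1// -powRrM mulN1r powRN. Qed.

Let gamma_powR (p q : R) : p = 1 - q -> gamma `^ p = gamma / gamma `^ q.
Proof.
move=> ->; rewrite powRD; last by rewrite (gt_eqF gamma0) implybT.
by rewrite powRr1 ?(ltW gamma0)// powRN.
Qed.

Let kappa_0E : kappa_0 = (32 * pi)^-1 :> R.
Proof.
rewrite /kappa_0 (_ : 1 / (2 ^+ 10 * pi ^+ 2) = ((32 * pi)^-1) ^+ 2 :> R); last first.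
  by move: pi pi0 => p p0; field; rewrite gt_eqF.
rewrite -powR_mulrn ?invr_ge0 ?mulr_ge0 ?(ltW pi0)// -powRrM.
by rewrite mul1r divff// powRr1// invr_ge0 mulr_ge0// ltW.
Qed.

Let kappa_ooE : kappa_oo = (2 `^ (13 / 3) * 3 * pi)^-1 :> R.
Proof.
have h : 2 ^+ 13 = (2 `^ (13 / 3)) ^+ 3 :> R.
  by rewrite -!powR_mulrn ?powR_ge0// -powRrM divfK.
have p2 : 0 < 2 `^ (13 / 3) :> R by rewrite powR_gt0.
rewrite /kappa_oo (_ : 1 / (2 ^+ 13 * 27 * pi ^+ 3) =
    ((2 `^ (13 / 3) * 3 * pi)^-1) ^+ 3 :> R); last first.
  rewrite h; move: pi pi0 (powR _ _) p2 => p p0 u u0; field.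
  by rewrite !gt_eqF.
have q0 : 0 <= (2 `^ (13 / 3) * 3 * pi)^-1 :> R.
  by rewrite invr_ge0 !mulr_ge0// ltW.
by rewrite -powR_mulrn// -powRrM mul1r divff// powRr1.
Qed.

(** Both sides contain the same two integrals, abstracted as [G] and [J]. The remaining identity is
    [2 * kappa_0] = 1/(16 pi) = (1/pi)(1/2) 4^(-3/2), with one power of [gamma] from the prefactor
    of [stable_psi]. *)
Lemma stable_psi_32 theta :
  Gamma (1 + 3 / 2) * gamma `^ (- (1 / 2)) * D_0 * `|theta| `^ (3 / 2) =
  stable_psi gamma 1 theta.
Proof.
rewrite (@stable_psiE _ _ (3 / 2))//; last first.
  by rewrite (_ : 1.*2.+1 = 3%N)//; field.
rewrite /Gamma /D_0.
have -> : 1 + 3 / 2 - 1 = 3 / 2 :> R by field.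
have -> : 1 + 3 / 2 = 5 / 2 :> R by field.
move: (Rintegral _ _ _) (Rintegral _ _ _) => G J.
rewrite kappa_0E powRM//; last by rewrite invr_ge0 mulr_ge0// ltW.
rewrite powRiV ?mulr_ge0 ?ltW// powRM ?ltW//.
have -> : 4 `^ (3 / 2) = 8 :> R.
  rewrite (_ : 4 = 2 ^+ 2); last by ring.
  rewrite -powR_mulrn// -powRrM (_ : 2%:R * (3 / 2) = 3%:R); last by field.
  by rewrite powR_mulrn//; ring.
rewrite (@gamma_powR (- (1 / 2)) (3 / 2)); last by field.
have := powR_gt0 (3 / 2) gamma0.
move: (gamma `^ _) (`|theta| `^ _) pi pi0 => u v p p0 u0.
by field; rewrite !gt_eqF.
Qed.

(** As for 3/2; now [2 * kappa_oo] = (1/pi)(1/3) 2^(-10/3), and 2^(10/3) = 4^(5/3). *)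
Lemma stable_psi_53 theta :
  Gamma (1 + 5 / 3) * gamma `^ (- (2 / 3)) * D_oo * `|theta| `^ (5 / 3) =
  stable_psi gamma 2 theta.
Proof.
rewrite (@stable_psiE _ _ (5 / 3))//; last first.
  by rewrite (_ : 2.*2.+1 = 5%N)//; field.
rewrite /Gamma /D_oo.
have -> : 1 + 5 / 3 - 1 = 5 / 3 :> R by field.
have -> : 1 + 5 / 3 = 8 / 3 :> R by field.
move: (Rintegral _ _ _) (Rintegral _ _ _) => G J.
rewrite kappa_ooE powRM//; last by rewrite invr_ge0 mulr_ge0// ltW.
rewrite powRiV ?mulr_ge0 ?ltW// powRM ?ltW//.
have -> : 2 `^ (13 / 3) = 2 * 4 `^ (5 / 3) :> R.
  have -> : 4 `^ (5 / 3) = 2 `^ (10 / 3) :> R.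
    have -> : 4 = 2 `^ 2 :> R by rewrite powR_mulrn//; ring.
    by rewrite -powRrM; congr (_ `^ _); field.
  rewrite (_ : 13 / 3 = 1 + 10 / 3); last by field.
  by rewrite powRD ?pnatr_eq0 ?implybT// powRr1.
rewrite (@gamma_powR (- (2 / 3)) (5 / 3)); last by field.
have := powR_gt0 (5 / 3) gamma0; have := @powR_gt0 R 4 (5 / 3) (ltr0n _ 4).
move: (gamma `^ _) (`|theta| `^ _) pi pi0 (4 `^ _) => u v p p0 w w0 u0.
by field; rewrite !gt_eqF.
Qed.

End StableConstants.

(** * Positivity, dominated convergence and scaling on the half line *)

Section HalfLineIntegrals.
Context {R : realType}.
Notation mu := (@lebesgue_measure R).
Implicit Types (x y r t : R).

Let P : set R := `]0, +oo[%classic.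
Let Pgt0 x : P x -> 0 < x. Proof. by rewrite /P/= in_itv/= andbT. Qed.
Let mP : measurable P. Proof. exact: measurable_itv. Qed.

Lemma Rintegral_0y_gt0 (f : R -> R) : mu.-integrable P (EFin \o f) ->
  (forall y, 0 < y -> 0 < f y) -> 0 < \int[mu]_(y in `]0, +oo[) f y.
Proof.
move=> fi f0; rewrite lt_neqAle; apply/andP; split; last first.
  by apply: Rintegral_ge0 => y /Pgt0 y0; exact/ltW/f0.
apply/eqP => I0.
have /integrableP[mf _] := fi.
have : (\int[mu]_(y in P) `|(EFin \o f) y| = 0)%E.
  transitivity (\int[mu]_(y in P) (f y)%:E)%E.
    by apply: eq_integral => y /set_mem/Pgt0 y0 /=; rewrite gtr0_norm// f0.
  rewrite -[LHS]fineK; last exact: integrable_fin_num.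
  by congr EFin; exact: esym I0.
move/(ae_eq_integral_abs mu mP mf) => -[Z [mZ Z0 hZ]].
have PZ : P `<=` Z.
  move=> y Py; apply: hZ => /(_ Py) /eqP /=.
  by rewrite eqe gt_eqF// f0// Pgt0.
have : (mu P <= mu Z)%E by apply: le_measure => //; rewrite inE.
by rewrite [mu Z]Z0 lebesgue_measure_itv/= ltry.
Qed.

Lemma Rintegral_0y_dominated_cvg (f_ : nat -> R -> R) (f : R -> R) (C : R) :
  (forall n, measurable_fun P (f_ n)) ->
  (forall y, 0 < y -> f_ n y @[n --> \oo] --> f y) ->
  (forall n y, 0 < y -> `|f_ n y| <= C * (1 + y ^+ 2)^-1) ->
  \int[mu]_(y in `]0, +oo[) f_ n y @[n --> \oo] --> \int[mu]_(y in `]0, +oo[) f y.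
Proof.
move=> mf cf fC.
pose g y := (C%:E * ((1 + y ^+ 2)^-1)%:E)%E.
have ig : mu.-integrable P g.
  by apply: integrableZl => //; apply: integrableS (@integrable_oneDsqrV R).
have mf' n : measurable_fun P (EFin \o f_ n) by exact/measurable_EFinP.
have cf' y : P y -> (EFin \o f_ n) y @[n --> \oo] --> (EFin \o f) y.
  by move=> /Pgt0 y0; apply: cvg_EFin; [exact: nearW|exact: cf].
have mlim : measurable_fun P (EFin \o f) by exact: emeasurable_fun_cvg mf' cf'.
have [] := @dominated_convergence _ _ _ mu P mP (fun n => EFin \o f_ n) (EFin \o f) g mf' mlim.
- exact: aeW.
- exact: ig.
- by apply: aeW => y n /Pgt0 y0 /=; rewrite lee_fin fC.
move=> fi _ cvgI; apply: fine_cvg; rewrite fineK//.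
exact: integrable_fin_num.
Qed.

Lemma inversion_substitution_0y (G : R -> R) (b : R) : 0 < b ->
  (forall x, 0 < x -> {for x, continuous G}) -> (forall x, 0 < x -> 0 <= G x) ->
  (\int[mu]_(x in P) (G x)%:E =
   \int[mu]_(y in P) (G (b / y) * (b / y ^+ 2))%:E)%E.
Proof.
move=> b0 cG G0.
have dS y : 0 < y -> is_derive y (1 : R) (fun y => b / y) (- (b / y ^+ 2)).
  move=> y0; have y1 : id y != 0 :> R by rewrite gt_eqF.
  have h := @is_deriveV R id y _ _ y1 (is_derive_id _ _).
  apply: is_derive_eq; rewrite /GRing.scale/=.
  by field.
rewrite (@decreasing_substitution_0y R _ _ G dS)//.
- by apply: eq_integral => y _; rewrite opprK.
- move=> y y0; apply: cvgN; apply: cvgM; first exact: cvg_cst.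
  by apply: cvgV; [rewrite gt_eqF// exprn_gt0|exact: exprn_continuous].
- by move=> y y0; rewrite oppr_lt0 divr_gt0// exprn_gt0.
- by move=> y y0; rewrite divr_gt0.
- rewrite -(mulr0 b); apply: cvgM; first exact: cvg_cst.
  by apply/gtr0_cvgV0 => //; exact: nbhs_pinfty_gt.
- apply: gt0_cvgMry => //; apply/gtr0_cvgV0.
    by near=> y; rewrite invr_gt0; near: y; exact: nbhs_right_gt.
  suff h : y @[y --> (0 : R)^'+] --> (0 : R).
    by apply: cvg_trans h; apply: near_eq_cvg; near=> y; rewrite /= invrK.
  exact: cvg_at_right_filter.
Unshelve. all: by end_near. Qed.

(** The increasing substitution [x = c * z] is composed of two decreasing ones, [x = c / y] and
    [z = 1 / y]. *)
Lemma scaling_0y (G : R -> R) (c : R) : 0 < c ->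
  (forall x, 0 < x -> {for x, continuous G}) -> (forall x, 0 < x -> 0 <= G x) ->
  (\int[mu]_(x in P) (G x)%:E = \int[mu]_(z in P) (c * G (c * z))%:E)%E.
Proof.
move=> c0 cG G0.
rewrite (inversion_substitution_0y c0)// (@inversion_substitution_0y (fun z => c * G (c * z)) 1)//.
- by apply: eq_integral => y _; rewrite !mul1r mulrA (mulrC c (G _)).
- move=> x x0; apply: cvgM; first exact: cvg_cst.
  have h : {for x, continuous (G \o ( *%R c))}.
    apply: continuous_comp; first by apply: cvgM; [exact: cvg_cst|].
    by apply: cG; rewrite mulr_gt0.
  exact: h.
- by move=> x x0; rewrite mulr_ge0 ?(ltW c0)// G0// mulr_gt0.
Qed.

End HalfLineIntegrals.

(** * Continuity, lower bound and limits of the Levy symbol *)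

Section LevyPsi.
Context {R : realType}.
Notation mu := (@lebesgue_measure R).
Implicit Types (s theta x y r t B : R).
Variable gamma : R.
Hypothesis gamma0 : 0 < gamma.

Let P : set R := `]0, +oo[%classic.
Let Pgt0 x : P x -> 0 < x. Proof. by rewrite /P/= in_itv/= andbT. Qed.
Let mP : measurable P. Proof. exact: measurable_itv. Qed.

Let one1 : (1 : R) = 1 \/ (1 : R) = - 1. Proof. by left. Qed.
Let None1 : (- 1 : R) = 1 \/ (- 1 : R) = - 1. Proof. by right. Qed.

Let Q B theta y := levy_q gamma B 1 theta y + levy_q gamma B (- 1) theta y.

(** Twice the constant of [levy_q_le], once for each sign. *)
Let C theta := 2 * (1 + 2 * (theta ^+ 2 / (16 * gamma ^+ 2))).

Let Q_le B theta y : 0 < B -> 0 < y -> `|Q B theta y| <= C theta * (1 + y ^+ 2)^-1.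
Proof.
move=> B0 y0; rewrite ger0_norm ?addr_ge0 ?levy_q_ge0//.
by rewrite /C mulrDl mul1r mulrDl lerD ?mul1r ?levy_q_le.
Qed.

Let mQ B theta : 0 < B -> measurable_fun P (Q B theta).
Proof. by move=> B0; apply: measurable_funD; exact: measurable_levy_q. Qed.

Let iQ B theta : 0 < B -> mu.-integrable P (EFin \o Q B theta).
Proof.
move=> B0; have h := @integrableD _ _ _ mu P mP _ _ (integrable_levy_q gamma0 B0 one1 theta)
  (integrable_levy_q gamma0 B0 None1 theta).
by apply: eq_integrable h.
Qed.

Let ratio_cts (d : R) : 0 < d -> continuous (fun theta => theta ^+ 2 / (theta ^+ 2 + d)).
Proof.
move=> d0 x; apply: cvgM; first exact: exprn_continuous.
apply: cvgV; first by rewrite gt_eqF// ltr_wpDl ?sqr_ge0.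
by apply: cvgD; [exact: exprn_continuous|exact: cvg_cst].
Qed.

Let d_gt0 B s y : 0 < B -> s = 1 \/ s = - 1 -> 0 < y ->
  0 < 4 * gamma ^+ 2 * levy_F B s y ^+ 2.
Proof.
move=> B0 s1 y0; have F0 := levy_F_gt0 B0 s1 y0.
exact: mulr_gt0 (mulr_gt0 _ (exprn_gt0 _ _)) (exprn_gt0 _ F0).
Qed.

Lemma continuous_levy_psi B : 0 < B -> continuous (levy_psi gamma B).
Proof.
move=> B0 a; apply: cvgM; first exact: cvg_cst.
pose M := `|a| + 1.
apply: (@continuity_under_integral R _ _ mu (Q B) P mP (a - 1) (a + 1) _ _
  (fun y => C M * (1 + y ^+ 2)^-1)).
- by move=> x _; exact: iQ.
- apply: aeW => y /Pgt0 y0 x _.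
  by apply: cvgD; (apply: cvgM; [exact: cvg_cst|exact: ratio_cts (d_gt0 _ _ _) _]).
- apply: (@integrableZl _ _ _ mu P mP (C M) (fun y => ((1 + y ^+ 2)^-1)%:E)).
  by apply: integrableS (@integrable_oneDsqrV R).
- move=> x /= xI; apply: aeW => y /Pgt0 y0.
  rewrite (le_trans (Q_le _ B0 y0))// ler_wpM2r ?invr_ge0 ?addr_ge0 ?sqr_ge0//.
  rewrite /C ler_pM2l// lerD2l ler_pM2l// ler_pM2r ?invr_gt0 ?mulr_gt0 ?exprn_gt0//.
  rewrite -(real_normK (num_real x)) ler_pXn2r ?nnegrE ?addr_ge0//.
  move: xI; rewrite in_itv/= /M => /andP[x1 x2].
  have := ler_norm a; have := ler_norm (- a); rewrite normrN => h1 h2.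
  by rewrite ler_norml; apply/andP; split; lra.
- by rewrite inE/= in_itv/=; apply/andP; split; lra.
Qed.

Lemma levy_psi_gt0 B : 0 < B -> 0 < levy_psi gamma B 1.
Proof.
move=> B0; rewrite mulr_gt0 ?divr_gt0 ?pi_gt0//.
apply: Rintegral_0y_gt0; first exact: iQ.
move=> y y0; rewrite ltr_wpDr ?levy_q_ge0// mulr_gt0//; last first.
  by rewrite divr_gt0 ?exprn_gt0// addr_gt0 ?exprn_gt0// d_gt0.
have q0 : 0 < 4 * Num.sqrt (y ^+ 2 + B ^+ 2 / 4).
  by rewrite mulr_gt0// sqrtr_gt0 addr_gt0 ?divr_gt0 ?exprn_gt0.
have h := divr_gt0 B0 q0.
by rewrite mulr_gt0 ?exprn_gt0// mul1r; lra.
Qed.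

(** The quotient [theta ^+ 2 / (theta ^+ 2 + d)] increases with the modulus of [theta]. With
    [levy_psi_gt0], the symbol stays away from 0 at high frequency, so that a transform is
    integrable there when its product with the symbol is. *)
Lemma levy_psi_ge B theta : 0 < B -> 1 <= `|theta| ->
  levy_psi gamma B 1 <= levy_psi gamma B theta.
Proof.
move=> B0 th1; rewrite ler_wpM2l ?divr_ge0 ?pi_ge0 ?(ltW gamma0)//.
apply: le_Rintegral => //; [exact: iQ|exact: iQ|].
have h s y : s = 1 \/ s = - 1 -> 0 < y ->
    levy_q gamma B s 1 y <= levy_q gamma B s theta y.
  move=> s1 y0; rewrite ler_wpM2l ?hB_integrand_ge0//.
  have := d_gt0 B0 s1 y0; move: (4 * _ * _) => d d0.
  have t1 : 1 <= theta ^+ 2 by rewrite -(real_normK (num_real theta)) exprn_ege1.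
  rewrite expr1n ler_pdivrMr ?ltr_wpDl// mulrAC ler_pdivlMr; last first.
    by rewrite ltr_wpDl ?sqr_ge0.
  rewrite !mul1r mulrDr mulr1 lerD2l; nra.
by move=> y /Pgt0 y0; rewrite lerD// h.
Qed.

(** At fixed [y > 0] the integrands are continuous in [B] up to [B = 0], where
    [levy_F 0 s y = 2 * y ^+ 2] and each sign contributes the weight [y ^+ 2 / 2]. *)
Lemma levy_psi_cvg0 (B : nat -> R) theta : (forall n, 0 < B n) ->
  B n @[n --> \oo] --> (0 : R) ->
  levy_psi gamma (B n) theta @[n --> \oo] --> stable_psi gamma 1 theta.
Proof.
move=> Bn0 B0; apply: cvgM; first exact: cvg_cst.
apply: (@Rintegral_0y_dominated_cvg R (fun n => Q (B n) theta) _ (C theta)).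
- by move=> n; exact: mQ.
- move=> y y0.
  have cq : {for (0 : R), continuous (fun B => Num.sqrt (y ^+ 2 + B ^+ 2 / 4))}.
    have h : {for (0 : R), continuous ((@Num.sqrt R) \o (fun B => y ^+ 2 + B ^+ 2 / 4))}.
      apply: continuous_comp; last exact: sqrt_continuous.
      apply: cvgD; first exact: cvg_cst.
      by apply: cvgM; [exact: exprn_continuous|exact: cvg_cst].
    exact: h.
  have q0 : Num.sqrt (y ^+ 2 + 0 ^+ 2 / 4) = y :> R.
    by rewrite expr0n mul0r addr0 sqrtr_sqr gtr0_norm.
  have h s : {for (0 : R), continuous (fun B => levy_q gamma B s theta y)}.
    apply: cvgM.
      apply: cvgM; last exact: cvg_cst.
      apply: cvgD; first exact: cvg_cst.
      apply: cvgM; first exact: cvg_cst.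
      apply: cvgM => //; apply: cvgV; first by rewrite q0 mulf_neq0// gt_eqF.
      by apply: cvgM; [exact: cvg_cst|exact: cq].
    apply: cvgM; first exact: cvg_cst.
    have cF : {for (0 : R), continuous (fun B => levy_F B s y)}.
      apply: cvgM; last exact: cvg_cst.
      apply: cvgD; first by apply: cvgM; [exact: cvg_cst|exact: cq].
      by apply: cvgM => //; exact: cvg_cst.
    have cD : {for (0 : R), continuous (fun B =>
        theta ^+ 2 + 4 * gamma ^+ 2 * levy_F B s y ^+ 2)}.
      apply: cvgD; first exact: cvg_cst.
      by apply: cvgM; [exact: cvg_cst|exact: (cvgM cF cF)].
    apply: (cvgV _ cD).
    have F0 : 0 < levy_F 0 s y.
      by rewrite /levy_F q0 mulr0 addr0 mulr_gt0// mulr_gt0.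
    rewrite gt_eqF// ltr_wpDl ?sqr_ge0//.
    exact: mulr_gt0 (mulr_gt0 _ (exprn_gt0 _ _)) (exprn_gt0 _ F0).
  have -> : stable_q gamma 1 theta y =
      levy_q gamma 0 1 theta y + levy_q gamma 0 (- 1) theta y.
    rewrite /stable_q /levy_q /hB_integrand /levy_F q0 !mul0r !mulr0 !addr0.
    rewrite (_ : 1.*2 = 2)// (_ : 2.*2 = 4)//.
    have d0 : theta ^+ 2 + 16 * gamma ^+ 2 * y ^+ 4 != 0.
      rewrite gt_eqF// ltr_wpDl ?sqr_ge0//.
      exact: mulr_gt0 (mulr_gt0 _ (exprn_gt0 _ _)) (exprn_gt0 _ _).
    have -> : 4 * gamma ^+ 2 * (2 * y * y) ^+ 2 = 16 * gamma ^+ 2 * y ^+ 4 by ring.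
    by field.
  by apply: cvgD; exact: (cvg_comp _ _ B0 (h _)).
- by move=> n y y0; exact: Q_le.
Qed.

(* With [B = c ^ 3] and [y = c z], only the integrand of sign -1 survives as
   [c] tends to infinity; it is the function [W] of [e = c ^- 2]. *)
Let V s theta c z := c ^+ 2 * levy_q gamma (c ^+ 3) s theta (c * z).

(** The square root of [levy_F] measured in units of [B = c ^+ 3]; it tends to 1/2 with [e]. *)
Let p (e z : R) := Num.sqrt (e ^+ 2 * z ^+ 2 + 1 / 4).

Let pE c z : 0 < c ->
  Num.sqrt ((c * z) ^+ 2 + (c ^+ 3) ^+ 2 / 4) = c ^+ 3 * p (c ^- 2) z.
Proof.
move=> c0; have c3 : 0 < c ^+ 3 by rewrite exprn_gt0.
have -> : (c * z) ^+ 2 + (c ^+ 3) ^+ 2 / 4 =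
    (c ^+ 3) ^+ 2 * ((c ^- 2) ^+ 2 * z ^+ 2 + 1 / 4).
  by field; rewrite gt_eqF.
by rewrite sqrtrM ?sqr_ge0// sqrtr_sqr gtr0_norm.
Qed.

Let p_ge e z : 1 / 2 <= p e z.
Proof.
have -> : 1 / 2 = Num.sqrt ((1 / 2) ^+ 2) :> R by rewrite sqrtr_sqr ger0_norm.
rewrite ler_wsqrtr// -subr_ge0 [leRHS](_ : _ = e ^+ 2 * z ^+ 2); last by field.
by rewrite mulr_ge0 ?sqr_ge0.
Qed.

Let p2 e z : p e z ^+ 2 = e ^+ 2 * z ^+ 2 + 1 / 4.
Proof. by rewrite sqr_sqrtr// addr_ge0// mulr_ge0 ?sqr_ge0. Qed.

Let W theta e z := z ^+ 4 / ((2 * p e z + 1) * p e z) *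
  (theta ^+ 2 / (theta ^+ 2 + 64 * gamma ^+ 2 * z ^+ 6 / (2 * p e z + 1) ^+ 2)).

Let W_den theta e z : 0 < z ->
  0 < theta ^+ 2 + 64 * gamma ^+ 2 * z ^+ 6 / (2 * p e z + 1) ^+ 2.
Proof.
move=> z0; rewrite ltr_wpDl ?sqr_ge0// divr_gt0 ?exprn_gt0//.
  exact: mulr_gt0 (mulr_gt0 _ (exprn_gt0 _ _)) (exprn_gt0 _ _).
by have := p_ge e z; lra.
Qed.

Let VW theta c z : 0 < c -> 0 < z -> V (- 1) theta c z = W theta (c ^- 2) z.
Proof.
move=> c0 z0; rewrite /V /levy_q /hB_integrand /levy_F !pE//.
have h1 := p_ge (c ^- 2) z; have h2 := p2 (c ^- 2) z.
have hd : 0 < theta ^+ 2 + 64 * gamma ^+ 2 * z ^+ 6 / (2 * p (c ^- 2) z + 1) ^+ 2.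
  exact: W_den.
rewrite /W; move: (p (c ^- 2) z) h1 h2 hd => u h1 h2 hd.
have cn : c != 0 by rewrite gt_eqF.
have u0 : u != 0 by rewrite gt_eqF//; lra.
have u1 : 2 * u + 1 != 0 by rewrite gt_eqF//; lra.
(* For the sign -1 the slope [2 * u - 1] degenerates as [c] grows. Multiplication by the conjugate
   [2 * u + 1] extracts the exact factor [c ^- 4], which absorbs all the powers of [c]. *)
have E : 2 * u - 1 = 4 * z ^+ 2 / (c ^+ 4 * (2 * u + 1)).
  apply: (mulIf u1); rewrite -subr_sqr_1 exprMn h2.
  by field; rewrite cn u1.
have -> : (1 / 2 + -1 * (c ^+ 3 / (4 * (c ^+ 3 * u)))) * (c * z) ^+ 2 =
    (2 * u - 1) / (4 * u) * (c * z) ^+ 2.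
  by field; rewrite u0 cn.
have -> : (2 * (c ^+ 3 * u) + -1 * c ^+ 3) * (c * z) = c ^+ 4 * z * (2 * u - 1).
  by ring.
rewrite E.
have -> : 4 * gamma ^+ 2 * (c ^+ 4 * z * (4 * z ^+ 2 / (c ^+ 4 * (2 * u + 1)))) ^+ 2 =
    64 * gamma ^+ 2 * z ^+ 6 / (2 * u + 1) ^+ 2.
  by field; rewrite u1 cn.
rewrite mulrA; congr (_ * _).
by field; rewrite u1 u0 cn.
Qed.

Let stable_den theta z : 0 < z -> 0 < theta ^+ 2 + 16 * gamma ^+ 2 * z ^+ 6.
Proof.
move=> z0; rewrite ltr_wpDl ?sqr_ge0//.
exact: mulr_gt0 (mulr_gt0 _ (exprn_gt0 _ _)) (exprn_gt0 _ _).
Qed.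

Let stable2E theta z :
  stable_q gamma 2 theta z = z ^+ 4 * (theta ^+ 2 / (theta ^+ 2 + 16 * gamma ^+ 2 * z ^+ 6)).
Proof. by []. Qed.

(** The limit is itself the majorant: [p e z >= 1 / 2] makes both [(2 * u + 1) * u] and
    [4 * u / (2 * u + 1)] at least 1. *)
Let W_le theta e z : 0 < z -> W theta e z <= stable_q gamma 2 theta z.
Proof.
move=> z0; rewrite stable2E /W; have h1 := p_ge e z.
have hd := W_den theta e z0; have sd := stable_den theta z0.
move: (p e z) h1 hd => u h1 hd.
have u0 : 0 < u by lra.
have u1 : 0 < 2 * u + 1 by lra.
have -> : z ^+ 4 / ((2 * u + 1) * u) *
    (theta ^+ 2 / (theta ^+ 2 + 64 * gamma ^+ 2 * z ^+ 6 / (2 * u + 1) ^+ 2)) =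
    z ^+ 4 * (theta ^+ 2 / ((2 * u + 1) * u *
      (theta ^+ 2 + 64 * gamma ^+ 2 * z ^+ 6 / (2 * u + 1) ^+ 2))).
  by rewrite [in RHS]invfM mulrACA !mulrA.
rewrite ler_wpM2l ?exprn_ge0 ?(ltW z0)// ler_wpM2l ?sqr_ge0//.
rewrite lef_pV2 ?posrE ?mulr_gt0//.
have -> : (2 * u + 1) * u * (theta ^+ 2 + 64 * gamma ^+ 2 * z ^+ 6 / (2 * u + 1) ^+ 2) =
    (2 * u + 1) * u * theta ^+ 2 + (4 * u / (2 * u + 1)) * (16 * gamma ^+ 2 * z ^+ 6).
  by field; rewrite gt_eqF.
apply: lerD; first by rewrite ler_peMl ?sqr_ge0//; nra.
rewrite ler_peMl ?ler_pdivlMr//; last by lra.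
by rewrite mulr_ge0 ?exprn_ge0 ?(ltW z0)// mulr_ge0 ?sqr_ge0.
Qed.

(** At [e = 0], [p] is 1/2: the weight has denominator 1, and [(2 * p + 1) ^+ 2 = 4] turns 64 into
    16. *)
Let W_cvg0 theta z : 0 < z -> W theta e z @[e --> (0 : R)] --> stable_q gamma 2 theta z.
Proof.
move=> z0.
have cp : p e z @[e --> (0 : R)] --> p 0 z.
  have h : {for (0 : R), continuous ((@Num.sqrt R) \o (fun e => e ^+ 2 * z ^+ 2 + 1 / 4))}.
    apply: continuous_comp; last exact: sqrt_continuous.
    apply: cvgD; last exact: cvg_cst.
    by apply: cvgM; [exact: exprn_continuous|exact: cvg_cst].
  exact: h.
have p0 : p 0 z = 1 / 2.
  rewrite /p expr0n mul0r add0r (_ : 1 / 4 = (1 / 2) ^+ 2); last by field.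
  by rewrite sqrtr_sqr ger0_norm.
rewrite p0 in cp.
have c1 : 2 * p e z + 1 @[e --> (0 : R)] --> (2 * (1 / 2) + 1 : R).
  by apply: cvgD; [apply: cvgM => //; exact: cvg_cst|exact: cvg_cst].
have c2 : (2 * p e z + 1) * p e z @[e --> (0 : R)] --> ((2 * (1 / 2) + 1) * (1 / 2) : R).
  exact: cvgM.
have c3 : theta ^+ 2 + 64 * gamma ^+ 2 * z ^+ 6 / (2 * p e z + 1) ^+ 2 @[e --> (0 : R)] -->
    (theta ^+ 2 + 64 * gamma ^+ 2 * z ^+ 6 / ((2 * (1 / 2) + 1) * (2 * (1 / 2) + 1)) : R).
  apply: cvgD; first exact: cvg_cst.
  apply: cvgM; first exact: cvg_cst.
  apply: cvgV; last exact: (cvgM c1 c1).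
  by rewrite (_ : 2 * (1 / 2) + 1 = 2 :> R) ?mulf_neq0//; field.
have sd := stable_den theta z0.
have -> : stable_q gamma 2 theta z = z ^+ 4 / ((2 * (1 / 2) + 1) * (1 / 2)) *
    (theta ^+ 2 / (theta ^+ 2 +
       64 * gamma ^+ 2 * z ^+ 6 / ((2 * (1 / 2) + 1) * (2 * (1 / 2) + 1)))).
  rewrite stable2E.
  have -> : (2 * (1 / 2) + 1) * (2 * (1 / 2) + 1) = 4 :> R by field.
  have -> : (2 * (1 / 2) + 1) * (1 / 2) = 1 :> R by field.
  by rewrite divr1; congr (_ * (_ / (_ + _))); field.
apply: cvgM.
  apply: cvgM; first exact: cvg_cst.
  apply: cvgV => //; rewrite (_ : _ * _ = 1 :> R) ?oner_neq0//; field.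
apply: cvgM; first exact: cvg_cst.
apply: cvgV => //; rewrite gt_eqF//.
have -> : 64 * gamma ^+ 2 * z ^+ 6 / ((2 * (1 / 2) + 1) * (2 * (1 / 2) + 1)) =
  16 * gamma ^+ 2 * z ^+ 6 by field.
by [].
Qed.

(** The weight is at most [y ^+ 2], and [(2 * q + B) ^+ 2 >= 4 * q ^+ 2 + B ^+ 2 = 4 * y ^+ 2 + 2 *
    B ^+ 2]. The term in [B] makes the sign + negligible after rescaling. *)
Let levy_q_plus_le B theta y : 0 < B -> 0 < y ->
  levy_q gamma B 1 theta y <= theta ^+ 2 / (4 * gamma ^+ 2 * (4 * y ^+ 2 + 2 * B ^+ 2)).
Proof.
move=> B0 y0; rewrite /levy_q /hB_integrand /levy_F.
have : Num.sqrt (y ^+ 2 + B ^+ 2 / 4) ^+ 2 = y ^+ 2 + B ^+ 2 / 4.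
  by rewrite sqr_sqrtr// addr_ge0 ?sqr_ge0// divr_ge0 ?sqr_ge0.
have : 0 < Num.sqrt (y ^+ 2 + B ^+ 2 / 4).
  by rewrite sqrtr_gt0 addr_gt0 ?divr_gt0 ?exprn_gt0.
move: (Num.sqrt _) => q q0 q2.
have t2 := sqr_ge0 theta.
have qB : B <= 2 * q.
  rewrite -(@ler_pXn2r _ 2)// ?nnegrE ?mulr_ge0 ?(ltW q0) ?(ltW B0)//.
  by rewrite exprMn q2; move: (sqr_ge0 y) => y2; lra.
have w1 : 1 / 2 + 1 * (B / (4 * q)) <= 1.
  have : B / (4 * q) <= 1 / 2 by rewrite ler_pdivrMr ?mulr_gt0//; lra.
  by lra.
have X0 : 0 < 4 * gamma ^+ 2 * (4 * y ^+ 2 + 2 * B ^+ 2).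
  by rewrite mulr_gt0 ?mulr_gt0 ?addr_gt0 ?exprn_gt0// mulr_gt0 ?exprn_gt0.
apply: (@le_trans _ _ (y ^+ 2 * (theta ^+ 2 /
    (y ^+ 2 * (4 * gamma ^+ 2 * (4 * y ^+ 2 + 2 * B ^+ 2)))))); last first.
  rewrite [leLHS](_ : _ = theta ^+ 2 / (4 * gamma ^+ 2 * (4 * y ^+ 2 + 2 * B ^+ 2)))//.
  by rewrite invfM mulrCA mulVKf// gt_eqF// exprn_gt0.
have h : y ^+ 2 * (4 * gamma ^+ 2 * (4 * y ^+ 2 + 2 * B ^+ 2)) <=
    theta ^+ 2 + 4 * gamma ^+ 2 * ((2 * q + 1 * B) * y) ^+ 2.
  rewrite [leLHS](_ : _ = 4 * gamma ^+ 2 * (y ^+ 2 * (4 * q ^+ 2 + B ^+ 2))); last first.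
    by rewrite q2; field.
  apply: ler_wpDl => //; apply: ler_wpM2l; first by rewrite mulr_ge0 ?sqr_ge0.
  rewrite exprMn mulrC; apply: ler_wpM2r; first exact: sqr_ge0.
  by move: q0 B0 => q0 B0'; nra.
apply: ler_pM.
- rewrite mulr_ge0 ?sqr_ge0// addr_ge0// mul1r divr_ge0 ?mulr_ge0 ?ltW//.
- rewrite divr_ge0// (le_trans _ h)// ltW// mulr_gt0 ?exprn_gt0//.
- by rewrite ler_piMl ?sqr_ge0.
- rewrite ler_wpM2l// lef_pV2 ?posrE//; first by rewrite (lt_le_trans _ h)// mulr_gt0 ?exprn_gt0.
  by rewrite mulr_gt0 ?exprn_gt0.
Qed.

Let Vplus_le theta c z : 1 <= c -> 0 < z ->
  V 1 theta c z <= theta ^+ 2 / (4 * gamma ^+ 2 * (4 * z ^+ 2 + 2 * c ^+ 4)).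
Proof.
move=> c1 z0; have c0 : 0 < c by rewrite (lt_le_trans ltr01).
have c3 : 0 < c ^+ 3 by rewrite exprn_gt0.
have := levy_q_plus_le theta c3 (mulr_gt0 c0 z0).
rewrite -(@ler_pM2l _ (c ^+ 2)) ?exprn_gt0// => /le_trans; apply.
rewrite le_eqVlt; apply/orP; left; apply/eqP.
have X0 : 4 * z ^+ 2 + 2 * c ^+ 4 != 0.
  by rewrite gt_eqF// addr_gt0 ?mulr_gt0 ?exprn_gt0.
have -> : 4 * (c * z) ^+ 2 + 2 * (c ^+ 3) ^+ 2 = c ^+ 2 * (4 * z ^+ 2 + 2 * c ^+ 4) by ring.
move: (4 * z ^+ 2 + 2 * c ^+ 4) X0 => X X0.
by field; rewrite (gt_eqF c0) (gt_eqF gamma0) X0.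
Qed.

Let V_ge0 s theta c z : s = 1 \/ s = - 1 -> 0 < c -> 0 <= V s theta c z.
Proof. by move=> s1 c0; rewrite mulr_ge0 ?sqr_ge0// levy_q_ge0// exprn_gt0. Qed.

Let V_le theta c z : 1 <= c -> 0 < z ->
  `|V 1 theta c z + V (- 1) theta c z| <= C theta * (1 + z ^+ 2)^-1.
Proof.
move=> c1 z0; have c0 : 0 < c by rewrite (lt_le_trans ltr01).
have g2 : 0 < gamma ^+ 2 by rewrite exprn_gt0.
rewrite ger0_norm ?addr_ge0 ?V_ge0//; try by [left|right].
rewrite /C mulrDl mul1r mulrDl lerD//.
  rewrite (le_trans (Vplus_le theta c1 z0))//.
  apply: (@le_trans _ _ ((theta ^+ 2 / (8 * gamma ^+ 2)) * (1 + z ^+ 2)^-1)).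
    have -> : theta ^+ 2 / (8 * gamma ^+ 2) / (1 + z ^+ 2) =
      theta ^+ 2 / (4 * gamma ^+ 2 * (4 * z ^+ 2 + 2 * c ^+ 4)) *
      ((4 * z ^+ 2 + 2 * c ^+ 4) / (2 + 2 * z ^+ 2)).
      have z1 : 1 + z ^+ 2 != 0 by rewrite gt_eqF// addr_gt0 ?exprn_gt0.
      have X0 : 4 * z ^+ 2 + 2 * c ^+ 4 != 0.
        by rewrite gt_eqF// addr_gt0 ?mulr_gt0 ?exprn_gt0.
      have -> : 2 + 2 * z ^+ 2 = 2 * (1 + z ^+ 2) by ring.
      move: (4 * z ^+ 2 + 2 * c ^+ 4) X0 (1 + z ^+ 2) z1 => X X0 Z Z0.
      by field; rewrite (gt_eqF gamma0) X0 Z0.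
    rewrite ler_peMr ?divr_ge0 ?sqr_ge0//.
      apply: mulr_ge0; first by rewrite mulr_ge0 ?sqr_ge0.
      by apply: addr_ge0; apply: mulr_ge0; rewrite ?exprn_ge0// ltW.
    rewrite ler_pdivlMr ?addr_gt0 ?mulr_gt0 ?exprn_gt0//.
    have := sqr_ge0 z; have := exprn_ege1 4 c1; lra.
  rewrite ler_wpM2r ?invr_ge0 ?addr_ge0 ?sqr_ge0//.
  rewrite (_ : theta ^+ 2 / (8 * gamma ^+ 2) = 2 * (theta ^+ 2 / (16 * gamma ^+ 2))).
    by rewrite lerDr.
  by field; rewrite (gt_eqF gamma0).
rewrite VW// (le_trans (W_le _ _ z0))//.
exact: stable_q_le.
Qed.

(** With [B = c ^+ 3] the factor B^(1/3) is [c] and only integer powers occur. Of the factor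
    [c ^+ 2] in [V], one [c] is this time scale and the other the Jacobian of [y = c * z]. *)
Lemma levy_psi_cvgy (c : nat -> R) theta : (forall n, 1 <= c n) ->
  c n @[n --> \oo] --> +oo ->
  c n * levy_psi gamma (c n ^+ 3) theta @[n --> \oo] --> stable_psi gamma 2 theta.
Proof.
move=> c1 cy; have c0 n : 0 < c n by rewrite (lt_le_trans ltr01).
have c3 n : 0 < c n ^+ 3 by rewrite exprn_gt0.
have mV s n : s = 1 \/ s = - 1 -> measurable_fun P (V s theta (c n)).
  move=> s1; apply: open_continuous_measurable_fun => // z /set_mem/Pgt0 z0.
  apply: cvgM; first exact: cvg_cst.
  have h : {for z, continuous (levy_q gamma (c n ^+ 3) s theta \o ( *%R (c n)))}.
    apply: continuous_comp; first by apply: cvgM; [exact: cvg_cst|].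
    by apply: continuous_levy_q => //; rewrite mulr_gt0.
  exact: h.
have mVV n : measurable_fun P (fun z => V 1 theta (c n) z + V (- 1) theta (c n) z).
  by apply: measurable_funD; exact: mV.
have E n : c n * levy_psi gamma (c n ^+ 3) theta =
    gamma / pi * \int[mu]_(z in P) (V 1 theta (c n) z + V (- 1) theta (c n) z).
  rewrite /levy_psi mulrCA; congr (_ * _).
  have -> : \int[mu]_(y in P) (Q (c n ^+ 3) theta y) =
      \int[mu]_(z in P) (c n * Q (c n ^+ 3) theta (c n * z)).
    rewrite /Rintegral (@scaling_0y R _ (c n))//.
    - by move=> y y0; apply: cvgD; exact: continuous_levy_q.
    - by move=> y y0; rewrite addr_ge0// levy_q_ge0.
  rewrite -RintegralZl//.
    by apply: eq_Rintegral => z _; rewrite /V /Q mulrA -expr2 mulrDr.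
  apply: (@eq_integrable _ _ _ mu P mP (fun z => ((c n)^-1)%:E *
      (V 1 theta (c n) z + V (- 1) theta (c n) z)%:E)%E).
    move=> z _; rewrite /V /Q /= -EFinM; congr EFin.
    by field; rewrite gt_eqF.
  apply: integrableZl => //.
  apply: (@integrable_oneDsqrV_cst R (C theta)) => //.
  - by move=> z z0; rewrite addr_ge0// V_ge0.
  - by move=> z z0; rewrite (le_trans (ler_norm _))// V_le.
rewrite (_ : (fun _ => _) = (fun n => gamma / pi *
    \int[mu]_(z in P) (V 1 theta (c n) z + V (- 1) theta (c n) z))); last exact/funext.
apply: cvgM; first exact: cvg_cst.
apply: (@Rintegral_0y_dominated_cvg R _ _ (C theta)) => //; last first.
  by move=> n z z0; exact: V_le.
move=> z z0; rewrite -[stable_q _ _ _ _]add0r.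
have ce : (c n) ^- 2 @[n --> \oo] --> (0 : R).
  have h : (c n)^-1 @[n --> \oo] --> (0 : R).
    by apply/gtr0_cvgV0 => //; near=> n.
  rewrite (_ : (fun n => (c n) ^- 2) = (fun n => (c n)^-1 * (c n)^-1)).
    by rewrite -(mulr0 0); apply: cvgM.
  by apply/funext => n; rewrite -exprVn expr2.
apply: cvgD; last first.
  have h : W theta (c n ^- 2) z @[n --> \oo] --> stable_q gamma 2 theta z.
    have h := @W_cvg0 theta z z0.
    exact: (@cvg_comp _ _ _ (fun n => c n ^- 2) (fun e => W theta e z) _ _ _ ce h).
  rewrite (_ : (fun n => V (- 1) theta (c n) z) = (fun n => W theta (c n ^- 2) z))//.
  by apply/funext => n; rewrite VW.
apply: (@squeeze_cvgr _ _ _ _ (fun=> 0) (fun n => theta ^+ 2 / (8 * gamma ^+ 2) * (c n) ^- 2)).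
- near=> n; rewrite V_ge0//= (le_trans (Vplus_le _ (c1 n) z0))//.
  have X0 : 0 < 2 * c n ^+ 2 by rewrite mulr_gt0 ?exprn_gt0.
  have -> : theta ^+ 2 / (8 * gamma ^+ 2) * c n ^- 2 =
      theta ^+ 2 / (4 * gamma ^+ 2 * (2 * c n ^+ 2)).
    by field; rewrite (gt_eqF gamma0) gt_eqF.
  rewrite ler_wpM2l ?sqr_ge0// lef_pV2 ?posrE; last 2 first.
  - apply: mulr_gt0; first by rewrite mulr_gt0 ?exprn_gt0.
    by rewrite addr_gt0 ?mulr_gt0 ?exprn_gt0.
  - by apply: mulr_gt0 => //; rewrite mulr_gt0 ?exprn_gt0.
  apply: ler_wpM2l; first by rewrite mulr_ge0 ?sqr_ge0.
  have h1 : c n ^+ 2 <= c n ^+ 4 by rewrite ler_weXn2l.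
  by have := sqr_ge0 z; lra.
- exact: cvg_cst.
- by rewrite -(mulr0 (theta ^+ 2 / (8 * gamma ^+ 2))); apply: cvgM => //; exact: cvg_cst.
Unshelve. all: by end_near. Qed.

End LevyPsi.

(** * Fourier inversion and the Plancherel identity *)

Lemma Rdominated_cvg d (T : measurableType d) (R : realType)
    (mu : {measure set T -> \bar R}) (D : set T) (f_ : nat -> T -> R) (f g : T -> R) :
  measurable D -> (forall n, measurable_fun D (f_ n)) ->
  (forall x, D x -> f_ n x @[n --> \oo] --> f x) ->
  mu.-integrable D (EFin \o g) -> (forall n x, D x -> `|f_ n x| <= g x) ->
  mu.-integrable D (EFin \o f) /\
  \int[mu]_(x in D) f_ n x @[n --> \oo] --> \int[mu]_(x in D) f x.
Proof.
move=> mD mf cf ig fg.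
have mf' n : measurable_fun D (EFin \o f_ n) by exact/measurable_EFinP.
have cf' x : D x -> (EFin \o f_ n) x @[n --> \oo] --> (EFin \o f) x.
  by move=> Dx; apply: cvg_EFin; [exact: nearW|exact: cf].
have mlim : measurable_fun D (EFin \o f) by exact: emeasurable_fun_cvg mf' cf'.
have h1 : {ae mu, forall x, D x -> (EFin \o f_ n) x @[n --> \oo] --> (EFin \o f) x}.
  exact: aeW.
have h2 : {ae mu, forall x n, D x -> (`|(EFin \o f_ n) x| <= (EFin \o g) x)%E}.
  by apply: aeW => x n Dx /=; rewrite lee_fin fg.
have [fi _ cvgI] := dominated_convergence mD mf' mlim h1 ig h2.
split => //; apply: fine_cvg; rewrite fineK//.
exact: integrable_fin_num.
Qed.

(** * Fubini for two integrable functions and a bounded kernel *)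

Section BoundedFubini.
Context {R : realType}.
Notation mu := (@lebesgue_measure R).
Implicit Types (f g : R -> R) (k : R -> R -> R) (x y : R).

Lemma integrable_bounded_mul f (h : R -> R) (M : R) :
  mu.-integrable setT (EFin \o f) -> measurable_fun setT h -> (forall x, `|h x| <= M) ->
  mu.-integrable setT (fun x => (f x * h x)%:E).
Proof.
move=> fi mh hM; have /integrableP[mf _] := fi.
apply: (@le_integrable _ _ _ mu setT measurableT _ (fun x => (`|M|)%:E * (f x)%:E)%E).
- by apply/measurable_EFinP; apply: measurable_funM => //; exact/measurable_EFinP.
- move=> x _ /=; rewrite lee_fin !normrM normr_id mulrC ler_wpM2r//.
  by rewrite (le_trans (hM x))// ler_norm.
- exact: integrableZl.
Qed.

Variables (f g : R -> R) (k : R -> R -> R) (M : R).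
Hypothesis fi : mu.-integrable setT (EFin \o f).
Hypothesis gi : mu.-integrable setT (EFin \o g).
Hypothesis mk : measurable_fun setT (fun z : R * R => k z.1 z.2).
Hypothesis kM : forall x y, `|k x y| <= M.

Let mf : measurable_fun setT f.
Proof. by have /integrableP[/measurable_EFinP] := fi. Qed.

Let mg : measurable_fun setT g.
Proof. by have /integrableP[/measurable_EFinP] := gi. Qed.

Let mk1 x : measurable_fun setT (k x).
Proof. exact: (measurableT_comp mk (measurable_pair1 x)). Qed.

Let mk2 y : measurable_fun setT (k ^~ y).
Proof. exact: (measurableT_comp mk (measurable_pair2 y)). Qed.

Let h (z : R * R) := (g z.1 * (f z.2 * k z.1 z.2))%:E.

Let mh : measurable_fun setT h.
Proof.
apply/measurable_EFinP; apply: measurable_funM.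
  by apply: measurableT_comp.
apply: measurable_funM => //.
by apply: measurableT_comp.
Qed.

Let hi : (mu \x mu)%E.-integrable setT h.
Proof.
apply/integrable12ltyP => //.
have mah : measurable_fun setT (abse \o h) by exact: measurableT_comp.
have ah0 z : (0 <= (abse \o h) z)%E by exact: abse_ge0.
pose b (z : R * R) := ((`|M|)%:E * ((`|g z.1|)%:E * (`|f z.2|)%:E))%E.
have mb : measurable_fun setT b.
  apply: emeasurable_funM => //; apply: emeasurable_funM.
    apply/measurable_EFinP; apply: measurableT_comp => //.
    exact: measurableT_comp mg measurable_fst.
  apply/measurable_EFinP; apply: measurableT_comp => //.
  exact: measurableT_comp mf measurable_snd.
have b0 z : (0 <= b z)%E by rewrite !mule_ge0.
apply: (@le_lt_trans _ _ (\int[mu]_x \int[mu]_y ((`|M|)%:E * ((`|g x|)%:E * (`|f y|)%:E)))%E).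
  apply: ge0_le_integral => //.
  - by move=> x _; exact: integral_ge0.
  - exact: (@measurable_fun_fubini_tonelli_F _ _ _ _ R mu (abse \o h) mah ah0).
  - exact: (@measurable_fun_fubini_tonelli_F _ _ _ _ R mu b mb b0).
  move=> x _; apply: ge0_le_integral => //.
  - apply: measurableT_comp => //.
    exact: (measurableT_comp mh (measurable_pair1 x)).
  - apply/measurable_EFinP; apply: measurable_funM => //; apply: measurable_funM => //.
    exact: measurableT_comp.
  move=> y _; rewrite /h /= !normrM -!EFinM lee_fin.
  rewrite mulrA mulrC ler_wpM2r ?mulr_ge0//.
  by rewrite (le_trans (kM x y))// ler_norm.
have /integrableP[_ If] := fi; have /integrableP[_ Ig] := gi.
have Ig0 : (0 <= \int[mu]_x (`|g x|)%:E)%E by apply: integral_ge0 => x _; rewrite lee_fin.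
have If0 : (0 <= \int[mu]_x (`|f x|)%:E)%E by apply: integral_ge0 => x _; rewrite lee_fin.
have E x : (\int[mu]_y ((`|M|)%:E * ((`|g x|)%:E * (`|f y|)%:E)) =
    (`|M|)%:E * ((`|g x|)%:E * \int[mu]_y (`|f y|)%:E))%E.
  rewrite ge0_integralZl//.
  - rewrite ge0_integralZl//.
    by apply/measurable_EFinP; exact: measurableT_comp.
  - apply/measurable_EFinP; apply: measurable_funM => //; exact: measurableT_comp.
under eq_integral do rewrite E.
rewrite ge0_integralZl//; last 2 first.
- apply: emeasurable_funM => //.
  by apply/measurable_EFinP; exact: measurableT_comp.
- by move=> x _; rewrite mule_ge0.
rewrite ge0_integralZr//; last first.
  by apply/measurable_EFinP; exact: measurableT_comp.
move: If Ig If0 Ig0; rewrite /= => If Ig If0 Ig0.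
rewrite -(@fineK _ (\int[mu]_x (`|f x|)%:E)%E) ?ge0_fin_numE//.
rewrite -(@fineK _ (\int[mu]_x (`|g x|)%:E)%E) ?ge0_fin_numE//.
by rewrite -!EFinM ltry.
Qed.

Let Gx x : (\int[mu]_y h (x, y) = (g x * \int[mu]_y (f y * k x y))%:E)%E.
Proof.
have i1 : mu.-integrable setT (fun y => (f y * k x y)%:E).
  exact: integrable_bounded_mul fi (mk1 x) (kM x).
rewrite /h /= -RintegralZl// fineK//.
apply: integrable_fin_num => //.
exact: (@integrableZl _ _ _ mu setT measurableT (g x) _ i1).
Qed.

Let Gy y : (\int[mu]_x h (x, y) = (f y * \int[mu]_x (g x * k x y))%:E)%E.
Proof.
have i1 : mu.-integrable setT (fun x => (g x * k x y)%:E).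
  exact: integrable_bounded_mul gi (mk2 y) (kM ^~ y).
rewrite /h /= -RintegralZl//.
under eq_integral do rewrite mulrCA.
rewrite fineK//; apply: integrable_fin_num => //.
exact: (@integrableZl _ _ _ mu setT measurableT (f y) _ i1).
Qed.

Lemma integrable_Rfubini :
  mu.-integrable setT (fun x => (g x * \int[mu]_y (f y * k x y))%:E).
Proof.
apply: eq_integrable (integrable_fubini_F hi) => //.
by move=> x _; rewrite /fubini_F Gx.
Qed.

(** Moves a bounded kernel, trigonometric or Poisson, from one integrable function to the other. *)
Lemma Rfubini :
  \int[mu]_x (g x * \int[mu]_y (f y * k x y)) = \int[mu]_y (f y * \int[mu]_x (g x * k x y)).
Proof.
rewrite /Rintegral; congr fine.
under eq_integral do rewrite -Gx.
under [RHS]eq_integral do rewrite -Gy.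
exact: (@Fubini _ _ _ _ R mu mu h hi).
Qed.

End BoundedFubini.

(** * Poisson kernels and Lebesgue points *)

Section PoissonKernel.
Context {R : realType}.
Notation mu := (@lebesgue_measure R).
Implicit Types (e c x y u p xi : R).

Definition abel e xi : R := expR (- (e * `|xi|)).

(** The Fourier transform of [abel e], by [Rintegral_abel_cos]: a probability density that
    concentrates at 0 as [e] tends to 0. *)
Definition poisson e x : R := 2 * e / (e ^+ 2 + (2 * pi * x) ^+ 2).

Lemma continuous_abel e : continuous (abel e).
Proof.
move=> x; apply: (@continuous_comp _ _ _ (fun x => - (e * `|x|)) expR).
  apply: cvgN; apply: cvgM; first exact: cvg_cst.
  exact: norm_continuous.
exact: continuous_expR.
Qed.

Lemma abel_ge0 e xi : 0 <= abel e xi. Proof. exact: expR_ge0. Qed.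

Lemma abel_le1 e xi : 0 <= e -> abel e xi <= 1.
Proof. by move=> e0; rewrite /abel expR_le1 oppr_le0 mulr_ge0. Qed.

Lemma abel_cvg1 xi (e : nat -> R) : e n @[n --> \oo] --> (0 : R) ->
  abel (e n) xi @[n --> \oo] --> (1 : R).
Proof.
move=> e0; rewrite -expR0 -oppr0 -(mul0r `|xi|).
apply: continuous_cvg; first exact: continuous_expR.
by apply: cvgN; apply: cvgM => //; exact: cvg_cst.
Qed.

Let nneg : [set x : R | 0 <= x] = `[0, +oo[%classic.
Proof. by rewrite set_itvcy. Qed.

Section fixed_e.
Variable e : R.
Hypothesis e0 : 0 < e.

Let integralT_abel : (\int[mu]_xi (abel e xi)%:E = (2 * e^-1)%:E)%E.
Proof.
rewrite ge0_symfun_integralT; last 3 first.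
- by move=> x; exact: abel_ge0.
- exact: continuous_abel.
- by move=> x /=; rewrite /abel normrN.
rewrite nneg EFinM; congr (_ * _)%E; rewrite -(integral0y_expR e0).
apply: eq_integral => x; rewrite inE/= in_itv/= andbT => x0.
by rewrite /abel ger0_norm.
Qed.

Lemma integrable_abel : mu.-integrable setT (EFin \o abel e).
Proof.
apply/integrableP; split.
  by apply/measurable_EFinP; apply: continuous_measurable_fun; exact: continuous_abel.
under eq_integral => x _ do rewrite /= ger0_norm ?abel_ge0//.
by rewrite integralT_abel ltry.
Qed.

Let integralT_abel_onem_cos c :
  (\int[mu]_xi (abel e xi * (1 - cos (c * xi)))%:E = (2 * (e^-1 - e / (e ^+ 2 + c ^+ 2)))%:E)%E.
Proof.
rewrite ge0_symfun_integralT; last 3 first.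
- by move=> x; rewrite mulr_ge0 ?abel_ge0// subr_ge0 cos_le1.
- move=> x; apply: cvgM; first exact: continuous_abel.
  apply: cvgB; first exact: cvg_cst.
  apply: (@continuous_comp _ _ _ (fun x => c * x) cos); last exact: continuous_cos.
  by apply: cvgM; [exact: cvg_cst|].
- by move=> x /=; rewrite /abel normrN mulrN cosN.
rewrite nneg EFinM; congr (_ * _)%E; rewrite -(integral0y_expR_onem_cos e0).
apply: eq_integral => x; rewrite inE/= in_itv/= andbT => x0.
by rewrite /abel ger0_norm.
Qed.

Let mcos c : measurable_fun setT (fun xi => cos (c * xi)).
Proof.
apply: measurableT_comp; last exact: measurable_funM.
by apply: continuous_measurable_fun; exact: continuous_cos.
Qed.

(** Writing the cosine as [1 - (1 - cos)] reduces to the two nonnegative integrals above. *)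
Lemma Rintegral_abel_cos c :
  \int[mu]_xi (abel e xi * cos (c * xi)) = 2 * e / (e ^+ 2 + c ^+ 2).
Proof.
have i1 : mu.-integrable setT (fun xi => (abel e xi * (1 - cos (c * xi)))%:E).
  apply: (integrable_bounded_mul (M := 2) integrable_abel).
    by apply: measurable_funB => //; exact: mcos.
  move=> x; rewrite (le_trans (ler_normB _ _))// normr1.
  have : `|cos (c * x)| <= 1 by rewrite ler_norml cos_geN1 cos_le1.
  by lra.
transitivity (\int[mu]_xi (abel e xi - abel e xi * (1 - cos (c * xi)))).
  by apply: eq_Rintegral => x _; ring.
rewrite RintegralB//; last exact: integrable_abel.
rewrite /Rintegral integralT_abel integralT_abel_onem_cos /=.
have d0 : e ^+ 2 + c ^+ 2 != 0 by rewrite gt_eqF// ltr_pwDl ?sqr_ge0// exprn_gt0.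
by field; rewrite d0 gt_eqF.
Qed.

Lemma Rintegral_abel_sin c : \int[mu]_xi (abel e xi * sin (c * xi)) = 0.
Proof.
have ms : measurable_fun setT (fun xi => sin (c * xi)).
  apply: measurableT_comp; last exact: measurable_funM.
  by apply: continuous_measurable_fun; exact: continuous_sin.
have i1 : mu.-integrable setT (fun xi => (abel e xi * sin (c * xi))%:E).
  apply: (integrable_bounded_mul (M := 1) integrable_abel) => //.
  by move=> x; rewrite ler_norml sin_geN1 sin_le1.
set I := LHS.
suff : I = - I by lra.
rewrite {1}/I /Rintegral -integral_opp//; last by have /integrableP[] := i1.
rewrite preimage_setT.
transitivity (\int[mu]_xi (- 1 * (abel e xi * sin (c * xi)))).
  by apply: eq_Rintegral => x _; rewrite /abel normrN mulrN sinN mulrN mulN1r.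
by rewrite RintegralZl// mulN1r.
Qed.

Lemma poisson_ge0 x : 0 <= poisson e x.
Proof. by rewrite divr_ge0 ?mulr_ge0 ?(ltW e0)// addr_ge0 ?sqr_ge0. Qed.

Lemma poisson_le x : poisson e x <= 2 / e.
Proof.
have d0 : 0 < e ^+ 2 + (2 * pi * x) ^+ 2 by rewrite ltr_pwDl ?sqr_ge0// exprn_gt0.
rewrite /poisson ler_pdivrMr// mulrAC ler_pdivlMr//.
by rewrite -!mulrA ler_pM2l// -expr2 lerDl sqr_ge0.
Qed.

Lemma continuous_poisson : continuous (poisson e).
Proof.
move=> x; apply: cvgM; first exact: cvg_cst.
apply: cvgV; first by rewrite gt_eqF// ltr_pwDl ?sqr_ge0// exprn_gt0.
apply: cvgD; first exact: cvg_cst.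
have h : 2 * pi * x @[x --> x] --> (2 * pi * x : R) by apply: cvgM => //; exact: cvg_cst.
exact: (cvgM h h).
Qed.

(** The mass of [[a, b]] under the Poisson kernel centred at [u], in a form whose limit as [e] tends
    to 0 is read off from that of [atan]. *)
Definition poisson_atan (a b u : R) : R :=
  (atan (2 * pi * (b - u) / e) - atan (2 * pi * (a - u) / e)) / pi.

Lemma Rintegral_poisson (a b u : R) : a < b ->
  \int[mu]_(p in `[a, b]) poisson e (u - p) = poisson_atan a b u.
Proof.
move=> ab; have e1 : e != 0 by rewrite gt_eqF.
have p1 : (pi : R) != 0 by rewrite gt_eqF// pi_gt0.
pose F p := atan (2 * pi * (p - u) / e) / pi.
have dF (p : R) : is_derive p (1 : R) F (poisson e (u - p)).
  have h1 : is_derive p (1 : R) (fun p => 2 * pi * (p - u) / e) (2 * pi / e).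
    apply: is_derive_eq; rewrite /GRing.scale/=.
    by move: pi p1 => q q1; field.
  have h2 := is_derive1_atan (2 * pi * (p - u) / e).
  have h3 := @is_derive1_comp R _ _ p _ _ h2 h1.
  have h4 : is_derive p (1 : R) (fun p => (atan \o (fun p => 2 * pi * (p - u) / e)) p / pi)
     (((1 + (2 * pi * (p - u) / e) ^+ 2)^-1 * (2 * pi / e)) / pi).
    by apply: is_derive_eq; rewrite /GRing.scale/= !mulr0 add0r mulrC.
  apply: is_derive_eq h4 _.
  rewrite /poisson.
  have d0 : e ^+ 2 + (2 * pi * (u - p)) ^+ 2 != 0.
    by rewrite gt_eqF// ltr_pwDl ?sqr_ge0// exprn_gt0.
  have d1 : 1 + (2 * pi * (p - u) / e) ^+ 2 = (e ^+ 2 + (2 * pi * (u - p)) ^+ 2) / e ^+ 2.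
    by move: pi p1 d0 => q q1 d0; field.
  rewrite d1; move: pi p1 d0 => q q1 d0.
  by field; rewrite d0 e1 q1.
have cF : continuous F by move=> x; exact: is_derive_continuous.
rewrite /Rintegral (@continuous_FTC2 R _ F)//.
- by rewrite /F -EFinB /= /poisson_atan mulrBl.
- apply: continuous_subspaceT => x.
  apply: (@continuous_comp _ _ _ (fun p => u - p) (poisson e)).
    by apply: cvgB => //; exact: cvg_cst.
  exact: continuous_poisson.
- split.
  + by move=> x _; exact: ex_derive.
  + exact/cvg_at_right_filter/cF.
  + exact/cvg_at_left_filter/cF.
- by move=> x _; rewrite derive1E; have [_ ->] := dF x.
Qed.

End fixed_e.

Section inversion.
Variable f : R -> R.
Hypothesis fi : mu.-integrable setT (EFin \o f).

Let eps (n : nat) : R := n.+1%:R^-1.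

Let eps_gt0 n : 0 < eps n. Proof. by rewrite invr_gt0. Qed.

Let sgnpi (x : R) : R := if 0 < x then pi / 2 else if x < 0 then - (pi / 2) else 0.

Let atan_cvg x : atan (2 * pi * x / eps n) @[n --> \oo] --> sgnpi x.
Proof.
have ny : (n.+1%:R : R) @[n --> \oo] --> +oo.
  by have := @cvgr_idn R; rewrite -(cvg_shiftS (fun n => n%:R : R)).
have h (y : R) : 0 < y -> atan (2 * pi * y / eps n) @[n --> \oo] --> (pi / 2 : R).
  move=> y0; have hy : 2 * pi * y / eps n @[n --> \oo] --> +oo.
    rewrite (_ : (fun n => _) = (fun n => 2 * pi * y * n.+1%:R)).
      have p0 : (0 : R) < 2 * pi * y by rewrite !mulr_gt0 ?pi_gt0.
      exact: (@cvg_comp _ _ _ _ ( *%R (2 * pi * y)) _ _ _ ny (gt0_cvgMry p0 cvg_id)).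
    by apply/funext => n; rewrite invrK.
  exact: (@cvg_comp _ _ _ _ atan _ _ _ hy (@cvgy_atan R)).
rewrite /sgnpi; case: ltgtP => [x0|x0|<-]; first exact: h.
  have hx := h (- x); rewrite oppr_gt0 in hx.
  rewrite (_ : (fun n => _) = (fun n => - atan (2 * pi * - x / eps n))).
    by apply: cvgN; exact: hx.
  by apply/funext => n; rewrite mulrN mulNr atanN opprK.
rewrite (_ : (fun n => _) = (fun=> 0)); first exact: cvg_cst.
by apply/funext => n; rewrite mulr0 mul0r atan0.
Qed.

(** The limit of [poisson_atan]: the indicator of [[a, b]], except for the value 1/2 at the two
    endpoints. *)
Let L (a b u : R) : R := (sgnpi (b - u) - sgnpi (a - u)) / pi.

Let L_in (a b u : R) : a < u -> u < b -> L a b u = 1.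
Proof.
move=> au ub; rewrite /L /sgnpi subr_gt0 ub subr_gt0 subr_lt0 au ltNge (ltW au)/=.
by rewrite opprK -splitr divff// gt_eqF// pi_gt0.
Qed.

Let L_out (a b u : R) : a < b -> (u < a) || (b < u) -> L a b u = 0.
Proof.
move=> ab /orP[ua|bu]; rewrite /L /sgnpi !subr_gt0 !subr_lt0.
  by rewrite ua (lt_trans ua ab) subrr mul0r.
have au := lt_trans ab bu.
by rewrite bu au !ltNge (ltW bu) (ltW au)/= subrr mul0r.
Qed.

Variables (v : R -> R) (M : R).
Hypothesis cv : forall p,
  \int[mu]_u (f u * poisson (eps n) (u - p)) @[n --> \oo] --> v p.
Hypothesis bv : forall n p, `|\int[mu]_u (f u * poisson (eps n) (u - p))| <= M.

Let mk n : measurable_fun setT (fun z : R * R => poisson (eps n) (z.2 - z.1)).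
Proof.
apply: measurableT_comp.
  by apply: continuous_measurable_fun; exact: continuous_poisson.
by apply: measurable_funB; [exact: measurable_snd|exact: measurable_fst].
Qed.

Let kM n x y : `|poisson (eps n) (y - x)| <= 2 / eps n.
Proof. by rewrite ger0_norm ?poisson_ge0// poisson_le. Qed.

Let indic_int (a b : R) (h : R -> R) :
  \int[mu]_(p in `[a, b]) h p = \int[mu]_p (\1_(`[a, b]%classic : set R) p * h p).
Proof.
rewrite Rintegral_mkcond; apply: eq_Rintegral => p _.
by rewrite patchE indicE; case: ifP => _; rewrite ?mul1r ?mul0r.
Qed.

Let gi (a b : R) : mu.-integrable setT (EFin \o \1_(`[a, b]%classic : set R)).
Proof. exact: integrable_indic_itv. Qed.

Let fub n (a b : R) : a < b ->
  \int[mu]_(p in `[a, b]) \int[mu]_u (f u * poisson (eps n) (u - p)) =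
  \int[mu]_u (f u * poisson_atan (eps n) a b u).
Proof.
move=> ab; rewrite indic_int.
rewrite (@Rfubini R f _ (fun p u => poisson (eps n) (u - p)) (2 / eps n) fi (gi a b))//.
by apply: eq_Rintegral => u _; rewrite -indic_int Rintegral_poisson.
Qed.

(** The weight [abel 1] is integrable, which brings the function under [integrable_Rfubini]; it is
    divided out afterwards. *)
Let mconv n : measurable_fun setT (fun p => \int[mu]_u (f u * poisson (eps n) (u - p))).
Proof.
have /integrableP[/measurable_EFinP h _] := integrable_Rfubini fi (integrable_abel ltr01) (mk n) (kM n).
rewrite (_ : (fun p => _) = (fun p => expR (1 * `|p|) *
    (abel 1 p * \int[mu]_u (f u * poisson (eps n) (u - p))))); last first.
  by apply/funext => p; rewrite /abel mulrA expRN divff ?mul1r// gt_eqF ?expR_gt0.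
apply: measurable_funM => //; apply: measurableT_comp => //.
by apply: measurable_funM => //; exact: measurableT_comp.
Qed.

Let mv : measurable_fun setT v.
Proof.
exact: (@measurable_fun_cvg _ _ _ setT (fun n p => \int[mu]_u (f u * poisson (eps n) (u - p)))).
Qed.

Let vM p : `|v p| <= M.
Proof.
have h : `|\int[mu]_u (f u * poisson (eps n) (u - p))| @[n --> \oo] --> `|v p|.
  by apply: cvg_norm; exact: (@cv p).
rewrite -(cvg_lim _ h)//.
by apply: limr_le; [exact: cvgP h|exact: nearW].
Qed.

Let M0 : 0 <= M. Proof. exact: le_trans (normr_ge0 (v 0)) (vM 0). Qed.

Let vi (K : set R) : measurable K -> (mu K < +oo)%E -> mu.-integrable K (EFin \o v).
Proof.
move=> mK Koo; apply: (@measurable_bounded_integrable _ _ _ mu v K mK Koo).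
  exact: measurable_funS mv.
exists M; split; first exact: num_real.
by move=> x Mx y _ /=; rewrite (le_trans (vM y))// ltW.
Qed.

Let itv_oo (a b : R) : (mu `[a, b]%classic < +oo)%E.
Proof. by apply: compact_finite_measure; exact: segment_compact. Qed.

(** The integral of the Poisson means over [[a, b]] has two limits: that of [v], by the bound [M],
    and, after Fubini, that of [f], because [poisson_atan] is bounded by 1 and tends to the
    indicator of [[a, b]] off the endpoints. *)
Let Rintegral_itv_eq (a b : R) : a < b ->
  \int[mu]_(p in `[a, b]) v p = \int[mu]_(p in `[a, b]) f p.
Proof.
move=> ab.
have mab : measurable (`[a, b]%classic : set R) by exact: measurable_itv.
have gM : mu.-integrable `[a, b]%classic (EFin \o (cst M : R -> R)).
  apply: (@measurable_bounded_integrable _ _ _ mu (cst M) _ mab (itv_oo a b)) => //.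
  by exists M; split; [exact: num_real|move=> x Mx y _ /=; rewrite ger0_norm// ltW].
have [_ h1] := @Rdominated_cvg _ _ _ mu `[a, b]%classic
  (fun n p => \int[mu]_u (f u * poisson (eps n) (u - p))) v (cst M)
  mab (fun n => measurable_funS measurableT (@subsetT _ _) (mconv n))
  (fun p _ => @cv p) gM (fun n p _ => bv n p).
have {}h1 : \int[mu]_u (f u * poisson_atan (eps n) a b u) @[n --> \oo] -->
    \int[mu]_(p in `[a, b]) v p.
  by under eq_cvg do rewrite -fub//.
have /integrableP[/measurable_EFinP mf _] := fi.
have pi0 : (0 : R) < pi by exact: pi_gt0.
have matan n : measurable_fun setT (poisson_atan (eps n) a b).
  apply: measurable_funM => //; apply: measurable_funB.
    apply: measurableT_comp;
      last by do 2 apply: measurable_funM => //; exact: measurable_funB.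
    by apply: continuous_measurable_fun; exact: continuous_atan.
  apply: measurableT_comp;
    last by do 2 apply: measurable_funM => //; exact: measurable_funB.
  by apply: continuous_measurable_fun; exact: continuous_atan.
have lf (u : R) : setT u -> f u * poisson_atan (eps n) a b u @[n --> \oo] --> f u * L a b u.
  move=> _; apply: cvgM; first exact: cvg_cst.
  by apply: cvgM; [apply: cvgB; exact: atan_cvg|exact: cvg_cst].
have af : mu.-integrable setT (EFin \o (fun u => `|f u|)).
  exact: (@integrable_norm _ _ _ mu setT f fi).
have bf n (u : R) : setT u -> `|f u * poisson_atan (eps n) a b u| <= `|f u|.
  move=> _; rewrite normrM ler_piMr//.
  rewrite /poisson_atan normrM normfV (gtr0_norm pi0) ler_pdivrMr// mul1r.
  have := atan_ltpi2 (2 * pi * (b - u) / eps n).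
  have := atan_gtNpi2 (2 * pi * (b - u) / eps n).
  have := atan_ltpi2 (2 * pi * (a - u) / eps n).
  have := atan_gtNpi2 (2 * pi * (a - u) / eps n).
  move: (atan (2 * pi * (b - u) / eps n)) (atan (2 * pi * (a - u) / eps n)) => x y.
  move: (pi : R) => p *.
  by rewrite ler_norml; apply/andP; split; lra.
have [fLi h2] := @Rdominated_cvg _ _ _ mu setT
  (fun n u => f u * poisson_atan (eps n) a b u) (fun u => f u * L a b u) (fun u => `|f u|)
  measurableT (fun n => measurable_funM mf (matan n)) lf af bf.
rewrite (cvg_unique _ h1 h2)// [RHS]Rintegral_mkcond /Rintegral; congr fine.
have /integrableP[/measurable_EFinP mfL _] := fLi.
apply: ae_eq_integral => //; first exact/measurable_EFinP.
- apply/measurable_EFinP; apply/(measurable_restrictT _ _).1 => //.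
  exact: measurable_funS mf.
- exists [set a; b]; split.
  + by apply: measurableU; exact: measurable_set1.
  + by apply: countable_lebesgue_measure0; exact: finite_set_countable.
  + move=> u /=; apply: contra_notP => /not_orP[/eqP ua /eqP ub] _.
    rewrite patchE; case: ifPn => [|].
      rewrite inE/= in_itv/= => /andP[au ub'].
      by rewrite L_in ?mulr1// lt_neqAle ?au ?ub' ?andbT// eq_sym.
    rewrite notin_setE/= in_itv/= => /negP; rewrite negb_and -!ltNge => h.
    by rewrite L_out// mulr0.
Qed.

Let wi (a b : R) : mu.-integrable `[a, b] (EFin \o (f \- v)).
Proof.
have mab : measurable (`[a, b]%classic : set R) by exact: measurable_itv.
rewrite (_ : EFin \o (f \- v) = ((EFin \o f) \- (EFin \o v))%E)//.
apply: (@integrableB _ _ _ mu `[a, b]%classic mab).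
  exact: (@integrableS _ _ _ mu setT `[a, b]%classic _ measurableT mab (@subsetT _ _) fi).
by apply: vi => //; exact: itv_oo.
Qed.

(** The primitive of [f \- v] is identically 0 by [Rintegral_itv_eq], and at a Lebesgue point its
    derivative is the value of [f \- v]. *)
Lemma inversion_lebesgue_pt x : lebesgue_pt (f \- v) x -> f x = v x.
Proof.
move=> wx.
have x1 : x < x + 1 by rewrite ltrDl.
have [|_] := @FTC1_lebesgue_pt _ _ _ x (x + 1) x1 (wi (x - 1) (x + 1)) _ wx.
  by rewrite lte_fin gtrBl.
rewrite (_ : (fun y : R => \int[mu]_(t in `[x - 1, y]) (f \- v) t) = cst 0).
  by rewrite derive1_cst => /esym/eqP; rewrite subr_eq0 => /eqP.
apply/funext => y /=.
have [xy|yx] := ltP (x - 1) y.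
  have mab : measurable (`[x - 1, y]%classic : set R) by exact: measurable_itv.
  rewrite (@RintegralB _ _ _ mu `[x - 1, y]%classic f v mab)//.
  - by rewrite Rintegral_itv_eq// subrr.
  - exact: (@integrableS _ _ _ mu setT _ _ measurableT mab (@subsetT _ _) fi).
  - by apply: vi => //; exact: itv_oo.
have [<-|ny] := eqVneq y (x - 1); first by rewrite set_itv1 Rintegral_set1.
by rewrite set_itv_ge ?Rintegral_set0// bnd_simp -ltNge lt_neqAle ny.
Qed.

Lemma inversion_ae : {ae mu, forall x, f x = v x}.
Proof.
have lw : locally_integrable setT (f \- v).
  apply: locally_integrableB.
    have /integrableP[/measurable_EFinP mf foo] := fi.
    split; [exact: mf|exact: openT|move=> K _ cK].
    have mK := compact_measurable cK.
    by have /integrableP[] :=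
      @integrableS _ _ _ mu setT K _ measurableT mK (@subsetT _ _) fi.
  split; [exact: mv|exact: openT|move=> K _ cK].
  have mK := compact_measurable cK.
  by have /integrableP[] := vi mK (compact_finite_measure cK).
have := lebesgue_differentiation lw.
apply: filterS; first exact: (ae_filter_ringOfSetsType mu).
by move=> x; exact: inversion_lebesgue_pt.
Qed.

Lemma inversion_continuous x : continuous f -> continuous v -> f x = v x.
Proof.
move=> cf cv'; apply: inversion_lebesgue_pt.
apply: (@continuous_lebesgue_pt _ _ _ setT) => //.
- by split; [exact: openT|].
- by apply: continuous_measurable_fun => y; apply: cvgB; [exact: cf|exact: cv'].
- by apply: cvgB; [exact: cf|exact: cv'].
Qed.

End inversion.

End PoissonKernel.

(** * Abel summation, Plancherel identity and inverse transforms *)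

Section FourierInversion.
Context {R : realType}.
Notation mu := (@lebesgue_measure R).
Implicit Types (f g h G w psi : R -> R) (e x y u p xi : R).

(** With [fsin], the real and imaginary part of [fourier], so that only real integrals occur. *)
Definition fcos f xi : R := \int[mu]_u (f u * cos (2 * pi * xi * u)).

Definition fsin f xi : R := \int[mu]_u (f u * sin (2 * pi * xi * u)).

Let cosM x : `|cos x| <= 1. Proof. by rewrite ler_norml cos_geN1 cos_le1. Qed.

Let sinM x : `|sin x| <= 1. Proof. by rewrite ler_norml sin_geN1 sin_le1. Qed.

Let mcos c : measurable_fun setT (fun u : R => cos (c * u)).
Proof.
apply: measurableT_comp; last exact: measurable_funM.
by apply: continuous_measurable_fun; exact: continuous_cos.
Qed.

Let msin c : measurable_fun setT (fun u : R => sin (c * u)).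
Proof.
apply: measurableT_comp; last exact: measurable_funM.
by apply: continuous_measurable_fun; exact: continuous_sin.
Qed.

Let mcos2 (c : R) : measurable_fun setT (fun z : R * R => cos (c * z.1 * z.2)).
Proof.
apply: (@measurableT_comp _ _ _ _ _ _ cos).
  by apply: continuous_measurable_fun; exact: continuous_cos.
apply: measurable_funM; last exact: measurable_snd.
by apply: measurable_funM => //; exact: measurable_fst.
Qed.

Let msin2 (c : R) : measurable_fun setT (fun z : R * R => sin (c * z.1 * z.2)).
Proof.
apply: (@measurableT_comp _ _ _ _ _ _ sin).
  by apply: continuous_measurable_fun; exact: continuous_sin.
apply: measurable_funM; last exact: measurable_snd.
by apply: measurable_funM => //; exact: measurable_fst.
Qed.

Lemma integrable_mul_cos f c : mu.-integrable setT (EFin \o f) ->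
  mu.-integrable setT (fun u => (f u * cos (c * u))%:E).
Proof. by move=> fi; exact: (integrable_bounded_mul (M := 1)). Qed.

Lemma integrable_mul_sin f c : mu.-integrable setT (EFin \o f) ->
  mu.-integrable setT (fun u => (f u * sin (c * u))%:E).
Proof. by move=> fi; exact: (integrable_bounded_mul (M := 1)). Qed.

Lemma fourierE f xi : fourier f xi = (fcos f xi +i* fsin f xi)%C.
Proof.
rewrite /fourier /cintegral /fcos /fsin.
by congr (_ +i* _)%C; apply: eq_Rintegral => u _ /=; rewrite !(mul0r, subr0, addr0).
Qed.

Lemma normr_fcos_le f xi : mu.-integrable setT (EFin \o f) ->
  `|fcos f xi| <= \int[mu]_u `|f u|.
Proof.
move=> fi; apply: (le_trans (le_normr_Rintegral _ _)) => //.
  exact: integrable_mul_cos.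
apply: le_Rintegral => //.
- apply: (@integrable_norm _ _ _ mu setT (fun u => f u * cos (2 * pi * xi * u))).
  exact: integrable_mul_cos.
- exact: (@integrable_norm _ _ _ mu setT f fi).
- by move=> u _; rewrite normrM ler_piMr.
Qed.

Lemma normr_fsin_le f xi : mu.-integrable setT (EFin \o f) ->
  `|fsin f xi| <= \int[mu]_u `|f u|.
Proof.
move=> fi; apply: (le_trans (le_normr_Rintegral _ _)) => //.
  exact: integrable_mul_sin.
apply: le_Rintegral => //.
- apply: (@integrable_norm _ _ _ mu setT (fun u => f u * sin (2 * pi * xi * u))).
  exact: integrable_mul_sin.
- exact: (@integrable_norm _ _ _ mu setT f fi).
- by move=> u _; rewrite normrM ler_piMr.
Qed.

Lemma continuous_fcos f : mu.-integrable setT (EFin \o f) -> continuous (fcos f).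
Proof.
move=> fi a.
have af : mu.-integrable setT (EFin \o (fun u => `|f u|)).
  exact: (@integrable_norm _ _ _ mu setT f fi).
apply: (@continuity_under_integral R _ _ mu (fun xi u => f u * cos (2 * pi * xi * u))
  setT measurableT (a - 1) (a + 1) _ _ (fun u => `|f u|)) => //.
- by move=> x _; exact: integrable_mul_cos.
- apply: aeW => u _ x _.
  apply: cvgM; first exact: cvg_cst.
  apply: (@continuous_comp _ _ _ (fun x => 2 * pi * x * u) cos); last exact: continuous_cos.
  by apply: cvgM; [apply: cvgM => //|]; exact: cvg_cst.
- by move=> x _; apply: aeW => u _; rewrite normrM ler_piMr.
- by rewrite inE/= in_itv/=; apply/andP; split; lra.
Qed.

Lemma continuous_fsin f : mu.-integrable setT (EFin \o f) -> continuous (fsin f).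
Proof.
move=> fi a.
have af : mu.-integrable setT (EFin \o (fun u => `|f u|)).
  exact: (@integrable_norm _ _ _ mu setT f fi).
apply: (@continuity_under_integral R _ _ mu (fun xi u => f u * sin (2 * pi * xi * u))
  setT measurableT (a - 1) (a + 1) _ _ (fun u => `|f u|)) => //.
- by move=> x _; exact: integrable_mul_sin.
- apply: aeW => u _ x _.
  apply: cvgM; first exact: cvg_cst.
  apply: (@continuous_comp _ _ _ (fun x => 2 * pi * x * u) sin); last exact: continuous_sin.
  by apply: cvgM; [apply: cvgM => //|]; exact: cvg_cst.
- by move=> x _; apply: aeW => u _; rewrite normrM ler_piMr.
- by rewrite inE/= in_itv/=; apply/andP; split; lra.
Qed.

(** This combination and that of [fsinB] are the real and imaginary part of [fourier f xi] times
    exp(-2 i pi p xi), the transform of a translate of [f]. *)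
Let fcosD f p xi : mu.-integrable setT (EFin \o f) ->
  fcos f xi * cos (2 * pi * p * xi) + fsin f xi * sin (2 * pi * p * xi) =
  \int[mu]_u (f u * cos (2 * pi * xi * (u - p))).
Proof.
move=> fi; rewrite /fcos /fsin -!RintegralZr//; [|exact: integrable_mul_sin|exact: integrable_mul_cos].
rewrite -RintegralD//.
- apply: eq_Rintegral => u _.
  rewrite mulrBr cosB (_ : 2 * pi * p * xi = 2 * pi * xi * p); last by ring.
  by ring.
- apply: (integrable_bounded_mul (M := 1)) => //.
    exact: integrable_mul_cos.
- apply: (integrable_bounded_mul (M := 1)) => //.
    exact: integrable_mul_sin.
Qed.

Let fsinB f p xi : mu.-integrable setT (EFin \o f) ->
  fsin f xi * cos (2 * pi * p * xi) - fcos f xi * sin (2 * pi * p * xi) =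
  \int[mu]_u (f u * sin (2 * pi * xi * (u - p))).
Proof.
move=> fi; rewrite /fcos /fsin -!RintegralZr//; [|exact: integrable_mul_cos|exact: integrable_mul_sin].
rewrite -RintegralB//.
- apply: eq_Rintegral => u _.
  rewrite mulrBr sinB (_ : 2 * pi * p * xi = 2 * pi * xi * p); last by ring.
  by ring.
- apply: (integrable_bounded_mul (M := 1)) => //.
    exact: integrable_mul_sin.
- apply: (integrable_bounded_mul (M := 1)) => //.
    exact: integrable_mul_cos.
Qed.

Let mcosB p : measurable_fun setT (fun z : R * R => cos (2 * pi * z.1 * (z.2 - p))).
Proof.
apply: (@measurableT_comp _ _ _ _ _ _ cos).
  by apply: continuous_measurable_fun; exact: continuous_cos.
apply: measurable_funM; first by apply: measurable_funM => //; exact: measurable_fst.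
by apply: measurable_funB => //; exact: measurable_snd.
Qed.

Let msinB p : measurable_fun setT (fun z : R * R => sin (2 * pi * z.1 * (z.2 - p))).
Proof.
apply: (@measurableT_comp _ _ _ _ _ _ sin).
  by apply: continuous_measurable_fun; exact: continuous_sin.
apply: measurable_funM; first by apply: measurable_funM => //; exact: measurable_fst.
by apply: measurable_funB => //; exact: measurable_snd.
Qed.

(** Abel means of the inverse transform are Poisson means of [f]: Fubini applies the cosine kernel
    to [abel e]. *)
Lemma Rintegral_abel_fcosD f e p : 0 < e -> mu.-integrable setT (EFin \o f) ->
  \int[mu]_xi (abel e xi *
    (fcos f xi * cos (2 * pi * p * xi) + fsin f xi * sin (2 * pi * p * xi))) =
  \int[mu]_u (f u * poisson e (u - p)).
Proof.
move=> e0 fi; under eq_Rintegral do rewrite fcosD//.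
rewrite (@Rfubini R f (abel e) (fun xi u => cos (2 * pi * xi * (u - p))) 1 fi (integrable_abel e0))//.
apply: eq_Rintegral => u _; congr (_ * _).
transitivity (\int[mu]_xi (abel e xi * cos (2 * pi * (u - p) * xi))).
  by apply: eq_Rintegral => x _; congr (_ * cos _); ring.
by rewrite Rintegral_abel_cos.
Qed.

Lemma Rintegral_abel_fsinB f e p : 0 < e -> mu.-integrable setT (EFin \o f) ->
  \int[mu]_xi (abel e xi *
    (fsin f xi * cos (2 * pi * p * xi) - fcos f xi * sin (2 * pi * p * xi))) = 0.
Proof.
move=> e0 fi; under eq_Rintegral do rewrite fsinB//.
rewrite (@Rfubini R f (abel e) (fun xi u => sin (2 * pi * xi * (u - p))) 1 fi (integrable_abel e0))//.
rewrite /Rintegral integral0_eq// => u _ /=; congr EFin.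
transitivity (f u * \int[mu]_xi (abel e xi * sin (2 * pi * (u - p) * xi))).
  by congr (_ * _); apply: eq_Rintegral => x _; congr (_ * sin _); ring.
by rewrite Rintegral_abel_sin ?mulr0.
Qed.

Let abelM (n : nat) xi h : `|abel n.+1%:R^-1 xi * h xi| <= `|h xi|.
Proof. by rewrite normrM ger0_norm ?abel_ge0// ler_piMl// abel_le1// ltW. Qed.

Let mabel e : measurable_fun setT (abel e).
Proof. by apply: continuous_measurable_fun; exact: continuous_abel. Qed.

Lemma abel_summation h : mu.-integrable setT (EFin \o h) ->
  \int[mu]_xi (abel n.+1%:R^-1 xi * h xi) @[n --> \oo] --> \int[mu]_xi h xi.
Proof.
move=> hi.
have /integrableP[/measurable_EFinP mh _] := hi.
have mf (n : nat) : measurable_fun setT (fun xi => abel n.+1%:R^-1 xi * h xi).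
  exact: measurable_funM.
have cf xi : setT xi -> abel n.+1%:R^-1 xi * h xi @[n --> \oo] --> h xi.
  move=> _; rewrite -[X in _ --> X]mul1r; apply: cvgM; last exact: cvg_cst.
  by apply: abel_cvg1; exact: cvg_harmonic.
have [_] := @Rdominated_cvg _ _ _ mu setT (fun (n : nat) xi => abel n.+1%:R^-1 xi * h xi) h
  (fun u => `|h u|) measurableT mf cf (@integrable_norm _ _ _ mu setT h hi) (fun n x _ => abelM n x h).
exact.
Qed.

Let abel_bound (n : nat) h g : mu.-integrable setT (EFin \o h) ->
  mu.-integrable setT (EFin \o g) -> (forall xi, `|h xi| <= g xi) ->
  `|\int[mu]_xi (abel n.+1%:R^-1 xi * h xi)| <= \int[mu]_xi g xi.
Proof.
move=> hi gi hg; have /integrableP[/measurable_EFinP mh _] := hi.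
have ai : mu.-integrable setT (EFin \o (fun xi => abel n.+1%:R^-1 xi * h xi)).
  apply: (@le_integrable _ _ _ mu setT measurableT _ (EFin \o g)) => //.
    by apply/measurable_EFinP; apply: measurable_funM; [exact: mabel|exact: mh].
  move=> x _ /=; rewrite lee_fin (le_trans (abelM n x h))// (le_trans (hg x))//.
  by rewrite ler_norm.
apply: (le_trans (le_normr_Rintegral _ _)) => //.
apply: le_Rintegral => //.
  exact: (@integrable_norm _ _ _ mu setT _ ai).
by move=> x _; rewrite (le_trans (abelM n x h)).
Qed.

Section Plancherel.
Variable w : R -> R.
Hypothesis wi : mu.-integrable setT (EFin \o w).
Hypothesis ci : mu.-integrable setT (EFin \o fcos w).
Hypothesis si : mu.-integrable setT (EFin \o fsin w).

Let inv : {ae mu, forall x, w x = fcos (fcos w) x + fsin (fsin w) x}.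
Proof.
have hi p : mu.-integrable setT (EFin \o
    (fun xi => fcos w xi * cos (2 * pi * p * xi) + fsin w xi * sin (2 * pi * p * xi))).
  apply: (@integrableD _ _ _ mu setT measurableT
    (fun xi => (fcos w xi * cos (2 * pi * p * xi))%:E)
    (fun xi => (fsin w xi * sin (2 * pi * p * xi))%:E)).
    exact: integrable_mul_cos.
  exact: integrable_mul_sin.
have ni : mu.-integrable setT (EFin \o (fun xi => `|fcos w xi| + `|fsin w xi|)).
  apply: (@integrableD _ _ _ mu setT measurableT
    (fun xi => (`|fcos w xi|)%:E) (fun xi => (`|fsin w xi|)%:E)).
    exact: (@integrable_norm _ _ _ mu setT _ ci).
  exact: (@integrable_norm _ _ _ mu setT _ si).
apply: (@inversion_ae R w wi _ (\int[mu]_xi (`|fcos w xi| + `|fsin w xi|))).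
- move=> p.
  rewrite (_ : (fun n : nat => _) = (fun n : nat => \int[mu]_xi (abel n.+1%:R^-1 xi *
    (fcos w xi * cos (2 * pi * p * xi) + fsin w xi * sin (2 * pi * p * xi))))); last first.
    by apply/funext => n; rewrite Rintegral_abel_fcosD.
  rewrite /fcos -/(fcos w) /fsin -/(fsin w) -RintegralD//; last 2 first.
    exact: integrable_mul_cos.
    exact: integrable_mul_sin.
  exact: abel_summation.
- move=> n p; rewrite -Rintegral_abel_fcosD//.
  apply: abel_bound => // xi; rewrite (le_trans (ler_normD _ _))//.
  by rewrite lerD// normrM ler_piMr.
Qed.

Let fcos_fcos :
  \int[mu]_p (w p * fcos (fcos w) p) = \int[mu]_p (fcos w p * fcos w p).
Proof.
have -> := @Rfubini R (fcos w) w (fun p xi => cos (2 * pi * p * xi)) 1 ci wi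
  (mcos2 (2 * pi)) (fun p xi => cosM _).
apply: eq_Rintegral => xi _; congr (_ * _); apply: eq_Rintegral => u _.
by congr (_ * cos _); ring.
Qed.

Let fsin_fsin :
  \int[mu]_p (w p * fsin (fsin w) p) = \int[mu]_p (fsin w p * fsin w p).
Proof.
have -> := @Rfubini R (fsin w) w (fun p xi => sin (2 * pi * p * xi)) 1 si wi
  (msin2 (2 * pi)) (fun p xi => sinM _).
apply: eq_Rintegral => xi _; congr (_ * _); apply: eq_Rintegral => u _.
by congr (_ * sin _); ring.
Qed.

(** The inversion formula is multiplied by [w] and integrated; Fubini then moves the cosine and sine
    kernels back onto [w]. The squares of the transforms are integrable because the transforms are
    also bounded. *)
Lemma plancherel :
  (\int[mu]_x ((w x) ^+ 2)%:E = \int[mu]_xi ((fcos w xi) ^+ 2 + (fsin w xi) ^+ 2)%:E)%E.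
Proof.
have i1 : mu.-integrable setT (fun p => (w p * fcos (fcos w) p)%:E).
  exact: (@integrable_Rfubini R (fcos w) w (fun p xi => cos (2 * pi * p * xi)) 1 ci wi).
have i2 : mu.-integrable setT (fun p => (w p * fsin (fsin w) p)%:E).
  exact: (@integrable_Rfubini R (fsin w) w (fun p xi => sin (2 * pi * p * xi)) 1 si wi).
have /integrableP[/measurable_EFinP mw _] := wi.
have mc : measurable_fun setT (fcos w).
  by apply: continuous_measurable_fun; exact: continuous_fcos.
have ms : measurable_fun setT (fsin w).
  by apply: continuous_measurable_fun; exact: continuous_fsin.
have i3 : mu.-integrable setT (fun p => (fcos w p * fcos w p)%:E).
  by apply: (integrable_bounded_mul ci mc) => x; exact: normr_fcos_le.
have i4 : mu.-integrable setT (fun p => (fsin w p * fsin w p)%:E).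
  by apply: (integrable_bounded_mul si ms) => x; exact: normr_fsin_le.
have i12 := @integrableD _ _ _ mu setT measurableT _ _ i1 i2.
have i34 := @integrableD _ _ _ mu setT measurableT _ _ i3 i4.
transitivity (\int[mu]_p (w p * fcos (fcos w) p + w p * fsin (fsin w) p)%:E)%E.
  apply: ae_eq_integral.
  - exact: measurableT.
  - by apply/measurable_EFinP; exact: measurable_funX mw.
  - by have /integrableP[] := i12.
  - apply: filterS inv; first exact: (ae_filter_ringOfSetsType mu).
    by move=> x wx _; rewrite -mulrDr -wx.
under [RHS]eq_integral do rewrite !expr2.
rewrite -[LHS]fineK; last exact: integrable_fin_num i12.
rewrite -[RHS]fineK; last exact: integrable_fin_num i34.
congr EFin; rewrite -!/(Rintegral _ _ _).
rewrite (RintegralD measurableT i1 i2) (RintegralD measurableT i3 i4).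
by rewrite fcos_fcos fsin_fsin.
Qed.

End Plancherel.

(** Here [psi] is the inverse transform of G1 + i G2, the last hypothesis saying that it is real.
    Poisson means of [G1] and [G2] are Abel means of the cosine and sine integrals of [psi], and
    continuity gives equality at every point. *)
Lemma fcos_fsin_inverse G1 G2 psi :
  mu.-integrable setT (EFin \o G1) -> mu.-integrable setT (EFin \o G2) ->
  mu.-integrable setT (EFin \o psi) -> continuous G1 -> continuous G2 ->
  (forall p, psi p = fcos G1 p + fsin G2 p) ->
  (forall p, 0 = fcos G2 p - fsin G1 p) ->
  (forall xi, fcos psi xi = G1 xi) /\ (forall xi, fsin psi xi = G2 xi).
Proof.
move=> i1 i2 ip c1 c2 e1 e2.
have e3 p : fcos G2 p = fsin G1 p by apply/eqP; rewrite -subr_eq0 -e2.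
have cf G : mu.-integrable setT (EFin \o G) -> measurable_fun setT (fcos G).
  by move=> Gi; apply: continuous_measurable_fun; exact: continuous_fcos.
have sf G : mu.-integrable setT (EFin \o G) -> measurable_fun setT (fsin G).
  by move=> Gi; apply: continuous_measurable_fun; exact: continuous_fsin.
have ni : mu.-integrable setT (EFin \o (fun u => `|psi u|)).
  exact: (@integrable_norm _ _ _ mu setT psi ip).
have bc G p e : 0 < e -> mu.-integrable setT (EFin \o G) ->
    mu.-integrable setT (EFin \o (fun x => abel e x *
      (fcos G x * cos (2 * pi * p * x) + fsin G x * sin (2 * pi * p * x)))).
  move=> e0 Gi; apply: (integrable_bounded_mul (M := 2 * \int[mu]_u `|G u|) (integrable_abel e0)).
    by apply: measurable_funD; apply: measurable_funM; auto.
  move=> x; rewrite (le_trans (ler_normD _ _))// !normrM (mulr_natl (\int[mu]_u `|G u|)) mulr2n.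
  have Gc := normr_fcos_le x Gi; have Gs := normr_fsin_le x Gi.
  by apply: lerD; [apply: le_trans Gc|apply: le_trans Gs]; rewrite ler_piMr.
have bs G p e : 0 < e -> mu.-integrable setT (EFin \o G) ->
    mu.-integrable setT (EFin \o (fun x => abel e x *
      (fsin G x * cos (2 * pi * p * x) - fcos G x * sin (2 * pi * p * x)))).
  move=> e0 Gi; apply: (integrable_bounded_mul (M := 2 * \int[mu]_u `|G u|) (integrable_abel e0)).
    by apply: measurable_funB; apply: measurable_funM; auto.
  move=> x; rewrite (le_trans (ler_normB _ _))// !normrM (mulr_natl (\int[mu]_u `|G u|)) mulr2n.
  have Gc := normr_fcos_le x Gi; have Gs := normr_fsin_le x Gi.
  by apply: lerD; [apply: le_trans Gs|apply: le_trans Gc]; rewrite ler_piMr.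
(* The vanishing integral of [Rintegral_abel_fsinB] for [G2] is added: the cosine terms combine to
   [psi] and the sine terms cancel by [e3]. *)
have E1 p e : 0 < e -> \int[mu]_u (G1 u * poisson e (u - p)) =
    \int[mu]_x (abel e x * (psi x * cos (2 * pi * p * x))).
  move=> e0; rewrite -(Rintegral_abel_fcosD p e0 i1) -[LHS]addr0.
  rewrite -(Rintegral_abel_fsinB p e0 i2) -RintegralD//; [|exact: bc|exact: bs].
  by apply: eq_Rintegral => x _; rewrite e1 e3; ring.
have E2 p e : 0 < e -> \int[mu]_u (G2 u * poisson e (u - p)) =
    \int[mu]_x (abel e x * (psi x * sin (2 * pi * p * x))).
  move=> e0; rewrite -(Rintegral_abel_fcosD p e0 i2) -[LHS]subr0.
  rewrite -(Rintegral_abel_fsinB p e0 i1) -RintegralB//; [|exact: bc|exact: bs].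
  by apply: eq_Rintegral => x _; rewrite e1 e3; ring.
split=> xi; apply/esym.
- apply: (@inversion_continuous R G1 i1 _ (\int[mu]_x `|psi x|) _ _ xi c1) => [p|n p|].
  + rewrite (_ : (fun n : nat => _) = (fun n : nat => \int[mu]_x (abel n.+1%:R^-1 x *
      (psi x * cos (2 * pi * p * x))))); last by apply/funext => n; rewrite E1.
    by apply: abel_summation; exact: integrable_mul_cos.
  + rewrite E1//; apply: abel_bound => //; first exact: integrable_mul_cos.
    by move=> x; rewrite normrM ler_piMr.
  + exact: continuous_fcos.
- apply: (@inversion_continuous R G2 i2 _ (\int[mu]_x `|psi x|) _ _ xi c2) => [p|n p|].
  + rewrite (_ : (fun n : nat => _) = (fun n : nat => \int[mu]_x (abel n.+1%:R^-1 x *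
      (psi x * sin (2 * pi * p * x))))); last by apply/funext => n; rewrite E2.
    by apply: abel_summation; exact: integrable_mul_sin.
  + rewrite E2//; apply: abel_bound => //; first exact: integrable_mul_sin.
    by move=> x; rewrite normrM ler_piMr.
  + exact: continuous_fsin.
Qed.

End FourierInversion.

(** * Solutions with a Fourier symbol *)

Section Norms.
Context {R : realType}.
Notation mu := (@lebesgue_measure R).
Implicit Types (f g : R -> R) (xi : R).

(* [ge0_le_integral] asks for the measurability of both functions; it is not
   available for t |-> ||rho_B(t) - rho(t)||_2, which is only bounded by a constant. *)
Lemma ge0_le_integral_nonmeasurable (D : set R) (f g : R -> \bar R) :
  (forall x, D x -> 0 <= f x)%E -> (forall x, D x -> f x <= g x)%E ->
  (\int[mu]_(x in D) f x <= \int[mu]_(x in D) g x)%E.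
Proof.
move=> f0 fg.
have fg' x : ((f \_ D) x <= (g \_ D) x)%E.
  by rewrite !patchE; case: ifPn => //; rewrite inE => Dx; exact: fg.
have f0' x : (0 <= (f \_ D) x)%E.
  by rewrite patchE; case: ifPn => //; rewrite inE => Dx; exact: f0.
rewrite integral_mkcond [leRHS]integral_mkcond.
rewrite !ge0_integralTE//; last by move=> x; exact: le_trans (fg' x).
apply: ub_ereal_sup => _ [h hf <-].
by apply: ereal_sup_ubound; exists h => // x; exact: le_trans (fg' x).
Qed.

Lemma norm12_integrable f : measurable_fun setT f -> (norm12 f < +oo)%E ->
  mu.-integrable setT (EFin \o f).
Proof.
move=> mf foo; apply/integrableP; split; first exact/measurable_EFinP.
rewrite -Lnorm1 (le_lt_trans _ foo)//.
by rewrite /norm12 leeDl ?Lnorm_ge0.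
Qed.

Lemma normr_fcos_le_norm12 f xi : measurable_fun setT f -> mu.-integrable setT (EFin \o f) ->
  ((`|fcos f xi|)%:E <= norm12 f)%E.
Proof.
move=> mf fi; apply: (@le_trans _ _ ('N[mu]_1 [EFin \o f])%E); last first.
  by rewrite /norm12 leeDl ?Lnorm_ge0.
rewrite Lnorm1; apply: (@le_trans _ _ (\int[mu]_u `|f u|)%:E).
  by rewrite lee_fin; exact: normr_fcos_le.
rewrite /Rintegral fineK//; apply: integrable_fin_num => //.
exact: (@integrable_norm _ _ _ mu setT f fi).
Qed.

Lemma normr_fsin_le_norm12 f xi : measurable_fun setT f -> mu.-integrable setT (EFin \o f) ->
  ((`|fsin f xi|)%:E <= norm12 f)%E.
Proof.
move=> mf fi; apply: (@le_trans _ _ ('N[mu]_1 [EFin \o f])%E); last first.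
  by rewrite /norm12 leeDl ?Lnorm_ge0.
rewrite Lnorm1; apply: (@le_trans _ _ (\int[mu]_u `|f u|)%:E).
  by rewrite lee_fin; exact: normr_fsin_le.
rewrite /Rintegral fineK//; apply: integrable_fin_num => //.
exact: (@integrable_norm _ _ _ mu setT f fi).
Qed.

Lemma cvg0_norm12 (F : set_system R) {FF : Filter F} (phi : R -> R) (N : R -> \bar R) :
  (\forall r \near F, (`|phi r|)%:E <= N r)%E -> N @ F --> 0%E -> phi @ F --> (0 : R).
Proof.
move=> phiN N0; apply/cvgrPdist_lt => e e0.
have /fine_cvgP[Nfin] := N0.
move/cvgrPdist_lt => /(_ _ e0) Ne.
near=> r; rewrite sub0r normrN.
have h1 : (`|phi r|%:E <= N r)%E by near: r.
have h2 : N r \is a fin_num by near: r.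
have h3 : `|0 - (fine \o N) r| < e by near: r.
rewrite sub0r normrN /= in h3.
rewrite -lte_fin (le_lt_trans h1)// -(fineK h2) lte_fin.
by rewrite (le_lt_trans _ h3)// ler_norm.
Unshelve. all: by end_near. Qed.

End Norms.

(** * The scalar equation at each frequency *)

Section SymbolODE.
Context {R : realType}.
Notation mu := (@lebesgue_measure R).
Variables (A : (R -> R) -> (R -> R) -> Prop) (S : R) (f0 : R -> R) (rho : R -> R -> R).
Hypothesis sol : is_solution A S f0 rho.
Implicit Types (t r u xi : R).

Let D : set R := [set` `[0, S] ].

Lemma solution_measurable t : 0 <= t <= S -> measurable_fun setT (rho t).
Proof. by move=> t0S; have [] := sol_space sol t0S. Qed.

Lemma solution_integrable t : 0 <= t <= S -> mu.-integrable setT (EFin \o rho t).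
Proof. by move=> t0S; have [mr nr] := sol_space sol t0S; exact: norm12_integrable. Qed.

(** A sequence suffices for measurability and integrability of the derivative; it comes from the
    left so as to stay in [[0, S]] when [t = S]. *)
Let seq_left t : 0 < t <= S ->
  (t - t / n.+2%:R) @[n --> \oo] --> within D (dnbhs t).
Proof.
move=> /andP[t0 tS].
have cv : (t - t / n.+2%:R) @[n --> \oo] --> t.
  rewrite -[X in _ --> X]subr0; apply: cvgB; first exact: cvg_cst.
  rewrite -(mulr0 t); apply: cvgM; first exact: cvg_cst.
  by have := @cvg_harmonic R; rewrite -(cvg_shiftS (@harmonic R)).
move=> P hP.
have h : nbhs t [set r | r != t -> D r -> P r].
  exact: hP.
have hn : \forall n \near \oo, t - t / n.+2%:R != t -> D (t - t / n.+2%:R) -> P (t - t / n.+2%:R).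
  exact: cv _ h.
suff : \forall n \near \oo, P (t - t / n.+2%:R) by [].
apply: filterS hn => n.
have n0 : 0 < t / n.+2%:R by rewrite divr_gt0.
have nt : t / n.+2%:R <= t by rewrite ler_pdivrMr// ler_peMr ?(ltW t0)// ler1n.
apply; first by rewrite lt_eqF// gtrBl.
by rewrite /D /= in_itv/= subr_ge0 nt/= (le_trans _ tS)// gerBl ltW.
Qed.

Let integrable_quot t r : 0 <= t <= S -> 0 <= r <= S ->
  mu.-integrable setT (EFin \o (fun u => (r - t)^-1 * (rho r u - rho t u))).
Proof.
move=> tS rS.
apply: (@integrableZl _ _ _ mu setT measurableT (r - t)^-1 (fun u => (rho r u - rho t u)%:E)).
apply: (@integrableB _ _ _ mu setT measurableT (EFin \o rho r) (EFin \o rho t));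
  exact: solution_integrable.
Qed.

(** Pointwise limits along [seq_left] give measurability. One index with finite [norm12] then writes
    [drho] as a difference of two integrable functions. *)
Lemma solution_derivative_integrable t (drho : R -> R) : 0 < t <= S ->
  (forall u, (fun r => (r - t)^-1 * (rho r u - rho t u)) @ within D (dnbhs t) --> drho u) ->
  (fun r => norm12 (fun u => (r - t)^-1 * (rho r u - rho t u) - drho u))
    @ within D (dnbhs t) --> 0%E ->
  mu.-integrable setT (EFin \o drho).
Proof.
move=> t0S cv nv; have sl := seq_left t0S; move: t0S => /andP[t0 tS].
have tS' : 0 <= t <= S by rewrite (ltW t0).
pose r (n : nat) := t - t / n.+2%:R.
have rS n : 0 <= r n <= S.
  have n0 : 0 < t / n.+2%:R by rewrite divr_gt0.
  have nt : t / n.+2%:R <= t by rewrite ler_pdivrMr// ler_peMr ?(ltW t0)// ler1n.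
  by rewrite subr_ge0 nt/= (le_trans _ tS)// gerBl ltW.
have mq n : measurable_fun setT (fun u => (r n - t)^-1 * (rho (r n) u - rho t u)).
  by have /integrableP[/measurable_EFinP] := integrable_quot tS' (rS n).
have md : measurable_fun setT drho.
  apply: (@measurable_fun_cvg _ _ _ setT
    (fun n u => (r n - t)^-1 * (rho (r n) u - rho t u))) => // u _.
  exact: (@cvg_comp _ _ _ r (fun r => (r - t)^-1 * (rho r u - rho t u)) _ _ _ sl (cv u)).
have := @cvg_comp _ _ _ r _ _ _ _ sl nv.
move=> /fine_cvgP[[n _ /(_ n (leqnn n)) /= fn] _].
have qi : mu.-integrable setT (EFin \o (fun u => (r n - t)^-1 * (rho (r n) u - rho t u) - drho u)).
  apply: norm12_integrable; first exact: measurable_funB.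
  by rewrite ltey_eq fn.
have := @integrableB _ _ _ mu setT measurableT _ _ (integrable_quot tS' (rS n)) qi.
apply: eq_integrable => // u _ /=.
by rewrite -EFinB subKr.
Qed.

(* A functional [L], bounded for [norm12], that diagonalizes [A]: along the solution
   [L (rho t)] solves the scalar equation y' = - a y. *)
Section functional.
Variables (L : (R -> R) -> R) (a : R).
Hypothesis LB : forall f g, mu.-integrable setT (EFin \o f) ->
  mu.-integrable setT (EFin \o g) -> L (fun u => f u - g u) = L f - L g.
Hypothesis LZ : forall c f, mu.-integrable setT (EFin \o f) ->
  L (fun u => c * f u) = c * L f.
Hypothesis Lle : forall f, measurable_fun setT f -> mu.-integrable setT (EFin \o f) ->
  ((`|L f|)%:E <= norm12 f)%E.
Hypothesis LA : forall phi psi, mu.-integrable setT (EFin \o phi) ->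
  mu.-integrable setT (EFin \o psi) -> A phi psi -> L psi = - a * L phi.

Let y r := L (rho r).

Let L_quot t r drho : 0 <= t <= S -> 0 <= r <= S -> mu.-integrable setT (EFin \o drho) ->
  L (fun u => (r - t)^-1 * (rho r u - rho t u) - drho u) = (r - t)^-1 * (y r - y t) - L drho.
Proof.
move=> tS rS di; rewrite LB//; last exact: integrable_quot.
rewrite LZ; first by rewrite LB//; exact: solution_integrable.
by apply: (@integrableB _ _ _ mu setT measurableT (EFin \o rho r) (EFin \o rho t));
  exact: solution_integrable.
Qed.

Let y_cont t : D t -> y @ within D (nbhs t) --> y t.
Proof.
rewrite /D /= in_itv/= => tS.
apply: (@cvg_sub0 _ _ _ _ _ y (cst (y t))); last exact: cvg_cst.
apply: (cvg0_norm12 _ (sol_cont sol tS)).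
have : \forall r \near within D (nbhs t), D r by exact: withinT.
apply: filterS => r; rewrite /D/= in_itv/= => rS.
have ri := solution_integrable rS; have ti := solution_integrable tS.
rewrite -[X in `|X|]/(L (rho r) - L (rho t)) -LB//; apply: Lle.
  by apply: measurable_funB; exact: solution_measurable.
exact: (@integrableB _ _ _ mu setT measurableT (EFin \o rho r) (EFin \o rho t)).
Qed.

Let y_cvg t : 0 < t <= S ->
  (r - t)^-1 * (y r - y t) @[r --> within D (dnbhs t)] --> - a * y t.
Proof.
move=> t0S; have [drho Ad [cv nv]] := sol_eq sol t0S.
have di := solution_derivative_integrable t0S cv nv.
have tS : 0 <= t <= S by case/andP: t0S => /ltW -> ->.
rewrite -(LA (solution_integrable tS) di Ad).
apply: (@cvg_sub0 _ _ _ _ _ _ (cst (L drho))); last exact: cvg_cst.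
apply: (cvg0_norm12 _ nv).
have : \forall r \near within D (dnbhs t), D r by exact: withinT.
apply: filterS => r; rewrite /D/= in_itv/= => rS.
rewrite -[X in `|X|]/((r - t)^-1 * (y r - y t) - L drho) -L_quot//.
have qi := @integrableB _ _ _ mu setT measurableT _ _ (integrable_quot tS rS) di.
by apply: Lle => //; have /integrableP[/measurable_EFinP] := qi.
Qed.

Let y_derive t : 0 < t < S -> is_derive t (1 : R) y (- a * y t).
Proof.
move=> /andP[t0 tS].
have h0 : (h : R) + t @[h --> (0 : R)] --> t.
  by rewrite -[X in _ --> X]add0r; apply: cvgD => //; exact: cvg_cst.
have nD : nbhs t D.
  exists (Num.min t (S - t)) => /=; first by rewrite lt_min t0 subr_gt0.
  move=> r /=; rewrite /D/= in_itv/= lt_min !ltr_norml => /andP[/andP[? ?] /andP[? ?]].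
  by apply/andP; split; lra.
have tS' : 0 < t <= S by rewrite t0 ltW.
have cv : h^-1 *: (y (h *: (1 : R) + t) - y t) @[h --> (0 : R)^'] --> - a * y t.
  move=> P hP; have hQ : nbhs t [set r | r != t -> D r -> P ((r - t)^-1 * (y r - y t))].
    exact: (y_cvg tS' hP).
  have nQ : nbhs t [set r | r != t -> P ((r - t)^-1 * (y r - y t))].
    by apply: filterS2 hQ nD => r /= h Dr rt; exact: h.
  have nP : nbhs (0 : R) [set h | h + t != t -> P ((h + t - t)^-1 * (y (h + t) - y t))].
    exact: (h0 _ nQ).
  suff : nbhs (0 : R) [set h | h != 0 -> P (h^-1 *: (y (h *: (1 : R) + t) - y t))] by [].
  apply: filterS nP => h /= hP' hn0.
  have := hP'; rewrite addrK -subr_eq0 addrK => /(_ hn0).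
  by rewrite /GRing.scale/= mulr1.
split; first by apply/cvg_ex; eexists; exact: cv.
exact: cvg_lim cv.
Qed.

(** With the integrating factor, [expR (r * a) * y r] has derivative 0 in the interior and is
    continuous up to the endpoints, hence takes the same value at 0 and at [t]. *)
Lemma solution_functional t : 0 <= t <= S -> L (rho t) = expR (- (t * a)) * L f0.
Proof.
move=> /andP[]; rewrite le_eqVlt => /predU1P[<- _|t0 tS].
  rewrite mul0r oppr0 expR0 mul1r; congr L; apply/funext => u.
  exact: sol_init sol u.
pose z r := expR (r * a) * y r.
have dz (r : R) : r \in `]0, t[ -> is_derive r (1 : R) z 0.
  rewrite in_itv/= => /andP[r0 rt].
  have h1 : is_derive r (1 : R) y (- a * y r).
    by apply: y_derive; rewrite r0 (lt_le_trans rt).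
  apply: is_derive_eq; rewrite /GRing.scale/=.
  by ring.
have cz : {within `[0, t], continuous z}.
  apply/subspace_continuousP => r rt.
  have Dr : D r.
    by move: rt; rewrite /D /= !in_itv/= => /andP[-> rt]; rewrite (le_trans rt).
  apply: cvgM.
    apply: cvg_within_filter; apply: continuous_cvg; first exact: continuous_expR.
    by apply: cvgM => //; exact: cvg_cst.
  apply: cvg_trans (y_cont Dr); apply: cvg_app.
  by apply: within_subset => // x; rewrite /D/= !in_itv/= => /andP[-> xt]; rewrite (le_trans xt).
have [c _] := MVT t0 dz cz.
rewrite mul0r => /eqP; rewrite subr_eq0 => /eqP.
rewrite /z mul0r expR0 mul1r => h.
rewrite expRN -[L f0](_ : y 0 = _); last first.
  by congr L; apply/funext => u; exact: sol_init sol u.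
by rewrite -h mulrA mulVf ?mul1r// gt_eqF ?expR_gt0.
Qed.

End functional.

Variable a : R -> R.
Hypothesis Aa : forall phi psi, mu.-integrable setT (EFin \o phi) ->
  mu.-integrable setT (EFin \o psi) -> A phi psi ->
  forall xi, fcos psi xi = - a xi * fcos phi xi /\ fsin psi xi = - a xi * fsin phi xi.

Lemma solution_fcos t xi : 0 <= t <= S ->
  fcos (rho t) xi = expR (- (t * a xi)) * fcos f0 xi.
Proof.
apply: (@solution_functional (fcos ^~ xi)).
- move=> f g fi gi; rewrite /fcos -RintegralB//; [|exact: integrable_mul_cos..].
  by apply: eq_Rintegral => u _; rewrite mulrBl.
- move=> c f fi; rewrite /fcos -RintegralZl//; last exact: integrable_mul_cos.
  by apply: eq_Rintegral => u _; rewrite mulrA.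
- by move=> f; exact: normr_fcos_le_norm12.
- by move=> phi psi i1 i2 /(Aa i1 i2)/(_ xi)[].
Qed.

Lemma solution_fsin t xi : 0 <= t <= S ->
  fsin (rho t) xi = expR (- (t * a xi)) * fsin f0 xi.
Proof.
apply: (@solution_functional (fsin ^~ xi)).
- move=> f g fi gi; rewrite /fsin -RintegralB//; [|exact: integrable_mul_sin..].
  by apply: eq_Rintegral => u _; rewrite mulrBl.
- move=> c f fi; rewrite /fsin -RintegralZl//; last exact: integrable_mul_sin.
  by apply: eq_Rintegral => u _; rewrite mulrA.
- by move=> f; exact: normr_fsin_le_norm12.
- by move=> phi psi i1 i2 /(Aa i1 i2)/(_ xi)[].
Qed.

End SymbolODE.

(** * Symbols of the two generators and decay of the transforms *)

Section Symbols.
Context {R : realType}.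
Notation mu := (@lebesgue_measure R).
Implicit Types (phi psi f : R -> R) (p u xi : R).

Let integrable_decay (b C : R) f : measurable_fun setT f -> (forall xi, `|f xi| <= C) ->
  0 < b -> (forall xi, 1 <= `|xi| -> `|f xi| <= C * expR (- (b * `|xi|))) ->
  mu.-integrable setT (EFin \o f).
Proof.
move=> mf fC b0 fb.
have C0 : 0 <= C by exact: le_trans (normr_ge0 _) (fC 0).
(* The factor [expR b] keeps the majorant above [C] for frequencies of modulus at most 1. *)
apply: (@le_integrable _ _ _ mu setT measurableT _ (fun xi => (C * expR b)%:E * (abel b xi)%:E)%E).
- exact/measurable_EFinP.
- move=> xi _; rewrite -EFinM /= lee_fin [leRHS]ger0_norm; last first.
    by rewrite !mulr_ge0// ?expR_ge0// abel_ge0.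
  have [x1|/ltW x1] := leP 1 `|xi|.
    rewrite (le_trans (fb _ x1))// /abel ler_wpM2r ?expR_ge0//.
    by rewrite ler_peMr// -expR0 ler_expR ltW.
  rewrite (le_trans (fC _))// /abel -mulrA -expRD ler_peMr// -[leLHS]expR0 ler_expR.
  by rewrite subr_ge0 ler_piMr// ltW.
- by apply: integrableZl => //; exact: integrable_abel.
Qed.

Variables (gamma B : R).
Hypothesis gamma0 : 0 < gamma.

Section levy.
Hypothesis B0 : 0 < B.

Let psi_ := fun xi : R => levy_psi gamma B (2 * pi * xi).

Let G1 phi xi := - psi_ xi * fcos phi xi.
Let G2 phi xi := - psi_ xi * fsin phi xi.

Let LB_integrandE phi p xi :
  LB_integrand gamma B phi p xi =
  ((G1 phi xi * cos (2 * pi * p * xi) + G2 phi xi * sin (2 * pi * p * xi)) +i*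
   (G2 phi xi * cos (2 * pi * p * xi) - G1 phi xi * sin (2 * pi * p * xi)))%C.
Proof.
rewrite /LB_integrand fourierE PhiBE// /cis cosN sinN /G1 /G2 -/(psi_ xi).
move: (fcos _ _) (fsin _ _) (psi_ xi) (cos _) (sin _) => a b c d e.
by apply/eqP; rewrite eq_complex /=; apply/andP; split; apply/eqP; ring.
Qed.

(** The point [p = 0] suffices, the kernel of the inverse transform being 1 there. *)
Lemma LB_graph_integrable phi psi : LB_graph gamma B phi psi ->
  mu.-integrable setT (EFin \o (fun xi => levy_psi gamma B (2 * pi * xi) * fcos phi xi)) /\
  mu.-integrable setT (EFin \o (fun xi => levy_psi gamma B (2 * pi * xi) * fsin phi xi)).
Proof.
move=> [/(_ 0)[i1 i2] _]; split.
  have := @integrableZl _ _ _ mu setT measurableT (-1) _ i1.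
  apply: eq_integrable => // xi _; rewrite LB_integrandE /=.
  by rewrite mulr0 mul0r cos0 sin0 /G1 /psi_ -EFinM; congr EFin; ring.
have := @integrableZl _ _ _ mu setT measurableT (-1) _ i2.
apply: eq_integrable => // xi _; rewrite LB_integrandE /=.
by rewrite mulr0 mul0r cos0 sin0 /G2 /psi_ -EFinM; congr EFin; ring.
Qed.

Let psi_cont : continuous psi_.
Proof.
move=> x; apply: (@continuous_comp _ _ _ (fun x => 2 * pi * x) (levy_psi gamma B)).
  by apply: cvgM => //; exact: cvg_cst.
exact: continuous_levy_psi.
Qed.

(* Membership in the graph only says that psi is the inverse transform of
   [- levy_psi * fourier phi]; Fourier inversion recovers the symbol. *)
Lemma LB_graph_symbol phi psi : mu.-integrable setT (EFin \o phi) ->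
  mu.-integrable setT (EFin \o psi) -> LB_graph gamma B phi psi ->
  forall xi, fcos psi xi = - levy_psi gamma B (2 * pi * xi) * fcos phi xi /\
             fsin psi xi = - levy_psi gamma B (2 * pi * xi) * fsin phi xi.
Proof.
move=> phii psii Ap; have [i1 i2] := LB_graph_integrable Ap.
have g1i : mu.-integrable setT (EFin \o G1 phi).
  have := @integrableZl _ _ _ mu setT measurableT (-1) _ i1.
  by apply: eq_integrable => // xi _; rewrite /G1 /= -EFinM mulN1r mulNr.
have g2i : mu.-integrable setT (EFin \o G2 phi).
  have := @integrableZl _ _ _ mu setT measurableT (-1) _ i2.
  by apply: eq_integrable => // xi _; rewrite /G2 /= -EFinM mulN1r mulNr.
have c1 : continuous (G1 phi).
  by move=> x; apply: cvgM; [apply: cvgN; exact: psi_cont|exact: continuous_fcos].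
have c2 : continuous (G2 phi).
  by move=> x; apply: cvgM; [apply: cvgN; exact: psi_cont|exact: continuous_fsin].
have [_ E] := Ap.
have E' p : (psi p)%:C%C =
    ((fcos (G1 phi) p + fsin (G2 phi) p) +i* (fcos (G2 phi) p - fsin (G1 phi) p))%C.
  rewrite E /LB /cintegral /fcos /fsin; congr (_ +i* _)%C.
    rewrite -RintegralD//; [|exact: integrable_mul_cos|exact: integrable_mul_sin].
    by apply: eq_Rintegral => xi _; rewrite LB_integrandE.
  rewrite -RintegralB//; [|exact: integrable_mul_cos|exact: integrable_mul_sin].
  by apply: eq_Rintegral => xi _; rewrite LB_integrandE.
have [h1 h2] := fcos_fsin_inverse g1i g2i psii c1 c2
  (fun p => congr1 (@complex.Re R) (E' p)) (fun p => congr1 (@complex.Im R) (E' p)).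
by move=> xi; split; [exact: h1|exact: h2].
Qed.

(** At high frequency [levy_psi_ge] controls [f] by its product with the symbol; at low frequency
    [f] is bounded, and the multiple of [abel 1] exceeds its bound. *)
Let decay f : continuous f -> (exists C, forall xi, `|f xi| <= C) ->
  mu.-integrable setT (EFin \o (fun xi => psi_ xi * f xi)) ->
  mu.-integrable setT (EFin \o f).
Proof.
move=> cf [C fC] i.
have k0 := levy_psi_gt0 gamma0 B0; set k := levy_psi gamma B 1 in k0.
have mf : measurable_fun setT f by exact: continuous_measurable_fun.
have C0 : 0 <= C by exact: le_trans (normr_ge0 _) (fC 0).
have h1 := @integrable_norm _ _ _ mu setT _ i.
have h2 := @integrableZl _ _ _ mu setT measurableT k^-1 _ h1.
have h3 := @integrableZl _ _ _ mu setT measurableT (C * expR 1) _ (@integrable_abel R 1 ltr01).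
apply: (@le_integrable _ _ _ mu setT measurableT _ _ _ _ (@integrableD _ _ _ mu setT measurableT _ _ h2 h3)).
  exact/measurable_EFinP.
move=> xi _; rewrite /= lee_fin.
have a0 : 0 <= C * expR 1 * abel 1 xi by rewrite !mulr_ge0 ?expR_ge0 ?abel_ge0.
have b0 : 0 <= k^-1 * `|psi_ xi * f xi| by rewrite mulr_ge0// invr_ge0 ltW.
rewrite [leRHS]ger0_norm ?addr_ge0//.
have [x1|x1] := leP 1 `|2 * pi * xi|.
  apply: (@le_trans _ _ (k^-1 * `|psi_ xi * f xi|)); last by rewrite lerDl.
  have kp := levy_psi_ge gamma0 B0 x1; rewrite -/k -/(psi_ xi) in kp.
  rewrite normrM mulrA ler_peMl// mulrC ler_pdivlMr// mul1r.
  by rewrite (le_trans kp)// ler_norm.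
apply: (@le_trans _ _ (C * expR 1 * abel 1 xi)); last by rewrite lerDr.
rewrite (le_trans (fC _))// /abel -mulrA -expRD ler_peMr// -[leLHS]expR0 ler_expR.
rewrite subr_ge0 mul1r (le_trans _ (ltW x1))// normrM ler_peMl//.
rewrite ger0_norm ?mulr_ge0 ?pi_ge0//.
by have := @pi_ge2 R; lra.
Qed.

Lemma LB_graph_integrable_fourier phi psi : mu.-integrable setT (EFin \o phi) ->
  LB_graph gamma B phi psi ->
  mu.-integrable setT (EFin \o fcos phi) /\ mu.-integrable setT (EFin \o fsin phi).
Proof.
move=> phii Ap; have [i1 i2] := LB_graph_integrable Ap.
split; apply: decay => //.
- exact: continuous_fcos.
- by exists (\int[mu]_u `|phi u|) => xi; exact: normr_fcos_le.
- exact: continuous_fsin.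
- by exists (\int[mu]_u `|phi u|) => xi; exact: normr_fsin_le.
Qed.

End levy.

Lemma neg_frac_lap_graph_symbol (c beta : R) phi psi :
  scale_graph c (neg_frac_lap_graph beta) phi psi ->
  forall xi, fcos psi xi = - (c * `|2 * pi * xi| `^ beta) * fcos phi xi /\
             fsin psi xi = - (c * `|2 * pi * xi| `^ beta) * fsin phi xi.
Proof.
move=> [chi [phii chii E] ->] xi.
have := E xi; rewrite !fourierE => /eqP; rewrite eq_complex /=.
rewrite !(mul0r, mulr0, subr0, oppr0, addr0) => /andP[/eqP h1 /eqP h2].
have e1 : fcos (fun u => c * chi u) xi = c * fcos chi xi.
  rewrite /fcos -RintegralZl//; last exact: integrable_mul_cos.
  by apply: eq_Rintegral => u _; rewrite mulrA.
have e2 : fsin (fun u => c * chi u) xi = c * fsin chi xi.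
  rewrite /fsin -RintegralZl//; last exact: integrable_mul_sin.
  by apply: eq_Rintegral => u _; rewrite mulrA.
by rewrite e1 e2 h1 h2; split; ring.
Qed.

(** Since [beta >= 1], the symbol grows at least linearly, and the exponential factor decays like
    [abel (t * c)]. *)
Lemma integrable_stable_decay (c beta t C : R) f : 0 < c -> 1 <= beta -> 0 < t ->
  measurable_fun setT f -> (forall xi, `|f xi| <= C) ->
  mu.-integrable setT (EFin \o
    (fun xi => expR (- (t * (c * `|2 * pi * xi| `^ beta))) * f xi)).
Proof.
move=> c0 b1 t0 mf fC.
have C0 : 0 <= C by exact: le_trans (normr_ge0 _) (fC 0).
have mpow : measurable_fun setT (fun xi : R => `|2 * pi * xi| `^ beta).
  apply: (@measurableT_comp _ _ _ _ _ _ (@powR R ^~ beta)); first exact: measurable_powR.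
  by apply: measurableT_comp => //; exact: measurable_funM.
apply: (@integrable_decay (t * c) C).
- apply: measurable_funM => //; apply: measurableT_comp => //.
  by apply: measurableT_comp => //; apply: measurable_funM => //; exact: measurable_funM.
- move=> xi; rewrite normrM (le_trans _ (fC xi))// ler_piMl// ger0_norm ?expR_ge0//.
  by rewrite expR_le1 oppr_le0 mulr_ge0 ?(ltW t0)// mulr_ge0 ?powR_ge0 ?(ltW c0).
- exact: mulr_gt0.
- move=> xi x1; rewrite normrM mulrC ler_pM// ger0_norm ?expR_ge0// ler_expR lerN2.
  rewrite -mulrA ler_pM2l// ler_pM2l//.
  have h : `|xi| <= `|2 * pi * xi|.
    rewrite normrM ler_peMl// ger0_norm ?mulr_ge0 ?pi_ge0//.
    by have := @pi_ge2 R; lra.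
  rewrite (le_trans h)// -[leLHS]powRr1// ler_powR// (le_trans x1)//.
Qed.

End Symbols.

(** * Convergence of the evolutions *)

Section Convergence.
Context {R : realType}.
Notation mu := (@lebesgue_measure R).
Implicit Types (f : R -> R) (a : R -> R) (t x y xi : R).

Lemma Lnorm2E f :
  'N[mu]_(2%:E)[EFin \o f]%E = ((\int[mu]_x ((f x) ^+ 2)%:E) `^ (2^-1))%E.
Proof.
rewrite unlock /=; congr (_ `^ _)%E; apply: eq_integral => x _.
by rewrite /= powR_mulrn// real_normK// num_real.
Qed.

(** After factoring out the larger exponential, 1 - e^(-s) <= min(1, s) with s = t (y - x). The
    resulting bound is uniform in [t]. *)
Let expRN_dist_le_aux t T x y : 0 <= t <= T -> 0 <= x -> x <= y ->
  `|expR (- (t * x)) - expR (- (t * y))| <= Num.min 1 (T * `|x - y|).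
Proof.
move=> /andP[t0 tT] x0 xy.
have E : expR (- (t * x)) - expR (- (t * y)) =
    expR (- (t * x)) * (1 - expR (- (t * (y - x)))).
  by rewrite mulrBr mulr1 -expRD; congr (_ - expR _); ring.
have e0 : 0 <= 1 - expR (- (t * (y - x))).
  by rewrite subr_ge0 expR_le1 oppr_le0 mulr_ge0// subr_ge0.
have e1 : expR (- (t * x)) <= 1 by rewrite expR_le1 oppr_le0 mulr_ge0.
rewrite ger0_norm ?E; last by rewrite mulr_ge0// expR_ge0.
apply: (@le_trans _ _ (1 - expR (- (t * (y - x))))); first by rewrite ler_piMl.
rewrite le_min lerBlDr lerDl expR_ge0/=.
rewrite distrC ger0_norm ?subr_ge0//.
apply: (@le_trans _ _ (t * (y - x))); last by rewrite ler_wpM2r// subr_ge0.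
have := expR_ge1Dx (- (t * (y - x))); lra.
Qed.

Lemma expRN_dist_le t T x y : 0 <= t <= T -> 0 <= x -> 0 <= y ->
  `|expR (- (t * x)) - expR (- (t * y))| <= Num.min 1 (T * `|x - y|).
Proof.
move=> tT x0 y0; have [xy|/ltW yx] := leP x y; first exact: expRN_dist_le_aux.
by rewrite distrC (distrC x y); exact: expRN_dist_le_aux.
Qed.

(** All that the comparison of two evolutions uses. It forgets the operator, is shared by both
    generators, and survives a change of time scale, which only multiplies the symbol. *)
Record fourier_evolution (T : R) (a f0 : R -> R) (rho : R -> R -> R) : Prop := {
  evolution_init : forall u, rho 0 u = f0 u;
  evolution_integrable : forall t, 0 <= t <= T -> mu.-integrable setT (EFin \o rho t);
  evolution_fcos : forall t xi, 0 <= t <= T ->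
    fcos (rho t) xi = expR (- (t * a xi)) * fcos f0 xi;
  evolution_fsin : forall t xi, 0 <= t <= T ->
    fsin (rho t) xi = expR (- (t * a xi)) * fsin f0 xi;
  evolution_fourier_integrable : forall t, 0 < t <= T ->
    mu.-integrable setT (EFin \o fcos (rho t)) /\
    mu.-integrable setT (EFin \o fsin (rho t)) }.

Definition sqr_fourier f xi : R := fcos f xi ^+ 2 + fsin f xi ^+ 2.

Lemma sqr_fourier_ge0 f xi : 0 <= sqr_fourier f xi.
Proof. by rewrite addr_ge0 ?sqr_ge0. Qed.

Lemma measurable_sqr_fourier f : mu.-integrable setT (EFin \o f) ->
  measurable_fun setT (sqr_fourier f).
Proof.
move=> fi; apply: measurable_funD; apply: measurable_funX.
  by apply: continuous_measurable_fun; exact: continuous_fcos.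
by apply: continuous_measurable_fun; exact: continuous_fsin.
Qed.

Section distance.
Variables (T : R) (f0 : R -> R).
Hypothesis T0 : 0 < T.

Let evo_init (a : R -> R) rho : fourier_evolution T a f0 rho -> rho 0 = f0.
Proof. by move=> ev; apply/funext => u; exact: (evolution_init ev). Qed.

Let f0i a rho : fourier_evolution T a f0 rho -> mu.-integrable setT (EFin \o f0).
Proof.
move=> ev; rewrite -(evo_init ev); apply: (evolution_integrable ev).
by rewrite lexx ltW.
Qed.

Lemma evolution_Lnorm2_le (a a0 : R -> R) sigma rho t :
  (forall xi, 0 <= a xi) -> (forall xi, 0 <= a0 xi) ->
  measurable_fun setT a -> measurable_fun setT a0 ->
  fourier_evolution T a f0 sigma -> fourier_evolution T a0 f0 rho -> 0 <= t <= T ->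
  ('N[mu]_(2%:E)[(fun u => (sigma t u - rho t u)%:E)] <=
   (\int[mu]_xi ((Num.min 1 (T * `|a xi - a0 xi|)) ^+ 2 * sqr_fourier f0 xi)%:E) `^ (2^-1))%E.
Proof.
move=> ap a0p ma ma0 es er tT.
rewrite -[(fun u => _)]/(EFin \o (fun u => sigma t u - rho t u)) Lnorm2E.
apply: gt0_ler_poweR; rewrite ?nnegrE ?invr_ge0//.
- by rewrite in_itv/= leey andbT; apply: integral_ge0 => x _; rewrite lee_fin sqr_ge0.
- rewrite in_itv/= leey andbT; apply: integral_ge0 => x _.
  by rewrite lee_fin mulr_ge0 ?sqr_ge0// sqr_fourier_ge0.
have [t0|t0] := eqVneq t 0.
  rewrite t0 (evo_init es) (evo_init er).
  under eq_integral do rewrite subrr expr0n /=.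
  rewrite integral0; apply: integral_ge0 => x _.
  by rewrite lee_fin mulr_ge0 ?sqr_ge0// sqr_fourier_ge0.
have tT' : 0 < t <= T by rewrite lt_neqAle eq_sym t0.
have si := evolution_integrable es tT; have ri := evolution_integrable er tT.
have [sc ss] := evolution_fourier_integrable es tT'.
have [rc rs] := evolution_fourier_integrable er tT'.
pose w u := sigma t u - rho t u.
have wi : mu.-integrable setT (EFin \o w).
  exact: (@integrableB _ _ _ mu setT measurableT _ _ si ri).
have wc xi : fcos w xi = fcos (sigma t) xi - fcos (rho t) xi.
  rewrite /fcos -RintegralB//; [|exact: integrable_mul_cos..].
  by apply: eq_Rintegral => u _; rewrite mulrBl.
have ws xi : fsin w xi = fsin (sigma t) xi - fsin (rho t) xi.
  rewrite /fsin -RintegralB//; [|exact: integrable_mul_sin..].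
  by apply: eq_Rintegral => u _; rewrite mulrBl.
have wci : mu.-integrable setT (EFin \o fcos w).
  apply: eq_integrable (@integrableB _ _ _ mu setT measurableT _ _ sc rc) => // xi _.
  by rewrite /= wc EFinB.
have wsi : mu.-integrable setT (EFin \o fsin w).
  apply: eq_integrable (@integrableB _ _ _ mu setT measurableT _ _ ss rs) => // xi _.
  by rewrite /= ws EFinB.
rewrite (plancherel wi wci wsi); apply: ge0_le_integral_nonmeasurable => xi _.
  by rewrite lee_fin addr_ge0 ?sqr_ge0.
rewrite lee_fin wc ws.
rewrite (evolution_fcos es _ tT) (evolution_fcos er _ tT).
rewrite (evolution_fsin es _ tT) (evolution_fsin er _ tT).
rewrite -!mulrBl !exprMn -mulrDr ler_wpM2r ?sqr_fourier_ge0//.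
rewrite -real_normK ?num_real// ler_pXn2r ?nnegrE// ?expRN_dist_le//.
by rewrite le_min ler01 mulr_ge0 ?(ltW T0).
Qed.

Hypothesis f0_fourier : mu.-integrable setT (EFin \o sqr_fourier f0).

(** The bound on the L^2 norm is the same for all [t], so the distance is at most [T] times the
    square root of an integral over frequencies alone. *)
Lemma distL1L2_evolution_cvg0 (a : nat -> R -> R) (a0 : R -> R) sigma rho :
  (forall n xi, 0 <= a n xi) -> (forall xi, 0 <= a0 xi) ->
  (forall n, measurable_fun setT (a n)) ->
  (forall xi, a n xi @[n --> \oo] --> a0 xi) ->
  (forall n, fourier_evolution T (a n) f0 (sigma n)) ->
  fourier_evolution T a0 f0 rho ->
  distL1L2 T (sigma n) rho @[n --> \oo] --> 0%E.
Proof.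
move=> ap a0p ma ca es er.
have ma0 : measurable_fun setT a0 by exact: (@measurable_fun_cvg _ _ _ setT a).
pose m n xi := Num.min 1 (T * `|a n xi - a0 xi|).
have m0 n xi : 0 <= m n xi by rewrite le_min ler01 mulr_ge0 ?(ltW T0).
have m1 n xi : m n xi <= 1 by rewrite ge_min lexx.
have mm n : measurable_fun setT (m n).
  apply: measurable_minr => //; apply: measurable_funM => //.
  by apply: measurableT_comp => //; exact: measurable_funB.
pose h n xi := m n xi ^+ 2 * sqr_fourier f0 xi.
have mh n : measurable_fun setT (h n).
  apply: measurable_funM; first exact: measurable_funX.
  by have /integrableP[/measurable_EFinP] := f0_fourier.
have ch (xi : R) : setT xi -> h n xi @[n --> \oo] --> (0 : R).
  move=> _.
  suff cm : m n xi @[n --> \oo] --> (0 : R).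
    have := cvgM (cvgM cm cm) (@cvg_cst _ (sqr_fourier f0 xi) _ _ _).
    by rewrite !mul0r; exact.
  apply: (@squeeze_cvgr _ _ _ _ (cst 0) (fun n => T * `|a n xi - a0 xi|)).
  - by apply: nearW => n; rewrite m0 /m ge_min lexx orbT.
  - exact: cvg_cst.
  - rewrite -(mulr0 T) -(@normr0 _ R) -(subrr (a0 xi)).
    apply: cvgM; first exact: cvg_cst.
    by apply: cvg_norm; apply: cvgB => //; exact: cvg_cst.
have bh n (xi : R) : setT xi -> `|h n xi| <= sqr_fourier f0 xi.
  move=> _; rewrite ger0_norm ?mulr_ge0 ?sqr_ge0 ?sqr_fourier_ge0//.
  by rewrite ler_piMl ?sqr_fourier_ge0// exprn_ile1.
have [_] := @Rdominated_cvg _ _ _ mu setT h (cst 0) (sqr_fourier f0) measurableT mh ch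
  f0_fourier bh.
rewrite /Rintegral integral0 /= => cI.
pose d n := \int[mu]_xi h n xi.
have hi n : mu.-integrable setT (EFin \o h n).
  apply: (@le_integrable _ _ _ mu setT measurableT _ _ _ _ f0_fourier).
    by apply/measurable_EFinP; exact: mh.
  by move=> xi _ /=; rewrite lee_fin (le_trans (bh n xi I))// ler_norm.
have dE n : (\int[mu]_xi (h n xi)%:E = (d n)%:E)%E.
  by rewrite /d /Rintegral fineK//; exact: (integrable_fin_num measurableT (hi n)).
have d0 n : 0 <= d n.
  by apply: Rintegral_ge0 => xi _; rewrite mulr_ge0 ?sqr_ge0 ?sqr_fourier_ge0.
apply: (@squeeze_cvge _ _ _ _ (cst 0%E) _ (fun n => (Num.sqrt (d n) * T)%:E)).
- apply: nearW => n; apply/andP; split.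
    by apply: integral_ge0 => t _; exact: Lnorm_ge0.
  apply: (@le_trans _ _ (\int[mu]_(t in [set` `[0%R, T] ]) (Num.sqrt (d n))%:E)%E).
    apply: ge0_le_integral_nonmeasurable => t /=; first by move=> _; exact: Lnorm_ge0.
    rewrite in_itv/= => tT.
    have := evolution_Lnorm2_le (ap n) a0p (ma n) ma0 (es n) er tT.
    by rewrite dE poweR_EFin powR12_sqrt.
  rewrite integral_cst//= lebesgue_measure_itv/= lte_fin T0 sube0.
  by rewrite -EFinM.
- exact: cvg_cst.
- apply: cvg_EFin; first exact: nearW.
  rewrite -(mul0r T) -(@sqrtr0 R); apply: cvgM; last exact: cvg_cst.
  by apply: continuous_cvg => //; exact: sqrt_continuous.
Qed.

End distance.

(* Plancherel is only available for t > 0, where the transforms are integrable: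
   ||rho(t)||_2 stays bounded as t tends to 0, and monotone convergence applies. *)
Lemma integrable_sqr_fourier (T : R) (a f0 : R -> R) rho A : 0 < T ->
  (forall xi, 0 <= a xi) -> measurable_fun setT a ->
  is_solution A T f0 rho -> fourier_evolution T a f0 rho ->
  mu.-integrable setT (EFin \o sqr_fourier f0).
Proof.
move=> T0 a0 ma sol ev.
have f0E : rho 0 = f0 by apply/funext => u; exact: evolution_init ev u.
have zT : (0 : R) <= 0 <= T by rewrite lexx ltW.
have f0i : mu.-integrable setT (EFin \o f0).
  by rewrite -f0E; exact: evolution_integrable ev _ zT.
have mf0 : measurable_fun setT f0 by have /integrableP[/measurable_EFinP] := f0i.
pose t (n : nat) := T / n.+1%:R.
have tT n : 0 < t n <= T.
  by rewrite divr_gt0//= ler_pdivrMr// ler_peMr ?(ltW T0)// ler1n.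
have t0T n : 0 <= t n <= T by have /andP[/ltW -> ->] := tT n.
have tcv : t n @[n --> \oo] --> within [set` `[0, T] ] (nbhs (0 : R)).
  have cv : t n @[n --> \oo] --> (0 : R).
    rewrite -(mulr0 T); apply: cvgM; first exact: cvg_cst.
    exact: cvg_harmonic.
  move=> P hP.
  have h : nbhs (0 : R) [set r | [set` `[0, T] ] r -> P r] by exact: hP.
  have hn : \forall n \near \oo, [set` `[0, T] ] (t n) -> P (t n) by exact: cv _ h.
  suff : \forall n \near \oo, P (t n) by [].
  by apply: filterS hn => n; apply; rewrite /= in_itv/=.
have nv := @cvg_comp _ _ _ t _ _ _ _ tcv (sol_cont sol zT).
have N0 : ('N[mu]_(2%:E)[EFin \o f0] < +oo)%E.
  have [_] := sol_space sol zT; rewrite f0E; apply: le_lt_trans.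
  by rewrite /norm12 leeDr ?Lnorm_ge0.
(* By continuity at time 0 and Minkowski, the norms of [rho (t n)] eventually exceed that of [f0] by
   at most 1. *)
pose K := (1 + 'N[mu]_(2%:E)[EFin \o f0])%E.
have K0 : (0 <= K)%E by rewrite adde_ge0 ?Lnorm_ge0.
have Kfin : K \is a fin_num by rewrite ge0_fin_numE// lte_add_pinfty// ltry.
have NK : (\forall n \near \oo, 'N[mu]_(2%:E)[EFin \o rho (t n)] <= K)%E.
  have /fine_cvgP[nf] := nv; move/cvgrPdist_le => /(_ _ ltr01) n1.
  apply: filterS2 nf n1 => n /= nf n1.
  have mr := solution_measurable sol (t0T n).
  have md : measurable_fun setT (fun u => rho (t n) u - f0 u) by exact: measurable_funB.
  rewrite (_ : rho (t n) = ((fun u => rho (t n) u - f0 u) \+ f0)); last first.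
    by apply/funext => u /=; rewrite subrK.
  rewrite (le_trans (minkowski_EFin _ _ _ _))// ?ler1n//.
  rewrite leeD2r//; rewrite -f0E.
  apply: (@le_trans _ _ (norm12 (fun u => rho (t n) u - rho 0 u))).
    by rewrite /norm12 leeDr ?Lnorm_ge0.
  rewrite sub0r normrN in n1.
  by rewrite -(fineK nf) lee_fin (le_trans (ler_norm _)).
pose g n xi := (expR (- (2 * t n * a xi)) * sqr_fourier f0 xi)%:E.
have msq := measurable_sqr_fourier f0i.
have mg n : measurable_fun setT (g n).
  apply/measurable_EFinP; apply: measurable_funM => //; apply: measurableT_comp => //.
  by apply: measurableT_comp => //; exact: measurable_funM.
have g0 n (xi : R) : setT xi -> (0 <= g n xi)%E.
  by move=> _; rewrite lee_fin mulr_ge0 ?expR_ge0 ?sqr_fourier_ge0.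
have ndg (xi : R) : setT xi -> nondecreasing_seq (g ^~ xi).
  move=> _ n k nk; rewrite lee_fin ler_wpM2r ?sqr_fourier_ge0// ler_expR lerN2.
  by rewrite ler_wpM2r// ler_pM2l// ler_pM2l// lef_pV2 ?posrE// ler_nat.
have gE n : (\int[mu]_xi g n xi = 'N[mu]_(2%:E)[EFin \o rho (t n)] `^ 2)%E.
  have [ci si] := evolution_fourier_integrable ev (tT n).
  rewrite Lnorm2E -poweRrM mulVf// poweRe1; last first.
    by apply: integral_ge0 => x _; rewrite lee_fin sqr_ge0.
  rewrite (plancherel (evolution_integrable ev (t0T n)) ci si).
  apply: eq_integral => xi _; rewrite /g /sqr_fourier.
  rewrite (evolution_fcos ev _ (t0T n)) (evolution_fsin ev _ (t0T n)).
  rewrite !exprMn -mulrDr; congr (_ * _)%:E; rewrite expr2 -expRD; congr expR; ring.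
have := @cvg_monotone_convergence _ _ _ mu setT measurableT g mg g0 ndg.
rewrite (_ : (fun x => limn (g ^~ x)) = (EFin \o sqr_fourier f0)); last first.
  apply/funext => xi; apply/cvg_lim => //; apply: cvg_EFin; first exact: nearW.
  have h : - (2 * t n * a xi) @[n --> \oo] --> - (2 * (T * 0) * a xi).
    apply: cvgN; apply: cvgM; last exact: cvg_cst.
    apply: cvgM; first exact: cvg_cst.
    apply: cvgM; first exact: cvg_cst.
    exact: cvg_harmonic.
  have h2 : expR (- (2 * t n * a xi)) @[n --> \oo] --> expR (- (2 * (T * 0) * a xi)).
    exact: (@cvg_comp _ _ _ _ expR _ _ _ h (@continuous_expR R _)).
  rewrite !mulr0 mul0r oppr0 expR0 in h2.
  have := cvgM h2 (@cvg_cst _ (sqr_fourier f0 xi) _ _ _).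
  by rewrite mul1r; exact.
move=> gcv; apply/integrableP; split; first exact/measurable_EFinP.
apply: (@le_lt_trans _ _ (K `^ 2)%E); last first.
  by apply: poweR_lty; rewrite -ge0_fin_numE.
rewrite (_ : (\int[mu]_x _)%E = (\int[mu]_x (EFin \o sqr_fourier f0) x)%E); last first.
  by apply: eq_integral => x _ /=; rewrite ger0_norm ?sqr_fourier_ge0.
apply: cvge_le gcv.
apply: filterS NK => n nK; rewrite gE.
by apply: gt0_ler_poweR => //; rewrite in_itv/= leey ?K0 ?Lnorm_ge0.
Qed.

End Convergence.

(** * The two limits *)

Section Evolutions.
Context {R : realType}.
Notation mu := (@lebesgue_measure R).
Implicit Types (xi t c beta : R) (f : R -> R).
Variable gamma : R.
Hypothesis gamma0 : 0 < gamma.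

Let mscale : measurable_fun setT (fun xi : R => 2 * pi * xi).
Proof. exact: measurable_funM. Qed.

Lemma measurable_levy_symbol B : 0 < B ->
  measurable_fun setT (fun xi : R => levy_psi gamma B (2 * pi * xi)).
Proof.
move=> B0; apply: (@measurableT_comp _ _ _ _ _ _ (levy_psi gamma B)) mscale.
by apply: continuous_measurable_fun; exact: continuous_levy_psi.
Qed.

Lemma measurable_stable_symbol c beta :
  measurable_fun setT (fun xi : R => c * `|2 * pi * xi| `^ beta).
Proof.
apply: measurable_funM => //.
apply: (@measurableT_comp _ _ _ _ _ _ (@powR R ^~ beta)); first exact: measurable_powR.
by apply: measurableT_comp => //; exact: mscale.
Qed.

Lemma stable_psi_gt0 k : 0 < stable_psi gamma k.+1 1.
Proof.
rewrite mulr_gt0 ?divr_gt0 ?pi_gt0//.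
apply: Rintegral_0y_gt0; first exact: integrable_stable_q.
move=> y y0; have d0 : 0 < 16 * gamma ^+ 2 * y ^+ (k.+2).*2.
  by apply: mulr_gt0; [apply: mulr_gt0|]; rewrite ?exprn_gt0.
apply: mulr_gt0; first exact: exprn_gt0.
by apply: divr_gt0; [exact: exprn_gt0|apply: addr_gt0; [exact: exprn_gt0|exact: d0]].
Qed.

(** The coefficient is the value of [stable_psi] at 1, whose integrand is positive. Positivity is
    what makes the transforms decay in [stable_evolution]. *)
Lemma stable_coef32_gt0 : 0 < Gamma (1 + 3 / 2) * gamma `^ (- (1 / 2)) * D_0.
Proof.
have := stable_psi_32 gamma0 1; rewrite normr1 powR1 mulr1 => ->.
exact: stable_psi_gt0.
Qed.

Lemma stable_coef53_gt0 : 0 < Gamma (1 + 5 / 3) * gamma `^ (- (2 / 3)) * D_oo.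
Proof.
have := stable_psi_53 gamma0 1; rewrite normr1 powR1 mulr1 => ->.
exact: stable_psi_gt0.
Qed.

Lemma levy_evolution B S f0 rho : 0 < B -> 0 < S ->
  is_solution (LB_graph gamma B) S f0 rho ->
  fourier_evolution S (fun xi => levy_psi gamma B (2 * pi * xi)) f0 rho.
Proof.
move=> B0 S0 sol; have sym := LB_graph_symbol gamma0 B0; split.
- exact: sol_init sol.
- by move=> t; exact: solution_integrable sol t.
- by move=> t xi; exact: (solution_fcos sol sym xi).
- by move=> t xi; exact: (solution_fsin sol sym xi).
(* For [t > 0] the equation places [rho t] in the domain of the operator, which forces its transform
   to be integrable. *)
- move=> t tS; have [drho Ad _] := sol_eq sol tS.
  apply: LB_graph_integrable_fourier Ad => //.
  by apply: (solution_integrable sol); case/andP: tS => /ltW -> ->.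
Qed.

Lemma stable_evolution c beta S f0 rho : 0 < c -> 1 <= beta -> 0 < S ->
  is_solution (scale_graph c (neg_frac_lap_graph beta)) S f0 rho ->
  fourier_evolution S (fun xi => c * `|2 * pi * xi| `^ beta) f0 rho.
Proof.
move=> c0 b1 S0 sol.
have sym (phi psi : R -> R) (_ : mu.-integrable setT (EFin \o phi))
  (_ : mu.-integrable setT (EFin \o psi)) :=
  @neg_frac_lap_graph_symbol R c beta phi psi.
have f0i : mu.-integrable setT (EFin \o f0).
  rewrite (_ : f0 = rho 0); last by apply/funext => u; rewrite (sol_init sol).
  by apply: (solution_integrable sol); rewrite lexx ltW.
split.
- exact: sol_init sol.
- by move=> t; exact: solution_integrable sol t.
- by move=> t xi; exact: (solution_fcos sol sym xi).
- by move=> t xi; exact: (solution_fsin sol sym xi).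
- move=> t /andP[t0 tS]; have tS' : 0 <= t <= S by rewrite ltW.
  split.
    rewrite (_ : fcos (rho t) = fun xi => expR (- (t * (c * `|2 * pi * xi| `^ beta))) * fcos f0 xi);
      last by apply/funext => xi; exact: (solution_fcos sol sym xi tS').
    apply: (@integrable_stable_decay _ c beta t (\int[mu]_u `|f0 u|)) => //.
      by apply: continuous_measurable_fun; exact: continuous_fcos.
    by move=> xi; exact: normr_fcos_le.
  rewrite (_ : fsin (rho t) = fun xi => expR (- (t * (c * `|2 * pi * xi| `^ beta))) * fsin f0 xi);
    last by apply/funext => xi; exact: (solution_fsin sol sym xi tS').
  apply: (@integrable_stable_decay _ c beta t (\int[mu]_u `|f0 u|)) => //.
    by apply: continuous_measurable_fun; exact: continuous_fsin.
  by move=> xi; exact: normr_fsin_le.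
Qed.

Lemma fourier_evolution_rescale k T (a : R -> R) f0 rho : 0 < k ->
  fourier_evolution (k * T) a f0 rho ->
  fourier_evolution T (fun xi => k * a xi) f0 (fun t => rho (k * t)).
Proof.
move=> k0 ev.
have kT t : (0 <= k * t <= k * T) = (0 <= t <= T).
  by rewrite pmulr_rge0// ler_pM2l.
have kT' t : (0 < k * t <= k * T) = (0 < t <= T).
  by rewrite pmulr_rgt0// ler_pM2l.
split.
- by move=> u; rewrite mulr0 (evolution_init ev).
- by move=> t; rewrite -kT; exact: evolution_integrable ev _.
- move=> t xi; rewrite -kT => tT.
  by rewrite (evolution_fcos ev _ tT) mulrA (mulrC t).
- move=> t xi; rewrite -kT => tT.
  by rewrite (evolution_fsin ev _ tT) mulrA (mulrC t).
- by move=> t; rewrite -kT'; exact: evolution_fourier_integrable ev _.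
Qed.

Lemma levy_evolution_cvg0 T f0 (rhoB : R -> R -> R -> R) rho0 : 0 < T ->
  (forall B : R, 0 < B -> is_solution (LB_graph gamma B) T f0 (rhoB B)) ->
  is_solution (scale_graph (Gamma (1 + 3 / 2) * gamma `^ (- (1 / 2)) * D_0)
    (neg_frac_lap_graph (3 / 2))) T f0 rho0 ->
  distL1L2 T (rhoB B) rho0 @[B --> 0^'+] --> 0%E.
Proof.
move=> T0 solB sol0.
have c0 := stable_coef32_gt0; set c := (X in 0 < X) in c0; rewrite -/c in sol0.
have b1 : (1 : R) <= 3 / 2 by lra.
have ev0 := stable_evolution c0 b1 T0 sol0.
have a0p (xi : R) : 0 <= c * `|2 * pi * xi| `^ (3 / 2) by rewrite mulr_ge0 ?powR_ge0 ?(ltW c0).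
have f0_fourier := integrable_sqr_fourier T0 a0p (measurable_stable_symbol _ _) sol0 ev0.
(* The limit is tested along sequences, as dominated convergence requires. *)
apply/cvge_at_rightP => B [B0 Bcv].
apply: (@distL1L2_evolution_cvg0 _ T f0 T0 f0_fourier
  (fun n xi => levy_psi gamma (B n) (2 * pi * xi))
  (fun xi => c * `|2 * pi * xi| `^ (3 / 2)) (fun n => rhoB (B n)) rho0) => //.
- by move=> n xi; exact: levy_psi_ge0.
- by move=> n; exact: measurable_levy_symbol.
- by move=> xi; rewrite stable_psi_32//; exact: levy_psi_cvg0.
- by move=> n; apply: levy_evolution => //; exact: solB.
Qed.

Lemma levy_evolution_cvgy T f0 (rhoB : R -> R -> R -> R) rhooo : 0 < T ->
  (forall B : R, 0 < B ->
    is_solution (LB_graph gamma B) (B `^ (1 / 3) * T) f0 (rhoB B)) ->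
  is_solution (scale_graph (Gamma (1 + 5 / 3) * gamma `^ (- (2 / 3)) * D_oo)
    (neg_frac_lap_graph (5 / 3))) T f0 rhooo ->
  distL1L2 T (fun t => rhoB B (B `^ (1 / 3) * t)) rhooo @[B --> +oo] --> 0%E.
Proof.
move=> T0 solB sol0.
have c0 := stable_coef53_gt0; set c := (X in 0 < X) in c0; rewrite -/c in sol0.
have b1 : (1 : R) <= 5 / 3 by lra.
have ev0 := stable_evolution c0 b1 T0 sol0.
have a0p (xi : R) : 0 <= c * `|2 * pi * xi| `^ (5 / 3) by rewrite mulr_ge0 ?powR_ge0 ?(ltW c0).
have f0_fourier := integrable_sqr_fourier T0 a0p (measurable_stable_symbol _ _) sol0 ev0.
apply/cvge_pinftyP => u uy.
(* The first terms of [u] may be nonpositive; the maximum gives [B n >= 1] for every [n] and changes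
   only finitely many terms. *)
pose B n := Num.max 1 (u n).
have B1 n : 1 <= B n by rewrite le_max lexx.
have B0 n : 0 < B n by rewrite (lt_le_trans ltr01).
have uB : \forall n \near \oo, B n = u n.
  by have /cvgryPge/(_ 1) := uy; apply: filterS => n u1; apply/max_idPr.
pose k n := B n `^ (1 / 3).
have k3 n : k n ^+ 3 = B n.
  by rewrite -powR_mulrn ?powR_ge0// -powRrM (_ : 1 / 3 * 3%:R = 1) ?powRr1 ?(ltW (B0 n))//; field.
have k0 n : 0 < k n by exact: powR_gt0.
have k1 n : 1 <= k n.
  rewrite leNgt; apply/negP => kn1.
  have := B1 n; rewrite -k3 leNgt => /negP; apply.
  by rewrite exprn_ilt1 ?(ltW (k0 n)).
have ky : k n @[n --> \oo] --> +oo.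
  apply/cvgryPge => M.
  have /cvgryPge/(_ (`|M| ^+ 3)) := uy.
  apply: filterS2 uB => n Bu; rewrite -Bu -k3 => h.
  rewrite (le_trans (ler_norm M))//.
  by rewrite -(@ler_pXn2r _ 3) ?nnegrE ?(ltW (k0 n)).
have cv : distL1L2 T (fun t => rhoB (B n) (k n * t)) rhooo @[n --> \oo] --> 0%E.
  apply: (@distL1L2_evolution_cvg0 _ T f0 T0 f0_fourier
    (fun n xi => k n * levy_psi gamma (B n) (2 * pi * xi))
    (fun xi => c * `|2 * pi * xi| `^ (5 / 3))
    (fun n t => rhoB (B n) (k n * t)) rhooo) => //.
  - by move=> n xi; rewrite mulr_ge0 ?(ltW (k0 n))// levy_psi_ge0.
  - by move=> n; apply: measurable_funM => //; exact: measurable_levy_symbol.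
  - move=> xi; rewrite stable_psi_53//.
    rewrite (_ : (fun n => _) = (fun n => k n * levy_psi gamma (k n ^+ 3) (2 * pi * xi))).
      exact: levy_psi_cvgy.
    by apply/funext => n; rewrite k3.
  - move=> n; apply: fourier_evolution_rescale => //.
    apply: levy_evolution => //; last exact: solB.
    by rewrite mulr_gt0 ?k0.
apply: cvg_trans cv; apply: near_eq_cvg.
by apply: filterS uB => n Bu; rewrite /k Bu.
Qed.

End Evolutions.

(** In the second limit the solution is taken up to time B^(1/3) T, where the rescaled times end. *)
Theorem theorem5p11 (R : realType) (T gamma : R) (f0 : R -> R -> 'I_2 -> R)
    (hT : 0 < T) (hgamma : 0 < gamma)
    (hf0 : forall i : 'I_2, Ccoo_torus (fun u k => f0 u k i)) :
  (forall (rhoB : R -> R -> R -> R) (rho0 : R -> R -> R),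
     (forall B : R, 0 < B ->
        is_solution (LB_graph gamma B) T (fbar f0) (rhoB B)) ->
     is_solution
       (scale_graph (Gamma (1 + 3 / 2) * gamma `^ (- (1 / 2)) * D_0)
          (neg_frac_lap_graph (3 / 2))) T (fbar f0) rho0 ->
     distL1L2 T (rhoB B) rho0 @[B --> 0^'+] --> 0%E)
  /\
  (forall (rhoB : R -> R -> R -> R) (rhooo : R -> R -> R),
     (forall B : R, 0 < B ->
        is_solution (LB_graph gamma B) (B `^ (1 / 3) * T) (fbar f0) (rhoB B)) ->
     is_solution
       (scale_graph (Gamma (1 + 5 / 3) * gamma `^ (- (2 / 3)) * D_oo)
          (neg_frac_lap_graph (5 / 3))) T (fbar f0) rhooo ->
     distL1L2 T (fun t => rhoB B (B `^ (1 / 3) * t)) rhooo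
       @[B --> +oo] --> 0%E).
Proof.
split=> rhoB rho' solB sol'.
- exact: (levy_evolution_cvg0 hgamma hT solB sol').
- exact: (levy_evolution_cvgy hgamma hT solB sol').
Qed.
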